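(* Let $M$ be a smooth compact Riemannian manifold without boundary, let $f: M\to M$ be a $C^2$-Anosov diffeomorphism, and let $y\in M$. Suppose that $f$ is conformal on unstable manifolds, i.e., for each $x\in M$, the derivative map $D_xf|_{E_x^u}: E^u_x\to E^u_{f(x)}$ is a scalar multiple of an isometry. Then the set $$E(f,y)=\{z\in M: y\notin \overline{\{f^k(z): k\in\mathbb{N}\}}\}$$ is a winning set for Schmidt games played on $M$.
   Context: Here $\mathbb{N}=\{0,1,2,\dots\}$. Anosov diffeomorphism: there are constants $\lambda<1<\sigma_1<\sigma_2$ and a nontrivial $Df$-invariant splitting $TM=E^s\oplus E^u$ such that, for some suitable Riemannian metric on $M$, all $x\in M$ and all unit vectors $v^s\in E^s_x$, $v^u\in E^u_x$ satisfy $\|D_xf v^s\|<\lambda<1<\sigma_1<\|D_xf v^u\|<\sigma_2$. Schmidt games on a complete metric space $(X,d)$ (here $X=M$ with the Riemannian distance): $B(x,r)$ denotes the closed ball of center $x$ and radius $r$; for $\omega=(x,r)\in X\times\mathbb{R}_+$ put $B(\omega)=B(x,r)$. Fix $0<\alpha,\beta<1$ and a target set $S\subset X$. Bob starts by choosing a pair $\omega_1=(x_1,r_1)$ with $x_1\in X$, $r_1>0$. Then Alice chooses $\omega_1'=(x_1',r_1')$ with $B(\omega_1')\subset B(\omega_1)$ and $r_1'=\alpha r_1$. In the $k$th turn ($k\ge 2$) Bob chooses $\omega_k=(x_k,r_k)$ with $B(\omega_k)\subset B(\omega_{k-1}')$ and $r_k=\beta r_{k-1}'$, and then Alice chooses $\omega_k'=(x_k',r_k')$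 with $B(\omega_k')\subset B(\omega_k)$ and $r_k'=\alpha r_k$. The intersection of all these nested balls is a single point $x_\infty$. Alice wins if $x_\infty\in S$; otherwise Bob wins. $S$ is $(\alpha,\beta)$-winning if Alice has a strategy to win regardless of how Bob plays; $S$ is $\alpha$-winning if it is $(\alpha,\beta)$-winning for every $0<\beta<1$; $S$ is a winning set if it is $\alpha$-winning for some $0<\alpha<1$. *)

(* Defs.v *)
From HB Require Import structures.
From mathcomp Require Import all_boot all_order all_algebra.
From mathcomp Require Import all_classical all_reals all_analysis.
Set Implicit Arguments.
Unset Strict Implicit.
Unset Printing Implicit Defensive.
Import Order.TTheory GRing.Theory Num.Theory.
Import numFieldNormedType.Exports.
Local Open Scope classical_set_scope.
Local Open Scope ring_scope.

(* Only meaningful for U open.  In finite dimension, continuity of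
   x |-> 'd f x in operator norm is continuity of x |-> 'd f x v for all v. *)
Fixpoint Ck_on (R : realType) (V W : normedModType R) (k : nat)
    (U : set V) (f : V -> W) : Prop :=
  match k with
  | 0%N => forall x, U x -> {for x, continuous f}
  | j.+1 => (forall x, U x -> differentiable f x) /\
            (forall v, Ck_on j U (fun x => 'd f x v))
  end.

(* Both maps are total; they are only meaningful on [chart_dom] and on
   [chart_img], respectively.  Since [chart_img] is open in R^n, there is no
   boundary. *)
Record chart (R : realType) (n : nat) (M : topologicalType) := Chart {
  chart_dom : set M ;
  chart_map : M -> 'rV[R]_n ;
  chart_inv : 'rV[R]_n -> M ;
  chart_img := chart_map @` chart_dom ;
  chart_dom_open : open chart_dom ;
  chart_img_open : open chart_img ;
  chart_mapK : forall x, chart_dom x -> chart_inv (chart_map x) = x ;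
  chart_map_cts : forall x, chart_dom x -> {for x, continuous chart_map} ;
  chart_inv_cts : forall a, chart_img a -> {for a, continuous chart_inv}
}.

(* A map between manifolds, read in the charts c (source) and e (target);
   [local_dom] is the part of R^n on which the local expression makes sense. *)
Definition local_rep (R : realType) (n m : nat) (M N : topologicalType)
    (c : chart R n M) (e : chart R m N) (f : M -> N) : 'rV[R]_n -> 'rV[R]_m :=
  fun a => chart_map e (f (chart_inv c a)).

Definition local_dom (R : realType) (n m : nat) (M N : topologicalType)
    (c : chart R n M) (e : chart R m N) (f : M -> N) : set 'rV[R]_n :=
  chart_map c @` (chart_dom c `&` f @^-1` chart_dom e).

(* A smooth structure on M, given by a smooth atlas.  The atlas selects a
   preferred chart [chart_at x] around each point x: the tangent space at x is
   represented by R^n, a vector v standing for the tangent vector at x whose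
   coordinates in the chart [chart_at x] are v.  No regularity of
   x |-> chart_at x is required. *)
Record smooth_structure (R : realType) (n : nat) (M : topologicalType) :=
  SmoothStructure {
  atlas : set (chart R n M) ;
  chart_at : M -> chart R n M ;
  chart_at_atlas : forall x, atlas (chart_at x) ;
  chart_at_dom : forall x, chart_dom (chart_at x) x ;
  atlas_smooth : forall c e, atlas c -> atlas e ->
    forall k, Ck_on k (local_dom c e id) (local_rep c e id) ;
  manifold_hausdorff : hausdorff_space M ;
  manifold_second_countable : @second_countable M
}.

Section Manifold.
Variables (R : realType) (n : nat) (M : topologicalType).
Variable A : smooth_structure R n M.

Definition Ck_map (k : nat) (f : M -> M) : Prop :=
  continuous f /\
  forall c e, atlas A c -> atlas A e ->
    Ck_on k (local_dom c e f) (local_rep c e f).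

Definition Ck_diffeomorphism (k : nat) (f : M -> M) : Prop :=
  Ck_map k f /\ exists g, [/\ cancel f g, cancel g f & Ck_map k g].

Definition tangent_map (f : M -> M) (x : M) : 'End('rV[R]_n) :=
  linfun ('d (local_rep (chart_at A x) (chart_at A (f x)) f)
             (chart_map (chart_at A x) x)).

(* The vector of the tangent space at [chart_inv c a] whose coordinates in the
   chart c are v. *)
Definition tangent_of_coord (c : chart R n M) (a v : 'rV[R]_n) : 'rV[R]_n :=
  'd (local_rep c (chart_at A (chart_inv c a)) id) a v.

Definition inner (gram : M -> 'M[R]_n) (x : M) (v w : 'rV[R]_n) : R :=
  (v *m gram x *m w^T) 0 0.

(* [gram x] is the Gram matrix in the chart [chart_at x]; smoothness of the
   metric is smoothness of its coefficients in every chart of the atlas. *)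
Record riemannian_metric := RiemannianMetric {
  gram : M -> 'M[R]_n ;
  gram_sym : forall x, (gram x)^T = gram x ;
  gram_pos : forall x v, v != 0 -> 0 < inner gram x v v ;
  gram_smooth : forall c, atlas A c -> forall v w k,
    Ck_on k (chart_img c)
      (fun a => inner gram (chart_inv c a)
                  (tangent_of_coord c a v) (tangent_of_coord c a w) : R^o)
}.

Definition tnorm (g : riemannian_metric) (x : M) (v : 'rV[R]_n) : R :=
  Num.sqrt (inner (gram g) x v v).

Definition C1_curve (c : R^o -> M) : Prop :=
  continuous c /\
  forall e, atlas A e ->
    Ck_on 1 (c @^-1` chart_dom e) (fun t : R^o => chart_map e (c t)).

Definition velocity (c : R^o -> M) (t : R^o) : 'rV[R]_n :=
  'd (fun s : R^o => chart_map (chart_at A (c t)) (c s)) t (1 : R^o).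

Definition curve_length (g : riemannian_metric) (c : R^o -> M) : \bar R :=
  (\int[lebesgue_measure]_(t in `[0%R, 1%R])
     (tnorm g (c t) (velocity c t))%:E)%E.

(* C^1 curves have the same lengths as piecewise C^1 ones (reparametrize so
   that the speed vanishes at the corners), and every C^1 curve on [0, 1]
   extends to a C^1 curve on the line.  The distance is +oo between points of
   different connected components, and only then. *)
Definition riemannian_dist (g : riemannian_metric) (x y : M) : \bar R :=
  ereal_inf [set l | exists c : R^o -> M,
    [/\ C1_curve c, c 0 = x, c 1 = y & l = curve_length g c]].

Definition invariant_splitting (f : M -> M) (Es Eu : M -> {vspace 'rV[R]_n}) :
    Prop :=
  forall x,
    [/\ (Es x + Eu x)%VS = fullv, (Es x :&: Eu x)%VS = 0%VS,
        Es x != 0%VS /\ Eu x != 0%VS,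
        (tangent_map f x @: Es x)%VS = Es (f x) &
        (tangent_map f x @: Eu x)%VS = Eu (f x)].

(* The metric h for which the estimates hold need not be the metric of the
   Riemannian manifold under consideration. *)
Definition anosov_splitting (f : M -> M) (Es Eu : M -> {vspace 'rV[R]_n}) :
    Prop :=
  invariant_splitting f Es Eu /\
  exists (lambda sigma1 sigma2 : R) (h : riemannian_metric),
    [/\ lambda < 1, 1 < sigma1, sigma1 < sigma2,
        (forall x v, v \in Es x -> tnorm h x v = 1 ->
           tnorm h (f x) (tangent_map f x v) < lambda) &
        (forall x v, v \in Eu x -> tnorm h x v = 1 ->
           sigma1 < tnorm h (f x) (tangent_map f x v) < sigma2)].

Definition conformal_on (g : riemannian_metric) (f : M -> M)
    (E : M -> {vspace 'rV[R]_n}) : Prop :=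
  forall x, exists (a : R) (L : 'End('rV[R]_n)),
    [/\ (L @: E x)%VS = E (f x),
        (forall v, v \in E x -> tnorm g (f x) (L v) = tnorm g x v) &
        (forall v, v \in E x -> tangent_map f x v = a *: L v)].

End Manifold.

Section SchmidtGame.
Variables (R : realType) (X : Type) (d : X -> X -> \bar R).

Definition game_ball (w : X * R) : set X := [set z | (d w.1 z <= w.2%:E)%E].

(* Turns are numbered from 0.  A strategy of Alice gives the center of her ball
   from the finite list of all moves made so far by Bob; her radius is forced. *)
Definition alice_move (alpha : R) (strat : seq (X * R) -> X)
    (bob : nat -> X * R) (k : nat) : X * R :=
  (strat (mkseq bob k.+1), alpha * (bob k).2).

Definition bob_legal (alpha beta : R) (strat : seq (X * R) -> X)
    (bob : nat -> X * R) (k : nat) : Prop :=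
  match k with
  | 0%N => 0 < (bob 0%N).2
  | j.+1 => game_ball (bob j.+1) `<=` game_ball (alice_move alpha strat bob j)
            /\ (bob j.+1).2 = beta * (alice_move alpha strat bob j).2
  end.

Definition alice_legal (alpha : R) (strat : seq (X * R) -> X)
    (bob : nat -> X * R) (k : nat) : Prop :=
  game_ball (alice_move alpha strat bob k) `<=` game_ball (bob k).

Definition alpha_beta_winning (alpha beta : R) (S : set X) : Prop :=
  exists strat : seq (X * R) -> X, forall bob : nat -> X * R,
    (forall k, (forall j, (j <= k)%N -> bob_legal alpha beta strat bob j) ->
       alice_legal alpha strat bob k) /\
    ((forall k, bob_legal alpha beta strat bob k) ->
       exists x, \bigcap_k game_ball (bob k) = [set x] /\ S x).

Definition alpha_winning (alpha : R) (S : set X) : Prop :=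
  forall beta : R, 0 < beta < 1 -> alpha_beta_winning alpha beta S.

Definition winning (S : set X) : Prop :=
  exists alpha : R, 0 < alpha < 1 /\ alpha_winning alpha S.

End SchmidtGame.

Definition orbit_avoiding (M : topologicalType) (f : M -> M) (y : M) : set M :=
  [set z | ~ closure (range (fun k : nat => iter k f z)) y].

(* Main.v *)
Require Import Defs.
From HB Require Import structures.
From mathcomp Require Import all_boot all_order all_algebra.
From mathcomp Require Import all_classical all_reals all_analysis.
From mathcomp Require Import ring lra.
Set Implicit Arguments.
Unset Strict Implicit.
Unset Printing Implicit Defensive.
Import Order.TTheory GRing.Theory Num.Theory.
Import numFieldNormedType.Exports.
Local Open Scope classical_set_scope.
Local Open Scope ring_scope.
(* A hyperbolic orbit is controlled to first order.  Along the orbit of x write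
   the displacement of a nearby orbit in charts as e_j; then e_(j+1) is D e_j up to
   an error quadratic in the size of the displacements.  Conformality gives
   |D^j v| = A_j |v| on the unstable space, and A_j grows exponentially, so as long
   as A_k r is small the errors sum up to a small multiple of A_k |e_0|: every
   point of the ball B(x, r) satisfies |e_k| <= C A_k |e_0|, and the unstable part
   of e_k is close to D^k of the unstable part of e_0.  Only the boundedness of the
   unstable projection is used, not its regularity in x.

   Alice treats at each turn the times k for which A_k r lies in a fixed window.
   Bounded distortion shows that every k is treated at some turn, and the number of
   times in a window is bounded.  At the first time k0 of the window at which
   f^k0(x) is close to y she moves the center in an unstable direction, so that the
   image of her ball has at time k0 an unstable gap from y comparable to
   A_k0 r; expansion preserves this gap as long as f^i(y) = y, while the other
   points f^i(y) with i bounded stay away from y.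

   The Riemannian distance is used only through its local comparison with the
   coordinate distance of finitely many charts. *)

(** * Differential calculus *)

(** Two norms coexist on each tangent space. Expansion and contraction are given in one step for the
    adapted metric [h], conformality for [g], which also defines the distance. Each estimate is
    iterated in the norm where a step costs no constant, and the passage to the other norm is paid
    once. Conformality controls the errors: an error made at some time is multiplied on the unstable
    space by exactly the factor that multiplies the main term, so it stays proportional to it. The
    parameter of Alice must not depend on [beta]. It is fixed by the comparison constant [C] alone;
    [beta] enters only through the ratio theta of the ends of a window, and from there through the
    scale and the size of the avoided neighbourhood of y. The direction of a move comes from a
    dichotomy: of two opposite unstable vectors, at least one is as far from a given vector as its
    own length. Since the abstract argument knows [d] only up to comparison with charts, a limit
    point is located only in a ball somewhat larger than the one played. Hence the estimates are
    proved for a radius [slack * r] larger than that of Alice. *)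

Lemma near_eq_diff (R : realType) (V W : normedModType R) (f g : V -> W) (a : V) :
  (\forall x \near a, f x = g x) -> differentiable f a ->
  differentiable g a /\ 'd g a = 'd f a :> (V -> W).
Proof.
move=> fg df; have fga : f a = g a by exact: nbhs_singleton fg.
have dfc : continuous ('d f a) by exact: diff_continuous.
have eg : g \o shift a = cst (g a) + 'd f a +o_0 id.
  have [_ /eqaddoP h] := (diff_locallyP a f).1 df.
  apply/eqaddoP => e e0; have := h e e0.
  have : \forall x \near (0 : V), f (x + a) = g (x + a).
    have h2 : shift a @ (0 : V) --> (0 + a).
      by apply: cvgD; [exact: cvg_id|exact: cvg_cst].
    by rewrite add0r in h2; exact: h2 fg.
  apply: filterS2 => x hx /=.
  by rewrite !fctE /= -hx -fga.
have dg : 'd g a = 'd f a :> (V -> W) by exact: diff_unique.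
split; last exact: dg.
by apply/diff_locallyP; rewrite dg; split.
Qed.

Lemma diff_line (R : realType) (V : normedModType R) (a v : V) (t : R) :
  is_diff (t : R^o) (fun s : R^o => a + s *: v) (fun s : R^o => s *: v).
Proof.
have h : is_diff (t : R^o) (cst a + ( *:%R ^~ v : R^o -> V)) (0 + ( *:%R ^~ v)).
  exact: is_diffD.
by apply: (is_diff_eq h); rewrite add0r.
Qed.

Lemma coord_is_diff (R : realType) (V : normedModType R) m n
    (F : V -> 'M[R]_(m, n)) x i j : differentiable F x ->
  differentiable (fun z => F z i j : R^o) x /\
  forall v, 'd (fun z => F z i j : R^o) x v = 'd F x v i j.
Proof.
move=> dF; have dc := differentiable_coord (F x) i j.
split; first exact: (differentiable_comp dF dc).
move=> v.
have -> := diff_comp dF dc.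
have @f : {linear 'M[R]_(m, n) -> R^o}.
  by exists (fun N : 'M[R]_(_, _) => N i j); do 2![eexists]; do ?[constructor];
     rewrite ?mxE// => ? *; rewrite ?mxE//; move=> ?; rewrite !mxE.
have h : 'd (fun N : 'M[R]_(m, n) => N i j : R^o) (F x) = f :> ('M[R]_(m, n) -> R^o).
  by apply: (diff_lin (f := f)); exact: coord_continuous.
by rewrite /= h.
Qed.

Lemma mx_norm_le (R : realType) m n (x : 'M[R]_(m, n)) e : 0 <= e ->
  (forall i j, `|x i j| <= e) -> `|x| <= e.
Proof.
by move=> e0 h; rewrite [leLHS]/Num.Def.normr/= mx_normrE (bigmax_le _ e0)//= => -[i j] _.
Qed.

Lemma mx_norm_ge (R : realType) m n (x : 'M[R]_(m, n)) i j : `|x i j| <= `|x|.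
Proof. by rewrite [leRHS]/Num.Def.normr/= mx_normrE; exact: (le_bigmax _ _ (i, j)). Qed.

(** The norm of a matrix is the maximum of its entries, so the scalar mean value theorem applied to
    one entry at a time loses no constant. *)
Lemma mean_value_bound (R : realType) (V : normedModType R) m n
    (F : V -> 'M[R]_(m, n)) (a b : V) (L : R) :
  (forall t : R, 0 <= t <= 1 -> differentiable F (a + t *: (b - a)) /\
     `|'d F (a + t *: (b - a)) (b - a)| <= L) ->
  `|F b - F a| <= L.
Proof.
move=> h.
have L0 : 0 <= L.
  have t0 : 0 <= (0 : R) <= 1 by lra.
  by have [_] := h 0 t0; exact: le_trans.
apply: mx_norm_le => // i j; rewrite !mxE.
pose phi : R^o -> R^o := fun t => F (a + t *: (b - a)) i j.
pose dphi : R -> R := fun t => 'd F (a + t *: (b - a)) (b - a) i j.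
have dp (t : R) : 0 <= t <= 1 -> differentiable phi (t : R^o) /\
    is_derive (t : R^o) 1 phi (dphi t).
  move=> /h[dF _].
  have dl := diff_line a (b - a) t.
  have [dFc eFc] := coord_is_diff i j dF.
  have dl1 : differentiable (fun s : R^o => a + s *: (b - a)) (t : R^o).
    exact: ex_diff.
  have dph : differentiable phi (t : R^o).
    exact: (differentiable_comp dl1 dFc).
  split => //; apply: DeriveDef; first exact: diff_derivable.
  rewrite deriveE// /phi.
  have -> := diff_comp dl1 dFc.
  by rewrite /= eFc diff_val /= scale1r.
have e1 : F b i j = phi 1 by rewrite /phi scale1r addrC subrK.
have e0 : F a i j = phi 0 by rewrite /phi scale0r addr0.
have [c cI ec] : exists2 c : R, c \in `[0, 1] & phi 1 - phi 0 = dphi c * (1 - 0).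
  apply: MVT_segment => //.
    move=> t; rewrite in_itv/= => /andP[t0 t1].
    by have [] := dp t; rewrite ?ltW.
  apply: continuous_in_subspaceT => t; rewrite inE/= in_itv/= => tI.
  have [dph _] := dp t tI.
  exact: differentiable_continuous.
rewrite e1 e0 ec subr0 mulr1; move: cI; rewrite in_itv/= => cI.
have [_ hL] := h c cI; apply: le_trans hL.
exact: mx_norm_ge.
Qed.

Lemma linear_rV_bound (R : realType) n (W : normedModType R)
    (L : {linear 'rV[R]_n -> W}) v :
  `|L v| <= (\sum_i `|L (delta_mx 0 i)|) * `|v|.
Proof.
rewrite {1}(row_sum_delta v) linear_sum mulr_suml.
apply: le_trans (ler_norm_sum _ _ _) _; apply: ler_sum => i _.
by rewrite linearZ normrZ mulrC ler_wpM2l// mx_norm_ge.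
Qed.

Lemma linear_rV_dist (R : realType) n (W : normedModType R)
    (L L' : {linear 'rV[R]_n -> W}) (c : 'I_n -> R) v :
  (forall i, `|L (delta_mx 0 i) - L' (delta_mx 0 i)| <= c i) ->
  `|L v - L' v| <= (\sum_i c i) * `|v|.
Proof.
have e (A : {linear 'rV[R]_n -> W}) : A v = \sum_i v 0 i *: A (delta_mx 0 i).
  by rewrite {1}(row_sum_delta v) linear_sum; apply: eq_bigr => i _; rewrite linearZ.
move=> h; rewrite !e -sumrB mulr_suml.
apply: le_trans (ler_norm_sum _ _ _) _; apply: ler_sum => i _.
rewrite -scalerBr normrZ mulrC; apply: ler_pM => //.
exact: mx_norm_ge.
Qed.

Lemma nbhs_closed_ball (R : realType) (V : normedModType R) (a : V) (P : set V) :
  nbhs a P -> exists2 r, 0 < r & forall b, `|b - a| <= r -> P b.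
Proof.
move=> /nbhs_ballP[e /= e0 h]; exists (e / 2); first by rewrite divr_gt0.
move=> b hb; apply: h; rewrite -ball_normE /= distrC.
by apply: le_lt_trans hb _; rewrite ltr_pdivrMr// ltr_pMr// ltr1n.
Qed.

Lemma segment_ball (R : realType) (V : normedModType R) (x b b' : V) r (t : R) :
  `|b - x| <= r -> `|b' - x| <= r -> 0 <= t <= 1 ->
  `|b' + t *: (b - b') - x| <= r.
Proof.
move=> hb hb' /andP[t0 t1].
have -> : b' + t *: (b - b') - x = (1 - t) *: (b' - x) + t *: (b - x).
  have -> : b - b' = (b - x) - (b' - x) by rewrite opprB addrA subrK.
  rewrite addrAC; move: (b' - x) (b - x) => p q.
  by rewrite scalerBl scale1r scalerBr addrA addrAC.
apply: le_trans (ler_normD _ _) _; rewrite !normrZ (ger0_norm t0) ger0_norm ?subr_ge0//.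
rewrite (_ : r = (1 - t) * r + t * r); last by ring.
by rewrite lerD// ler_wpM2l// subr_ge0.
Qed.

Lemma C1_locally_lipschitz (R : realType) n m k (F : 'rV[R]_n -> 'M[R]_(m, k)) a :
  (\forall x \near a, differentiable F x) ->
  (forall i, {for a, continuous (fun x => 'd F x (delta_mx 0 i))}) ->
  exists K, [/\ 0 < K,
    (\forall x \near a, forall v, `|'d F x v| <= K * `|v|) &
    exists2 r, 0 < r & forall b b', `|b - a| <= r -> `|b' - a| <= r ->
      `|F b - F b'| <= K * `|b - b'|].
Proof.
move=> dF cF.
pose K : R := 1 + \sum_(i < n) (`|'d F a (delta_mx 0 i)| + 1).
have K0 : 0 < K by rewrite ltr_wpDr// sumr_ge0// => i _; rewrite addr_ge0.
have nb : \forall x \near a, forall v, `|'d F x v| <= K * `|v|.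
  have h : \forall x \near a, forall i,
      `|'d F x (delta_mx 0 i)| <= `|'d F a (delta_mx 0 i)| + 1.
    apply: (@filter_forall _ _ (fun i x =>
      `|'d F x (delta_mx 0 i)| <= `|'d F a (delta_mx 0 i)| + 1) (nbhs a) _).
    move=> i.
    have /cvgrPdist_le /(_ 1 ltr01) := cF i.
    apply: filterS => x /= hx; rewrite -lerBlDl; apply: le_trans hx.
    by rewrite distrC; exact: lerB_dist.
  apply: filterS h => x hx v; apply: le_trans (linear_rV_bound _ _) _.
  apply: ler_wpM2r => //; apply: (@le_trans _ _ (\sum_(i < n) (`|'d F a (delta_mx 0 i)| + 1))).
    exact: ler_sum.
  by rewrite lerDr.
exists K; split => //.
have [r r0 hr] := nbhs_closed_ball (filterI dF nb).
exists r => // b b' hb hb'; apply: mean_value_bound => t t01.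
by have [h1 h2] := hr _ (segment_ball hb hb' t01).
Qed.

(* The remainder is Lipschitz with a constant proportional to the size of the
   ball, which is stronger than the second order Taylor estimate. *)
Lemma C2_taylor (R : realType) n m k (F : 'rV[R]_n -> 'M[R]_(m, k)) a :
  (\forall x \near a, differentiable F x) ->
  (forall i, \forall x \near a, differentiable (fun z => 'd F z (delta_mx 0 i)) x) ->
  (forall i j, {for a, continuous
     (fun x => 'd (fun z => 'd F z (delta_mx 0 i)) x (delta_mx 0 j))}) ->
  exists K r, [/\ 0 < K, 0 < r &
    forall x, `|x - a| <= r ->
    forall b b' t, `|b - x| <= t -> `|b' - x| <= t -> t <= r ->
      `|F b - F b' - 'd F x (b - b')| <= K * t * `|b - b'|].
Proof.
move=> dF dG cG.
have hex (i : 'I_n) : exists Kr : R * R, [/\ 0 < Kr.1, 0 < Kr.2 &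
    forall b b', `|b - a| <= Kr.2 -> `|b' - a| <= Kr.2 ->
      `|'d F b (delta_mx 0 i) - 'd F b' (delta_mx 0 i)| <= Kr.1 * `|b - b'|].
  have [K [K0 _ [r r0 h]]] := C1_locally_lipschitz (dG i) (cG i).
  by exists (K, r).
have [Kr hKr] := choice hex.
have [r0 r00 hr0] := nbhs_closed_ball dF.
pose r := \big[Num.min/r0]_(i < n) (Kr i).2.
have rpos : 0 < r.
  by rewrite /r; elim/big_ind: _ => // [u v u0 v0|i _]; [rewrite lt_min u0|case: (hKr i)].
have rr0 : r <= r0 by exact: bigmin_le_id.
have rK i : r <= (Kr i).2 by exact: bigmin_le.
pose K := 1 + \sum_i (Kr i).1.
(* Half of [r]: a point within [r / 2] of [x] is then within [r] of [a], where the derivatives are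
   Lipschitz. *)
exists K, (r / 2); split.
- by rewrite ltr_pwDl// sumr_ge0// => i _; case: (hKr i) => /ltW.
- by rewrite divr_gt0.
move=> x xa b b' t bx b'x tr.
have t0 : 0 <= t by exact: le_trans bx.
have nearx z : `|z - x| <= t -> `|z - a| <= r.
  move=> zx; rewrite -(subrK x z) -addrA; apply: le_trans (ler_normD _ _) _.
  by apply: le_trans (lerD zx xa) _; move: tr; lra.
have xa' : `|x - a| <= r by apply: nearx; rewrite subrr normr0.
have -> : F b - F b' - 'd F x (b - b') = (F b - 'd F x b) - (F b' - 'd F x b').
  rewrite linearB !opprB; move: (F b) (F b') ('d F x b) ('d F x b') => p q u v.
  by rewrite [v - u]addrC addrACA [- q + v]addrC.
have dc : continuous ('d F x).
  by apply: diff_continuous; apply: hr0; apply: le_trans xa' rr0.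
(* The derivative of [H] at [z] is ['d F z - 'd F x], which is at most a multiple of [t] because the
   partial derivatives are Lipschitz. The claim is the mean value inequality for [H]. *)
pose H : 'rV[R]_n -> 'M[R]_(m, k) := F - ('d F x : 'rV[R]_n -> 'M[R]_(m, k)).
suff : `|H b - H b'| <= K * t * `|b - b'| by [].
apply: mean_value_bound => s s01.
set z := b' + s *: (b - b').
have zx : `|z - x| <= t by exact: segment_ball.
have za := nearx _ zx.
have dFz : differentiable F z by apply: hr0; exact: le_trans za rr0.
clearbody z.
have dxz : differentiable ('d F x) z by exact: linear_differentiable.
have exz : 'd ('d F x) z = 'd F x :> (_ -> _) by exact: diff_lin.
split; first exact: (differentiableB dFz dxz).
have -> := diffB dFz dxz.
have e2 : 'd F z (b - b') - 'd ('d F x) z (b - b') =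
    'd F z (b - b') - 'd F x (b - b') :=
  congr1 (fun g : _ -> _ => 'd F z (b - b') - g (b - b')) exz.
have -> : ('d F z \- 'd ('d F x) z) (b - b') =
    'd F z (b - b') - 'd F x (b - b') := e2.
apply: le_trans (linear_rV_dist (c := fun i => (Kr i).1 * t) _ _) _.
  move=> i; have [Ki0 _ h] := hKr i.
  apply: le_trans (h _ _ (le_trans za (rK i)) (le_trans xa' (rK i))) _.
  exact: (ler_wpM2l (ltW Ki0) zx).
apply: ler_wpM2r; first exact: normr_ge0.
by rewrite /K mulrDl mul1r mulr_suml; apply: ler_wpDl.
Qed.

(** * Charts and Riemannian metrics *)

Lemma near_diff_comp (R : realType) (U V W : normedModType R)
    (F : U -> V) (G : V -> W) (H : U -> W) (a v : U) :
  (\forall x \near a, G (F x) = H x) -> differentiable F a ->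
  differentiable G (F a) ->
  differentiable H a /\ 'd H a v = 'd G (F a) ('d F a v).
Proof.
move=> hn dF dG.
have [dH e] := near_eq_diff (f := G \o F) hn (differentiable_comp dF dG).
split; first exact: dH.
have e1 := congr1 (fun h : U -> W => h v) (diff_comp dF dG).
exact: etrans (congr1 (fun h : U -> W => h v) e) e1.
Qed.

Section Charts.
Variables (R : realType) (n : nat) (M : topologicalType).
Variable A : smooth_structure R n M.
Implicit Types (c e : chart R n M) (f : M -> M) (x : M).

Lemma chart_imgP c a : chart_img c a ->
  chart_dom c (chart_inv c a) /\ chart_map c (chart_inv c a) = a.
Proof. by move=> [x dx <-]; rewrite chart_mapK. Qed.

Lemma chart_img_map c x : chart_dom c x -> chart_img c (chart_map c x).
Proof. by exists x. Qed.

Lemma chart_map_inj c x y : chart_dom c x -> chart_dom c y ->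
  chart_map c x = chart_map c y -> x = y.
Proof. by move=> dx dy /(congr1 (chart_inv c)); rewrite !chart_mapK. Qed.

Lemma nbhs_chart_img c x : chart_dom c x -> nbhs (chart_map c x) (chart_img c).
Proof.
move=> dx; apply: open_nbhs_nbhs; split; first exact: chart_img_open.
exact: chart_img_map.
Qed.

Lemma nbhs_chart_dom c x : chart_dom c x -> nbhs x (chart_dom c).
Proof.
by move=> dx; apply: open_nbhs_nbhs; split; first exact: chart_dom_open.
Qed.

Lemma local_repE c e f x : chart_dom c x ->
  local_rep c e f (chart_map c x) = chart_map e (f x).
Proof. by move=> dx; rewrite /local_rep chart_mapK. Qed.

Lemma nbhs_local_dom c e f x : continuous f -> chart_dom c x ->
  chart_dom e (f x) -> nbhs (chart_map c x) (local_dom c e f).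
Proof.
move=> cf dx dfx.
have ci := chart_inv_cts (chart_img_map dx).
have h : nbhs x (chart_dom c `&` f @^-1` chart_dom e).
  apply: filterI; first exact: nbhs_chart_dom.
  exact: (cf x _ (nbhs_chart_dom dfx)).
rewrite -(chart_mapK dx) in h.
have h2 := ci _ h.
near=> a.
have ai : chart_img c a by near: a; exact: nbhs_chart_img.
have [_ e1] := chart_imgP ai.
exists (chart_inv c a); last exact: e1.
by near: a; exact: h2.
Unshelve. all: by end_near. Qed.

Lemma Ck_map_id k : Ck_map A k id.
Proof.
split; first by move=> x; exact: cvg_id.
by move=> c e Ac Ae; exact: (atlas_smooth Ac Ae).
Qed.

Lemma Ck_map_diff k f c e x : Ck_map A k.+1 f -> atlas A c -> atlas A e ->
  chart_dom c x -> chart_dom e (f x) ->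
  differentiable (local_rep c e f) (chart_map c x).
Proof. by move=> [_ h] Ac Ae dx dfx; have [+ _] := h c e Ac Ae; apply; exists x. Qed.

Lemma diff_local_rep_comp k c1 c2 c3 f1 f2 x v :
  Ck_map A k.+1 f1 -> Ck_map A k.+1 f2 ->
  atlas A c1 -> atlas A c2 -> atlas A c3 ->
  chart_dom c1 x -> chart_dom c2 (f1 x) -> chart_dom c3 (f2 (f1 x)) ->
  'd (local_rep c2 c3 f2) (chart_map c2 (f1 x))
     ('d (local_rep c1 c2 f1) (chart_map c1 x) v) =
  'd (local_rep c1 c3 (f2 \o f1)) (chart_map c1 x) v.
Proof.
move=> h1 h2 A1 A2 A3 d1 d2 d3.
have D1 := Ck_map_diff h1 A1 A2 d1 d2.
have D2 := Ck_map_diff h2 A2 A3 d2 d3.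
rewrite -(local_repE c2 f1 d1) in D2 *.
have [|_ e] := near_diff_comp (H := local_rep c1 c3 (f2 \o f1)) v _ D1 D2.
  apply: filterS (nbhs_local_dom h1.1 d1 d2) => _ [z [/= dz dfz] <-].
  by rewrite (local_repE _ _ dz) (local_repE _ _ dfz) (local_repE _ _ dz).
exact: esym e.
Qed.

Lemma diff_local_rep_id c x v : atlas A c -> chart_dom c x ->
  'd (local_rep c c id) (chart_map c x) v = v.
Proof.
move=> Ac dx.
have hn : \forall a \near chart_map c x, id a = local_rep c c id a.
  by apply: filterS (nbhs_chart_img dx) => a /chart_imgP[_ e]; rewrite /local_rep e.
have [_ e] := near_eq_diff hn (ex_diff (f := id)).
have e1 := congr1 (fun h : 'rV[R]_n -> 'rV[R]_n => h v) e.
apply: etrans e1 _.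
exact: (congr1 (fun h : 'rV[R]_n -> 'rV[R]_n => h v) diff_val).
Qed.

Definition to_tangent c x : {linear 'rV[R]_n -> 'rV[R]_n} :=
  'd (local_rep c (chart_at A x) id) (chart_map c x).

Definition of_tangent c x : {linear 'rV[R]_n -> 'rV[R]_n} :=
  'd (local_rep (chart_at A x) c id) (chart_map (chart_at A x) x).

Lemma tangent_of_coordE c x v : chart_dom c x ->
  tangent_of_coord A c (chart_map c x) v = to_tangent c x v.
Proof. by move=> dx; rewrite /tangent_of_coord chart_mapK. Qed.

Lemma to_tangentK c x : atlas A c -> chart_dom c x ->
  cancel (to_tangent c x) (of_tangent c x).
Proof.
move=> Ac dx v.
have h := Ck_map_id 1.
have := diff_local_rep_comp v h h Ac (chart_at_atlas A x) Ac dx (chart_at_dom A x) dx.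
by move=> /= ->; exact: diff_local_rep_id.
Qed.

Lemma of_tangentK c x : atlas A c -> chart_dom c x ->
  cancel (of_tangent c x) (to_tangent c x).
Proof.
move=> Ac dx v.
have h := Ck_map_id 1; have Ax := chart_at_atlas A x.
have := diff_local_rep_comp v h h Ax Ac Ax (chart_at_dom A x) dx (chart_at_dom A x).
by move=> /= ->; apply: diff_local_rep_id => //; exact: chart_at_dom.
Qed.

(** By the chain rule both sides are the derivative of [f] read from [c] to the preferred chart at
    [f x]. This allows computations in well chosen charts while [chart_at] varies without any
    regularity. *)
Lemma tangent_map_to_tangent k f c e x v : Ck_map A k.+1 f ->
  atlas A c -> atlas A e -> chart_dom c x -> chart_dom e (f x) ->
  tangent_map A f x (to_tangent c x v) =
  to_tangent e (f x) ('d (local_rep c e f) (chart_map c x) v).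
Proof.
move=> hf Ac Ae dx dfx.
have h := Ck_map_id k.+1; have Ax := chart_at_atlas A x.
have Afx := chart_at_atlas A (f x).
rewrite lfunE.
have e1 := diff_local_rep_comp v h hf Ac Ax Afx dx (chart_at_dom A x) (chart_at_dom A (f x)).
have e2 := diff_local_rep_comp v hf h Ac Ae Afx dx dfx (chart_at_dom A (f x)).
exact: etrans e1 (esym e2).
Qed.

Lemma C2_local_taylor f c e x : Ck_map A 2 f -> atlas A c -> atlas A e ->
  chart_dom c x -> chart_dom e (f x) ->
  let F := local_rep c e f in let a := chart_map c x in
  exists K r, [/\ 0 < K, 0 < r &
    forall z, `|z - a| <= r ->
    (forall v, `|'d F z v| <= K * `|v|) /\
    forall b b' t, `|b - z| <= t -> `|b' - z| <= t -> t <= r ->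
      local_dom c e f b /\
      `|F b - F b' - 'd F z (b - b')| <= K * t * `|b - b'|].
Proof.
move=> [cf hf] Ac Ae dx dfx F a.
have [dF h2] := hf c e Ac Ae.
have nb := nbhs_local_dom cf dx dfx.
have aD := nbhs_singleton nb.
have dFn : \forall z \near a, differentiable F z.
  by apply: filterS nb => z; exact: dF.
have dG i : \forall z \near a, differentiable (fun z => 'd F z (delta_mx 0 i)) z.
  by have [+ _] := h2 (delta_mx 0 i) => h; apply: filterS nb => z; exact: h.
have cG (i j : 'I_n) : {for a, continuous (fun b : 'rV[R]_n =>
     'd (fun z : 'rV[R]_n => 'd F z (delta_mx 0 i)) b (delta_mx 0 j))}.
  by have [_ h] := h2 (delta_mx 0 i); exact: (h (delta_mx 0 j) a aD).
have cF (i : 'I_n) : {for a, continuous (fun b : 'rV[R]_n => 'd F b (delta_mx 0 i))}.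
  have [h _] := h2 (delta_mx 0 i).
  exact: differentiable_continuous (h a aD).
have [K1 [K10 nK1 _]] := C1_locally_lipschitz dFn cF.
have [K2 [r2 [K20 r20 hT]]] := C2_taylor dFn dG cG.
have [r1 r10 hr1] := nbhs_closed_ball (filterI nb nK1).
have le1 : Num.min (r1 / 2) r2 <= r1 / 2 by rewrite ge_min lexx.
have le2 : Num.min (r1 / 2) r2 <= r2 by rewrite ge_min lexx orbT.
exists (K1 + K2), (Num.min (r1 / 2) r2); split.
- exact: addr_gt0.
- by rewrite lt_min divr_gt0.
move=> z hz; have z1 := le_trans hz le1.
split.
  move=> v; have [_ h] : (local_dom c e f `&` [set z | forall v, `|'d F z v| <= K1 * `|v|]) z.
    by apply: hr1; apply: le_trans z1 _; lra.
  apply: le_trans (h v) _; rewrite mulrDl lerDl mulr_ge0//; exact: ltW.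
move=> b b' t hb hb' ht; split.
  have [+ _] : (local_dom c e f `&` [set z | forall v, `|'d F z v| <= K1 * `|v|]) b.
    apply: hr1; rewrite -(subrK z b) -addrA; apply: le_trans (ler_normD _ _) _.
    by have := le_trans ht le1; move: z1 hb; lra.
  by [].
have h := hT z (le_trans hz le2) b b' t hb hb' (le_trans ht le2).
apply: le_trans h _; rewrite -!mulrA ler_wpM2r ?lerDr ?(ltW K10)// mulr_ge0//.
exact: le_trans hb.
Qed.

Section Metric.
Variable g : riemannian_metric A.

Lemma innerDl x v w u : inner (gram g) x (v + w) u = inner (gram g) x v u + inner (gram g) x w u.
Proof. by rewrite /inner !mulmxDl mxE. Qed.

Lemma innerZl x k v u : inner (gram g) x (k *: v) u = k * inner (gram g) x v u.
Proof. by rewrite /inner -!scalemxAl mxE. Qed.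

Lemma innerC x v w : inner (gram g) x v w = inner (gram g) x w v.
Proof.
rewrite /inner -[in LHS](trmxK (v *m _ *m _)) mxE.
by rewrite !trmx_mul trmxK gram_sym mulmxA.
Qed.

Lemma innerDr x v w u : inner (gram g) x u (v + w) = inner (gram g) x u v + inner (gram g) x u w.
Proof. by rewrite innerC innerDl !(innerC x u). Qed.

Lemma innerZr x k v u : inner (gram g) x u (k *: v) = k * inner (gram g) x u v.
Proof. by rewrite innerC innerZl innerC. Qed.

Lemma inner_ge0 x v : 0 <= inner (gram g) x v v.
Proof.
have [->|v0] := eqVneq v 0; last exact/ltW/gram_pos.
by rewrite /inner !mul0mx mxE.
Qed.

Lemma tnorm_ge0 x v : 0 <= tnorm g x v. Proof. exact: sqrtr_ge0. Qed.

Lemma tnorm_sqr x v : tnorm g x v ^+ 2 = inner (gram g) x v v.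
Proof. by rewrite sqr_sqrtr// inner_ge0. Qed.

Lemma tnorm_eq0 x v : tnorm g x v = 0 -> v = 0.
Proof.
move=> h; apply: contrapT => /eqP v0; have := gram_pos g x v0.
by rewrite -tnorm_sqr h expr0n ltxx.
Qed.

Lemma tnormZ x k v : tnorm g x (k *: v) = `|k| * tnorm g x v.
Proof.
by rewrite /tnorm innerZl innerZr mulrA -expr2 sqrtrM ?sqr_ge0// sqrtr_sqr.
Qed.

(** Cauchy-Schwarz: the form is nonnegative on [W *: v - B *: w], where its value is
    [W * (W * U - B ^+ 2)]. *)
Lemma inner_le x v w : inner (gram g) x v w <= tnorm g x v * tnorm g x w.
Proof.
have [->|w0] := eqVneq w 0.
  by rewrite /inner trmx0 mulmx0 mxE mulr_ge0// tnorm_ge0.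
set W := inner (gram g) x w w; set B := inner (gram g) x v w.
set U := inner (gram g) x v v.
have W0 : 0 < W by exact: gram_pos.
have : 0 <= inner (gram g) x (W *: v - B *: w) (W *: v - B *: w) by exact: inner_ge0.
rewrite -scaleNr !(innerDl, innerDr, innerZl, innerZr) (innerC x w v) -/W -/B -/U.
rewrite (_ : _ + _ = W * (W * U - B ^+ 2)); last by ring.
rewrite pmulr_rge0// subr_ge0 => h.
apply: le_trans (ler_norm _) _; rewrite -ler_sqr ?nnegrE ?mulr_ge0 ?tnorm_ge0//.
by rewrite exprMn !tnorm_sqr real_normK ?num_real// mulrC.
Qed.

Lemma tnormD x v w : tnorm g x (v + w) <= tnorm g x v + tnorm g x w.
Proof.
rewrite -ler_sqr ?nnegrE ?addr_ge0 ?tnorm_ge0// sqrrD !tnorm_sqr.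
rewrite !(innerDl, innerDr) (innerC x w v).
by have := inner_le x v w; lra.
Qed.

End Metric.

End Charts.

(** The continuous function [q] attains a positive minimum on the compact unit sphere. It is applied
    to the norm of a metric at a single point, read in coordinates. *)
Lemma norm_equivalence (R : realType) n (q : 'rV[R]_n -> R) :
  (forall v w, q (v + w) <= q v + q w) ->
  (forall k v, q (k *: v) = `|k| * q v) -> (forall v, q v = 0 -> v = 0) ->
  exists2 C, 1 <= C & forall v, `|v| <= C * q v /\ q v <= C * `|v|.
Proof.
move=> qD qZ q0.
have q00 : q 0 = 0 by rewrite -(scale0r 0) qZ normr0 mul0r.
have qN v : q (- v) = q v by rewrite -scaleN1r qZ normrN1 mul1r.
have qge v : 0 <= q v.
  by have := qD v (- v); rewrite subrr q00 qN -mulr2n pmulrn_lge0.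
pose L := 1 + \sum_(i < n) q (delta_mx 0 i).
have L1 : 1 <= L by rewrite lerDl sumr_ge0.
have qL v : q v <= L * `|v|.
  have h : q v <= \sum_i q (v 0 i *: delta_mx 0 i).
    rewrite {1}(row_sum_delta v); elim/big_ind2: _ => //; first by rewrite q00.
    by move=> u1 s1 u2 s2 h1 h2; apply: le_trans (qD _ _) _; exact: lerD.
  apply: le_trans h _; rewrite mulrDl mul1r mulr_suml ler_wpDl//.
  by apply: ler_sum => i _; rewrite qZ mulrC ler_wpM2l// mx_norm_ge.
pose S := [set v : 'rV[R]_n | `|v| = 1].
have cS : compact S.
  apply: bounded_closed_compact.
    by exists 1; split; [exact: num_real|move=> x x1 v /= ->; exact: ltW].
  apply: (@preimage_closed _ _ (fun v : 'rV[R]_n => `|v|) [set 1]).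
    by move=> v _; exact: norm_continuous.
  exact: closed_eq.
have qc : continuous q.
  move=> v; apply/(@cvgrPdist_le _ _ _ (nbhs v)) => e e0.
  have := nbhsx_ballx v (e / L) (divr_gt0 e0 (lt_le_trans ltr01 L1)).
  apply: filterS => w; rewrite -ball_normE /= => hw.
  have hL u : L * `|u| <= e -> q u <= e by exact: le_trans.
  have hvw : q (v - w) <= e.
    by apply: hL; rewrite mulrC -ler_pdivlMr ?ltW//; lra.
  have h1 := qD (v - w) w; rewrite subrK in h1.
  have h2 := qD (w - v) v; rewrite subrK -opprB qN in h2.
  by rewrite ler_norml; apply/andP; split; lra.
(* In dimension 0 the sphere is empty and there is no minimum to take; then every vector is zero. *)
have [[v0 v01]|noS] := pselect (S !=set0); last first.
  exists L => // v; split => //.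
  have [->|vn0] := eqVneq v 0; first by rewrite normr0 mulr_ge0//; lra.
  exfalso; apply: noS; exists (`|v|^-1 *: v).
  by rewrite /S /= normrZ normfV normr_id mulVf// normr_eq0.
have [c cS' hmin] := EVT_min_rV (ex_intro _ v0 v01) cS (continuous_subspaceT qc).
have qc0 : 0 < q c.
  rewrite lt_neqAle qge andbT eq_sym; apply/eqP => /q0 c0.
  by move: cS'; rewrite inE /S /= c0 normr0 => /eqP; rewrite eq_sym oner_eq0.
exists (L + (q c)^-1); first by rewrite ler_wpDr// invr_ge0.
move=> v; split; last first.
  by apply: le_trans (qL v) _; rewrite ler_wpM2r// lerDl invr_ge0.
have [->|vn0] := eqVneq v 0; first by rewrite normr0 q00 mulr0.
have nv : 0 < `|v| by rewrite normr_gt0.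
have := hmin (`|v|^-1 *: v).
rewrite inE /S /= normrZ normfV normr_id mulVf ?normr_eq0// => /(_ erefl).
rewrite qZ normfV normr_id mulrC ler_pdivlMr// => h.
apply: (@le_trans _ _ ((q c)^-1 * q v)).
  by rewrite mulrC ler_pdivlMr// mulrC.
by rewrite ler_wpM2r// lerDr; lra.
Qed.

Section MetricComparison.
Variables (R : realType) (n : nat) (M : topologicalType).
Variable A : smooth_structure R n M.
Variable g : riemannian_metric A.

Lemma inner_suml x (I : finType) (F : I -> 'rV[R]_n) w :
  inner (gram g) x (\sum_i F i) w = \sum_i inner (gram g) x (F i) w.
Proof.
apply: (big_morph (fun v => inner (gram g) x v w)).
  by move=> u v; exact: innerDl.
by rewrite /inner !mul0mx mxE.
Qed.

Lemma inner_linear_expand x (T : {linear 'rV[R]_n -> 'rV[R]_n}) v :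
  inner (gram g) x (T v) (T v) = \sum_i \sum_j v 0 i * v 0 j *
    inner (gram g) x (T (delta_mx 0 i)) (T (delta_mx 0 j)).
Proof.
have e : T v = \sum_i v 0 i *: T (delta_mx 0 i).
  by rewrite {1}(row_sum_delta v) linear_sum; apply: eq_bigr => i _; rewrite linearZ.
rewrite {1}e inner_suml; apply: eq_bigr => i _.
rewrite e innerC inner_suml; apply: eq_bigr => j _.
by rewrite innerZl innerC innerZl; ring.
Qed.

(** At the point itself this is [norm_equivalence]; continuity of the Gram coefficients carries it
    to a neighbourhood at the price of doubling the constant. *)
Lemma metric_comparison c x : atlas A c -> chart_dom c x ->
  exists2 C, 1 <= C & \forall a \near chart_map c x, forall v,
    `|v| <= C * tnorm g (chart_inv c a) (tangent_of_coord A c a v) /\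
    tnorm g (chart_inv c a) (tangent_of_coord A c a v) <= C * `|v|.
Proof.
move=> Ac dx; set a := chart_map c x.
pose q b v := tnorm g (chart_inv c b) (tangent_of_coord A c b v).
have [C C1 hC] : exists2 C, 1 <= C & forall v, `|v| <= C * q a v /\ q a v <= C * `|v|.
  apply: norm_equivalence.
  - by move=> v w; rewrite /q /tangent_of_coord linearD; exact: tnormD.
  - by move=> k v; rewrite /q /tangent_of_coord linearZ; exact: tnormZ.
  - move=> v /tnorm_eq0; rewrite /a tangent_of_coordE// => h.
    apply: etrans (esym (to_tangentK Ac dx v)) _.
    exact: etrans (congr1 (of_tangent A c x) h) (linear0 _).
have C0 : 0 < C by exact: lt_le_trans C1.
pose G b (i j : 'I_n) := inner (gram g) (chart_inv c b)
  (tangent_of_coord A c b (delta_mx 0 i)) (tangent_of_coord A c b (delta_mx 0 j)).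
(* There are n^2 coefficients, so an error [eta] in each changes [q a v ^+ 2] by at most
   [(2 * C ^+ 2)^-1 * |v| ^+ 2], half of what the comparison at [a] guarantees. *)
pose eta : R := (2 * C ^+ 2)^-1 / (n%:R * n%:R + 1).
have N0 : 0 < (n%:R * n%:R + 1 : R) by rewrite ltr_wpDl// mulr_ge0.
have eta0 : 0 < eta by rewrite divr_gt0// invr_gt0 mulr_gt0// exprn_gt0.
have nG : \forall b \near a, forall i j, `|G a i j - G b i j| <= eta.
  apply: (@filter_forall _ _ (fun i b => forall j, `|G a i j - G b i j| <= eta) (nbhs a) _).
  move=> i.
  apply: (@filter_forall _ _ (fun j b => `|G a i j - G b i j| <= eta) (nbhs a) _).
  move=> j.
  have /= h0 := gram_smooth g Ac (delta_mx 0 i) (delta_mx 0 j) 0.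
  have := h0 a (chart_img_map dx).
  by move=> /cvgrPdist_le /(_ _ eta0).
exists (2 * C); first by lra.
apply: filterS nG => b hb v.
have qE b' : q b' v ^+ 2 = \sum_i \sum_j v 0 i * v 0 j * G b' i j.
  by rewrite /q tnorm_sqr /tangent_of_coord inner_linear_expand.
have qge b' w : 0 <= q b' w by exact: tnorm_ge0.
suff : `|v| <= 2 * C * q b v /\ q b v <= 2 * C * `|v| by [].
clearbody q G.
have hd : `|q a v ^+ 2 - q b v ^+ 2| <= (2 * C ^+ 2)^-1 * `|v| ^+ 2.
  rewrite (qE a) (qE b) -sumrB.
  apply: (@le_trans _ _ (\sum_(i < n) \sum_(j < n) eta * `|v| ^+ 2)).
    apply: le_trans (ler_norm_sum _ _ _) _; apply: ler_sum => i _.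
    rewrite -sumrB; apply: le_trans (ler_norm_sum _ _ _) _; apply: ler_sum => j _.
    rewrite -mulrBr normrM mulrC; apply: ler_pM => //.
    by rewrite normrM expr2; apply: ler_pM => //; exact: mx_norm_ge.
  rewrite !sumr_const !card_ord -mulrnA -[X in X <= _]mulr_natl natrM mulrA.
  apply: ler_wpM2r; first exact: sqr_ge0.
  rewrite /eta mulrCA ler_piMr//; first by rewrite invr_ge0 ltW// mulr_gt0// exprn_gt0.
  by rewrite ler_pdivrMr// mul1r lerDl.
have [h1 h2] := hC v.
move: hd; rewrite ler_norml => /andP[hd1 hd2].
have n0 : 0 <= `|v| by [].
have inv1 : (2 * C ^+ 2)^-1 * (2 * C ^+ 2) = 1.
  by rewrite mulVf// gt_eqF// mulr_gt0// exprn_gt0.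
have C21 : 1 <= C ^+ 2 by exact: exprn_ege1.
have inv2 : 0 < (2 * C ^+ 2)^-1 by rewrite invr_gt0 mulr_gt0// exprn_gt0.
have inv3 : (2 * C ^+ 2)^-1 <= 1 by rewrite invf_le1; [lra|rewrite mulr_gt0// exprn_gt0].
have s1 : `|v| ^+ 2 <= C ^+ 2 * q a v ^+ 2.
  by rewrite -exprMn ler_sqr ?nnegrE// mulr_ge0// ltW.
have s2 : q a v ^+ 2 <= C ^+ 2 * `|v| ^+ 2.
  by rewrite -exprMn ler_sqr ?nnegrE// mulr_ge0// ltW.
have v2 : 0 <= `|v| ^+ 2 by exact: sqr_ge0.
have C20 : 0 <= 2 * C by lra.
have p1 : 0 <= 2 * C * q b v by exact: mulr_ge0.
have p2 : 0 <= 2 * C * `|v| by exact: mulr_ge0.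
split.
  rewrite -ler_sqr ?nnegrE//.
  rewrite exprMn exprMn.
  have : C ^+ 2 * q a v ^+ 2 - C ^+ 2 * q b v ^+ 2 <= `|v| ^+ 2 / 2.
    have hh : C ^+ 2 * (q a v ^+ 2 - q b v ^+ 2) <= C ^+ 2 * ((2 * C ^+ 2)^-1 * `|v| ^+ 2).
      by rewrite ler_pM2l// exprn_gt0.
    rewrite -mulrBr; apply: le_trans hh _.
    by rewrite le_eqVlt; apply/orP; left; apply/eqP; field; rewrite gt_eqF.
  by have : 0 <= C ^+ 2 * q b v ^+ 2; [rewrite mulr_ge0// sqr_ge0|lra].
rewrite -ler_sqr ?nnegrE//.
rewrite exprMn exprMn.
have : (2 * C ^+ 2)^-1 * `|v| ^+ 2 <= `|v| ^+ 2 by rewrite ler_piMl.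
have : `|v| ^+ 2 <= C ^+ 2 * `|v| ^+ 2 by rewrite ler_peMl.
lra.
Qed.

End MetricComparison.

(** * Comparison of the Riemannian distance with coordinates *)

(* No measurability is required: the integral of a nonnegative function is a
   supremum over simple functions. *)
Lemma ge0_integral_mono (dd : measure_display) (T : measurableType dd) (R : realType)
    (mu : {measure set T -> \bar R}) (D D' : set T) (F G : T -> \bar R) :
  D `<=` D' -> (forall x, D x -> (0 <= F x)%E) -> (forall x, D' x -> (0 <= G x)%E) ->
  (forall x, D x -> (F x <= G x)%E) ->
  (\int[mu]_(x in D) F x <= \int[mu]_(x in D') G x)%E.
Proof.
move=> DD' F0 G0 FG; rewrite !ge0_integralE//.
apply: ereal_sup_le => _ [h /= hF <-]; exists h => // x.
apply: le_trans (hF x) _; rewrite /patch.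
case: ifPn => [/set_mem Dx|_].
  by rewrite ifT; [exact: FG|rewrite inE; exact: DD'].
by case: ifPn => [/set_mem/G0//|_].
Qed.

Lemma cvg_left_closed (R : realType) (X : topologicalType) (c : R^o -> X) (B : set X) (s : R) :
  0 < s -> continuous c -> closed B -> (forall t, 0 <= t < s -> B (c t)) -> B (c s).
Proof.
move=> s0 cc cB h; apply: contrapT => nB.
have nb : nbhs (c s) (~` B) by apply: open_nbhs_nbhs; split; first exact: closed_openC.
have /nbhs_ballP[e /= e0 he] := cc s _ nb.
pose t := Num.max 0 (s - e / 2).
have ts : 0 <= t < s.
  by rewrite le_max lexx/= gt_max s0/= ltrBlDr ltrDl divr_gt0.
apply: (he t); last exact: h.
rewrite -ball_normE /= ger0_norm ?subr_ge0; last by case/andP: ts => _ /ltW.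
rewrite ltrBlDr -ltrBlDl lt_max; apply/orP; right.
by rewrite ltrD2l ltrN2 ltr_pdivrMr// ltr_pMr// ltr1n.
Qed.

Section Curves.
Variables (R : realType) (n : nat) (M : topologicalType).
Variable A : smooth_structure R n M.
Variable g : riemannian_metric A.

Lemma velocityE (c : R^o -> M) (e : chart R n M) (t : R^o) :
  C1_curve A c -> atlas A e -> chart_dom e (c t) ->
  velocity A c t = tangent_of_coord A e (chart_map e (c t))
    ('d (fun s : R^o => chart_map e (c s)) t (1 : R^o)).
Proof.
move=> [cc hc] Ae dt.
have [d1 _] := hc e Ae.
have dF := d1 t dt.
rewrite tangent_of_coordE//.
have Ax := chart_at_atlas A (c t); have dx := chart_at_dom A (c t).
have D2 := Ck_map_diff (Ck_map_id A 1) Ae Ax dt dx.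
have hn : \forall s \near t, local_rep e (chart_at A (c t)) id (chart_map e (c s)) =
    chart_map (chart_at A (c t)) (c s).
  have : nbhs t (c @^-1` chart_dom e) by exact: cc (nbhs_chart_dom dt).
  by apply: filterS => s ds; rewrite local_repE.
have [_ h] := near_diff_comp (1 : R^o) hn dF D2.
exact: h.
Qed.

Lemma curve_length_ge0 c : (0 <= curve_length g c)%E.
Proof. by apply: integral_ge0 => t _; rewrite lee_fin tnorm_ge0. Qed.

Section InChart.
Variables (e : chart R n M) (c : R^o -> M) (s C : R).
Hypotheses (hc : C1_curve A c) (Ae : atlas A e) (s01 : 0 < s <= 1) (C0 : 0 < C).
Hypothesis dom_c : forall t, 0 <= t <= s -> chart_dom e (c t).
Hypothesis hC : forall t, 0 <= t <= s -> forall v,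
  `|v| <= C * tnorm g (c t) (tangent_of_coord A e (chart_map e (c t)) v).

(** The displacement of a coordinate is the integral of its derivative, which is at most [C] times
    the speed. Going coordinate by coordinate keeps the fundamental theorem of calculus scalar. *)
Lemma coord_le_length (j : 'I_n) :
  ((`|chart_map e (c s) 0 j - chart_map e (c 0) 0 j| / C)%:E <= curve_length g c)%E.
Proof.
have /andP[s0 s1] := s01.
pose u : R^o -> 'rV[R]_n := fun t => chart_map e (c t).
have [du cu] := hc.2 e Ae.
pose F : R -> R := fun t => u t 0 j / C.
pose f : R -> R := fun t => 'd u t (1 : R^o) 0 j / C.
have dF (t : R) : 0 <= t <= s -> differentiable (F : R^o -> R^o) (t : R^o) /\
    derive1 F t = f t.
  move=> ht; have dut : differentiable u t by exact: du (dom_c ht).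
  have [dj ej] := coord_is_diff 0 j dut.
  have d2 := differentiableZ C^-1 dj.
  have eF : (C^-1 *: (fun z : R^o => u z 0 j : R^o)) = F.
    by apply/funext => z; rewrite /F mulrC.
  rewrite eF in d2; split; first exact: d2.
  apply: etrans (derive1E' d2) _.
  apply: etrans (esym (congr1 (fun k : R^o -> R^o => 'd k t (1 : R^o)) eF)) _.
  have h := congr1 (fun k : R^o -> R^o => k 1) (diffZ C^-1 dj).
  apply: etrans h _; rewrite /= ej /f mulrC //.
have cf (t : R) : 0 <= t <= s -> {for t, continuous f}.
  move=> ht; have h := cu (1 : R^o) t (dom_c ht).
  apply: cvgM; last exact: cvg_cst.
  exact: continuous_comp h (@coord_continuous _ _ _ _ _ _).
have cF (t : R) : 0 <= t <= s -> {for t, continuous F}.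
  by move=> /dF[h _]; exact: (@differentiable_continuous _ R^o R^o).
have within_f : {within `[0, s], continuous f}.
  apply: continuous_in_subspaceT => t; rewrite inE/= in_itv/=; exact: cf.
have FTC : (\int[lebesgue_measure]_(x in `[0%R, s]) (f x)%:E)%E = ((F s)%:E - (F 0)%:E)%E.
  apply: continuous_FTC2 => //.
    split.
    - move=> t; rewrite in_itv/= => /andP[t0 ts].
      by have [h _] := dF t (introT andP (conj (ltW t0) (ltW ts))); exact/derivable1_diffP.
    - by apply: cvg_at_right_filter; apply: cF; rewrite lexx ltW.
    - by apply: cvg_at_left_filter; apply: cF; rewrite lexx ltW.
  move=> t; rewrite in_itv/= => /andP[t0 ts].
  by have [_] := dF t (introT andP (conj (ltW t0) (ltW ts))).
have /integrableP[mf _] := continuous_compact_integrable (@segment_compact R 0 s) within_f.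
have le1 := le_abse_integral lebesgue_measure (measurable_itv _) mf.
have -> : `|chart_map e (c s) 0 j - chart_map e (c 0) 0 j| / C = `|F s - F 0|.
  by rewrite /F -mulrBl normrM normfV (gtr0_norm C0).
rewrite /comp FTC in le1.
apply: le_trans le1 _; apply: ge0_integral_mono.
- move=> t /=; rewrite !in_itv/= => /andP[-> ts]/=; exact: le_trans s1.
- by move=> t _; rewrite abse_ge0.
- by move=> t _; rewrite lee_fin tnorm_ge0.
move=> t /=; rewrite in_itv/= => ht; rewrite lee_fin.
rewrite /f normrM normfV (gtr0_norm C0) ler_pdivrMr// mulrC.
rewrite (velocityE hc Ae (dom_c ht)).
exact: le_trans (mx_norm_ge _ _ _) (hC ht _).
Qed.

Lemma chart_displacement_le_length l : (curve_length g c <= l%:E)%E ->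
  `|chart_map e (c s) - chart_map e (c 0)| <= C * l.
Proof.
move=> hl.
have l0 : 0 <= l by rewrite -lee_fin; exact: le_trans (curve_length_ge0 c) hl.
apply: mx_norm_le => [|i j]; first by rewrite mulr_ge0// ltW.
rewrite (ord1 i) !mxE mulrC -ler_pdivrMr// -lee_fin.
exact: le_trans (coord_le_length j) hl.
Qed.

End InChart.

(** The set is the image of a compact ball under [chart_inv], hence compact, hence closed in the
    Hausdorff space [M]. Closedness in [M], and not just in the chart domain, ensures that a curve
    cannot leave the chart without being seen at the boundary of the ball. *)
Lemma chart_ball_closed (e : chart R n M) a r :
  (forall b, `|b - a| <= r -> chart_img e b) ->
  closed [set z | chart_dom e z /\ `|chart_map e z - a| <= r].
Proof.
move=> hi.
have -> : [set z | chart_dom e z /\ `|chart_map e z - a| <= r] =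
    chart_inv e @` [set b | `|b - a| <= r].
  apply/seteqP; split => [z [dz hz]|_ [b /= hb <-]].
    by exists (chart_map e z) => //; rewrite chart_mapK.
  by have [d1 e1] := chart_imgP (hi b hb); rewrite e1.
apply: compact_closed; first exact: (manifold_hausdorff A).
apply: continuous_compact.
  apply: continuous_in_subspaceT => b; rewrite inE/= => hb.
  exact: chart_inv_cts (hi b hb).
apply: bounded_closed_compact.
  exists (`|a| + r); split; first exact: num_real.
  move=> x hx v /= hv; rewrite -(subrK a v); apply: le_trans (ler_normD _ _) _.
  by apply: ltW; apply: le_lt_trans hx; rewrite addrC lerD2l.
apply: (@preimage_closed _ _ (fun b : 'rV[R]_n => `|b - a|) [set x | x <= r]).
  move=> b _.
  apply: (continuous_comp (f := fun b : 'rV[R]_n => b - a)); last exact: norm_continuous.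
  by apply: (@cvgB _ _ _ (nbhs b)); [exact: cvg_id|exact: cvg_cst].
exact: closed_le.
Qed.

Section LowerBound.
Variables (e : chart R n M) (x : M) (r C : R).
Hypotheses (Ae : atlas A e) (dx : chart_dom e x) (r0 : 0 < r) (C0 : 0 < C).
Hypothesis hball : forall a, `|a - chart_map e x| <= r -> chart_img e a /\
  forall v, `|v| <= C * tnorm g (chart_inv e a) (tangent_of_coord A e a v).

(** First exit argument. At the first time [s] outside the open ball [W] the curve is still in the
    closed ball [B], so the displacement bound holds up to [s] and gives at most [C * l < r], which
    puts [c s] back into [W]. *)
Lemma short_curve_stays (c : R^o -> M) l : C1_curve A c -> c 0 = x ->
  (curve_length g c <= l%:E)%E -> C * l < r ->
  chart_dom e (c 1) /\ `|chart_map e (c 1) - chart_map e x| <= C * l.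
Proof.
move=> hc c0 hl lr.
pose W := [set z | chart_dom e z /\ `|chart_map e z - chart_map e x| < r].
pose B := [set z | chart_dom e z /\ `|chart_map e z - chart_map e x| <= r].
have cB : closed B by apply: chart_ball_closed => b /hball[].
have oW z : W z -> nbhs z W.
  move=> [dz hz]; apply: filterI; first exact: nbhs_chart_dom.
  have h := chart_map_cts dz.
  have hn : nbhs (chart_map e z) [set b | `|b - chart_map e x| < r].
    have : nbhs (chart_map e z) (ball (chart_map e z) (r - `|chart_map e z - chart_map e x|)).
      by apply: nbhsx_ballx; rewrite subr_gt0.
    apply: filterS => b; rewrite -ball_normE /= distrC => hb.
    rewrite -(subrK (chart_map e z) b) -addrA; apply: le_lt_trans (ler_normD _ _) _.
    by rewrite -ltrBrDr.
  exact: h hn.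
have bound s : 0 < s <= 1 -> (forall t, 0 <= t <= s -> B (c t)) ->
    `|chart_map e (c s) - chart_map e x| <= C * l.
  move=> s01 hB; rewrite -c0.
  apply: (chart_displacement_le_length hc Ae s01 C0 _ _ hl).
    by move=> t /hB[].
  move=> t /hB[dt ht] v; have [_ h] := hball ht.
  by have := h v; rewrite chart_mapK.
have [hall|hex] := pselect (forall t, 0 <= t <= 1 -> W (c t)).
  have h1 : 0 <= (1 : R) <= 1 by rewrite ler01 lexx.
  have [d1 _] := hall 1 h1; split => //.
  apply: bound; first by rewrite ltr01 lexx.
  by move=> t /hall[? /ltW].
exfalso.
pose S := [set t : R | 0 <= t <= 1 /\ ~ W (c t)].
have S0 : S !=set0.
  by move: hex => /existsNP[t /not_implyP[h1 h2]]; exists t.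
have cS : compact S.
  have -> : S = `[0%R, 1%R] `&` (c @^-1` (~` W)).
    by apply/seteqP; split => t /=; rewrite in_itv.
  apply: (subclosed_compact _ (@segment_compact R 0 1)); last by move=> t [].
  apply: closedI; first exact: itv_closed.
  apply: (@preimage_closed R^o M c); first by move=> t _; exact: hc.1.
  by rewrite -openC setCK openE => z /oW.
have cid : continuous (id : R -> R) by move=> t; exact: cvg_id.
have [s sS smin] := compact_EVT_min S0 cS (continuous_subspaceT cid).
rewrite inE in sS; have [/andP[s0 s1] nWs] := sS.
have Wt t : 0 <= t < s -> W (c t).
  move=> /andP[t0 ts]; apply: contrapT => nW.
  have st : s <= t.
    apply: (smin t); rewrite inE; split => //.
    by rewrite t0/=; apply: ltW; exact: lt_le_trans s1.
  by move: ts; rewrite ltNge st.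
have spos : 0 < s.
  rewrite lt_neqAle s0 andbT; apply/eqP => s0'; apply: nWs; rewrite -s0' c0.
  by split => //; rewrite subrr normr0.
have Bs : B (c s).
  by apply: (cvg_left_closed spos hc.1 cB) => t /Wt[? /ltW].
have hs : `|chart_map e (c s) - chart_map e x| <= C * l.
  apply: bound; first by rewrite spos.
  move=> t /andP[t0]; rewrite le_eqVlt => /orP[/eqP->//|ts].
  by have [|? /ltW] := Wt t; rewrite ?t0.
by apply: nWs; split; [case: Bs|exact: le_lt_trans lr].
Qed.

Lemma chart_le_dist z t : (riemannian_dist g x z <= t%:E)%E -> C * t < r ->
  chart_dom e z /\ `|chart_map e z - chart_map e x| <= C * t.
Proof.
move=> hd tr.
have step u : t < u -> C * u < r ->
    chart_dom e z /\ `|chart_map e z - chart_map e x| <= C * u.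
  move=> tu ur.
  have : (riemannian_dist g x z < u%:E)%E by apply: le_lt_trans hd _; rewrite lte_fin.
  move=> /ereal_inf_lt[_ [c [hc c0 c1 ->]] hl].
  by rewrite -c1; exact: short_curve_stays hc c0 (ltW hl) ur.
have tr' : t < r / C by rewrite ltr_pdivlMr// mulrC.
have [dz _] : chart_dom e z /\ `|chart_map e z - chart_map e x| <= C * ((t + r / C) / 2).
  apply: step; first by lra.
  by rewrite mulrC -ltr_pdivlMr//; lra.
split => //; rewrite leNgt; apply/negP => hlt.
have hlt' : t < `|chart_map e z - chart_map e x| / C by rewrite ltr_pdivlMr// mulrC.
set q := _ / C in hlt'.
(* The infimum defining the distance need not be attained, so the bound is available only for
   [u > t]; this [u] is small enough to contradict the strict inequality that was assumed. *)
pose u := Num.min ((t + r / C) / 2) ((t + q) / 2).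
have [_] : chart_dom e z /\ `|chart_map e z - chart_map e x| <= C * u.
  apply: step; first by rewrite lt_min; apply/andP; split; lra.
  have hu : u <= (t + r / C) / 2 by rewrite ge_min lexx.
  by rewrite [C * u]mulrC -ltr_pdivlMr//; lra.
have hu : u <= (t + q) / 2 by rewrite ge_min lexx orbT.
by rewrite [C * u]mulrC -ler_pdivrMr// -/q; lra.
Qed.

End LowerBound.
End Curves.

Lemma is_diff_sin_scaled (R : realType) (k t : R) :
  is_diff (t : R^o) (fun s : R^o => sin (k * s) : R^o)
    (fun v : R^o => v * (k * cos (k * t)) : R^o).
Proof.
have h1 : is_derive (t : R) (1 : R) (fun s : R => k * s) k.
  have h := @is_deriveZ R R^o R^o id k t 1 1 (is_derive_id _ _).
  by apply: (is_derive_eq h); rewrite /GRing.scale/= mulr1.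
have h2 := is_derive1_comp (is_derive_sin (k * t)) h1.
have dd : derivable (fun s : R^o => sin (k * s) : R^o) (t : R^o) 1 by case: h2.
have df : differentiable (fun s : R^o => sin (k * s) : R^o) (t : R^o).
  exact/derivable1_diffP.
apply: DiffDef => //.
rewrite diff1E//; apply/funext => v; rewrite derive1E.
have -> : 'D_1 (fun s : R^o => sin (k * s) : R^o) (t : R^o) = cos (k * t) * k.
  by case: h2.
by rewrite /GRing.scale/= mulrC [cos _ * _]mulrC mulrC.
Qed.

Section UpperBound.
Variables (R : realType) (n : nat) (M : topologicalType).
Variable A : smooth_structure R n M.
Variable g : riemannian_metric A.
Variables (e : chart R n M) (a w : 'rV[R]_n) (C : R).
Hypotheses (Ae : atlas A e).
Hypothesis hseg : forall s : R, `|s| <= 1 -> chart_img e (a + s *: w) /\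
  forall v, tnorm g (chart_inv e (a + s *: w))
    (tangent_of_coord A e (a + s *: w) v) <= C * `|v|.

(* The sine keeps the curve inside the chart for all times. *)
Let phi (t : R) : R := sin (pi / 2 * t).
Let line (t : R^o) : 'rV[R]_n := a + phi t *: w.
Let dphi (t : R) : R := pi / 2 * cos (pi / 2 * t).
Let curve (t : R^o) : M := chart_inv e (line t).

Let phi_le1 t : `|phi t| <= 1.
Proof. by rewrite ler_norml sin_geN1 sin_le1. Qed.

Let line_diff (t : R^o) : differentiable line t /\
  forall v : R^o, 'd line t v = (v * dphi t) *: w.
Proof.
have h1 := is_diff_sin_scaled (pi / 2) t.
have d1 : differentiable (fun s : R^o => sin (pi / 2 * s) : R^o) t by exact: ex_diff.
have h2 := diff_line a w (phi t).
have d2 : differentiable (fun s : R^o => a + s *: w) (phi t : R^o) by exact: ex_diff.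
split; first exact: (differentiable_comp d1 d2).
move=> v.
have h := congr1 (fun k : R^o -> 'rV[R]_n => k v) (diff_comp d1 d2).
apply: etrans h _.
have e2 := congr1 (fun k : R^o -> 'rV[R]_n =>
  k ('d (fun s : R^o => sin (pi / 2 * s) : R^o) t v)) (@diff_val _ _ _ _ _ _ _ h2).
apply: etrans e2 _.
have e1 := congr1 (fun k : R^o -> R^o => k v *: w) (@diff_val _ _ _ _ _ _ _ h1).
exact: e1.
Qed.

Let curve_img t : chart_img e (line t).
Proof. by have [] := hseg (phi_le1 t). Qed.

Let curve_cts : continuous curve.
Proof.
move=> t; apply: (@continuous_comp R^o _ _ line (chart_inv e) t).
  have [d _] := line_diff t; exact: differentiable_continuous.
exact: chart_inv_cts (curve_img t).
Qed.

Let curve_rep (e' : chart R n M) (t : R^o) : atlas A e' -> chart_dom e' (curve t) ->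
  differentiable (fun s : R^o => chart_map e' (curve s)) t /\
  forall v : R^o, 'd (fun s : R^o => chart_map e' (curve s)) t v =
    (v * dphi t) *: 'd (local_rep e e' id) (line t) w.
Proof.
move=> Ae' dt.
have [d1 e1] := line_diff t.
have [dc ec] := chart_imgP (curve_img t).
have D2 := Ck_map_diff (Ck_map_id A 1) Ae Ae' dc dt.
rewrite ec in D2.
have hn : \forall s \near t, local_rep e e' id (line s) = chart_map e' (curve s).
  by apply: (@filterE _ (nbhs t)) => s.
have h v := near_diff_comp (v : R^o) hn d1 D2.
split; first by have [] := h 1.
move=> v; have [_ hv] := h v; apply: etrans hv _.
apply: etrans (congr1 ('d (local_rep e e' id) (line t)) (e1 v)) _.
exact: linearZ.
Qed.

Let curve_C1 : C1_curve A curve.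
Proof.
split; first exact: curve_cts.
move=> e' Ae'; split.
  by move=> t dt; have [] := curve_rep Ae' dt.
move=> v t dt.
have [dc ec] := chart_imgP (curve_img t).
have [_ h2] := atlas_smooth Ae Ae' 1.
have dl : local_dom e e' id (line t) by exists (curve t).
have cd := h2 w (line t) dl.
have nU : nbhs t (curve @^-1` chart_dom e') by exact: curve_cts (nbhs_chart_dom dt).
have hcts : {for t, continuous (fun s : R^o =>
    (v * dphi s) *: 'd (local_rep e e' id) (line s) w)}.
  apply: (@cvgZ _ _ _ (nbhs t)).
    apply: (@cvgM _ _ (nbhs t)); first exact: cvg_cst.
    apply: (@cvgM _ _ (nbhs t)); first exact: cvg_cst.
    apply: (@continuous_comp R^o R^o R^o (fun s => pi / 2 * s) cos t).
      by apply: (@cvgM _ _ (nbhs t)); [exact: cvg_cst|exact: cvg_id].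
    exact: continuous_cos.
  apply: (@continuous_comp R^o _ _ line (fun b => 'd (local_rep e e' id) b w) t).
    have [d _] := line_diff t; exact: differentiable_continuous.
  exact: cd.
have [_ et] := curve_rep Ae' dt.
refine (eq_ind_r (fun l => (fun s : R^o =>
   'd (fun t0 : R^o => chart_map e' (curve t0)) s v) @ nbhs t --> l) _ (et v)).
apply: cvg_trans hcts.
apply: near_eq_cvg; apply: filterS nU => s ds.
by have [_ h] := curve_rep Ae' ds; exact: esym (h v).
Qed.

(** The factor [pi / 2] bounds the speed of the sine parametrization. Over the whole line it runs
    through [a + s *: w] with [s] of both signs, hence the form of [hseg]. *)
Lemma dist_le_chart :
  (riemannian_dist g (chart_inv e a) (chart_inv e (a + w)) <= (pi / 2 * C * `|w|)%:E)%E.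
Proof.
have c0 : curve 0 = chart_inv e a.
  by rewrite /curve /line /phi mulr0 sin0 scale0r addr0.
have c1 : curve 1 = chart_inv e (a + w).
  by rewrite /curve /line /phi mulr1 sin_pihalf scale1r.
apply: (@le_trans _ _ (curve_length g curve)).
  by apply: ereal_inf_lbound; exists curve; split.
apply: (@le_trans _ _ (\int[lebesgue_measure]_(t in `[0%R, 1%R]) (cst (pi / 2 * C * `|w|)%:E t))%E).
  have pi0 : 0 < pi / 2 :> R by rewrite divr_gt0 ?pi_gt0.
  have speed (t : R) : tnorm g (curve t) (velocity A curve t) <= pi / 2 * C * `|w|.
    have [dc ec] := chart_imgP (curve_img t).
    have [_ ev] := curve_rep (chart_at_atlas A (curve t)) (chart_at_dom A (curve t)).
    rewrite /velocity ev mul1r tnormZ.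
    have [_ h] := hseg (phi_le1 t).
    have hw := h w.
    apply: (@le_trans _ _ (pi / 2 * (C * `|w|))); last by rewrite mulrA.
    apply: ler_pM => //; first exact: tnorm_ge0.
    rewrite normrM (gtr0_norm pi0) ler_piMr ?(ltW pi0)//.
    by rewrite ler_norml cos_geN1 cos_le1.
  apply: ge0_integral_mono => //.
  - by move=> t _; rewrite lee_fin tnorm_ge0.
  - move=> t _; rewrite lee_fin; apply: le_trans (speed 0); exact: tnorm_ge0.
  - by move=> t _; rewrite lee_fin; exact: speed.
rewrite integral_cst/=; last exact: measurable_itv.
rewrite lebesgue_measure_itv/= lte_fin ltr01 -EFinB subr0 -EFinM mulr1.
exact: lexx.
Qed.

End UpperBound.

(** * Uniform charts *)

Lemma compact_finite_cover (M : topologicalType) (U : M -> set M) :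
  compact [set: M] -> (forall x, nbhs x (U x)) ->
  exists s : seq M, forall x, exists2 p, p \in s & U p x.
Proof.
move=> /compact_near_coveringP cM hU.
(* Along this filter, eventually means for every finite list that contains some given finite
   list. *)
pose F := filter_from [set: seq M] (fun s => [set s' : seq M | {subset s <= s'}]).
have FF : Filter F.
  apply: filter_from_filter; first by exists [::].
  move=> s s' _ _; exists (s ++ s') => // u h; split => z zs; apply: h;
    by rewrite mem_cat zs ?orbT.
have h := cM (seq M) F (fun s x => exists2 p, p \in s & U p x) FF.
have [x _|s _ hs] := h.
  exists (U x, [set s : seq M | x \in s]).
    split; first exact: hU.
    by exists [:: x] => // s hs /=; apply: hs; rewrite inE.
  by move=> [x' s] /= [ux xs]; exists x.
by exists s => x; exact: (hs s (fun _ h => h) x I).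
Qed.

Lemma seq_pos_min (R : realType) (T : eqType) (s : seq T) (r : T -> R) :
  (forall p, 0 < r p) -> exists2 r0, 0 < r0 & forall p, p \in s -> r0 <= r p.
Proof.
move=> r0; elim: s => [|p s [m m0 hm]]; first by exists 1.
exists (Num.min m (r p)); first by rewrite lt_min m0 r0.
move=> q; rewrite inE => /orP[/eqP->|/hm h]; first by rewrite ge_min lexx orbT.
by rewrite ge_min h.
Qed.

Lemma seq_max (R : realType) (T : eqType) (s : seq T) (r : T -> R) :
  exists2 r0, 1 <= r0 & forall p, p \in s -> r p <= r0.
Proof.
elim: s => [|p s [m m0 hm]]; first by exists 1.
exists (Num.max m (r p)); first by rewrite le_max m0.
move=> q; rewrite inE => /orP[/eqP->|/hm h]; first by rewrite le_max lexx orbT.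
by rewrite le_max h.
Qed.

Lemma compact_uniform_scale (R : realType) (M : topologicalType) (P : R -> M -> Prop) :
  compact [set: M] -> (forall x d d', 0 < d' -> d' <= d -> P d x -> P d' x) ->
  (forall x : M, exists2 d, 0 < d & \forall x' \near x, P d x') ->
  exists2 d, 0 < d & forall x, P d x.
Proof.
move=> cM mono hP.
have ex (x : M) : exists d, 0 < d /\ \forall x' \near x, P d x'.
  by have [d d0 h] := hP x; exists d.
have [dl hdl] := choice ex.
have [s hs] := compact_finite_cover cM (fun x => (hdl x).2).
have [d d0 hd] := seq_pos_min s (fun p => (hdl p).1).
exists d => // x; have [p ps hp] := hs x.
exact: mono (hd p ps) hp.
Qed.

Lemma seq_near_scale (R : realType) (M : topologicalType) (T : eqType)
    (s : seq T) (Q : T -> R -> M -> Prop) (x : M) :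
  (forall p x' d d', 0 < d' -> d' <= d -> Q p d x' -> Q p d' x') ->
  (forall p, p \in s -> exists2 d, 0 < d & \forall x' \near x, Q p d x') ->
  exists2 d, 0 < d & \forall x' \near x, forall p, p \in s -> Q p d x'.
Proof.
move=> mono; elim: s => [_|p s IH h]; first by exists 1 => //; apply: filterE.
have [|d1 d10 h1] := IH; first by move=> q qs; apply: h; rewrite inE qs orbT.
have [|d2 d20 h2] := h p; first by rewrite inE eqxx.
have m0 : 0 < Num.min d1 d2 by rewrite lt_min d10.
exists (Num.min d1 d2) => //.
apply: filterS2 h1 h2 => x' h1' h2' q; rewrite inE => /orP[/eqP->|/h1' hq].
  by apply: mono h2'; rewrite // ge_min lexx orbT.
by apply: mono hq; rewrite // ge_min lexx.
Qed.

Section UniformCharts.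
Variables (R : realType) (n : nat) (M : topologicalType).
Variable A : smooth_structure R n M.
Variables (g h : riemannian_metric A).

Definition comparable_at (c : chart R n M) (C : R) (a : 'rV[R]_n) : Prop :=
  chart_img c a /\ forall v,
  [/\ `|v| <= C * tnorm g (chart_inv c a) (tangent_of_coord A c a v),
      tnorm g (chart_inv c a) (tangent_of_coord A c a v) <= C * `|v|,
      `|v| <= C * tnorm h (chart_inv c a) (tangent_of_coord A c a v) &
      tnorm h (chart_inv c a) (tangent_of_coord A c a v) <= C * `|v|].

Lemma comparable_at_mono c C C' a : C <= C' -> comparable_at c C a -> comparable_at c C' a.
Proof.
move=> CC [ia ha]; split => // v; have [h1 h2 h3 h4] := ha v.
split; [apply: le_trans h1 _|apply: le_trans h2 _|apply: le_trans h3 _|apply: le_trans h4 _];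
  by rewrite ler_wpM2r// tnorm_ge0.
Qed.

(** The factor 8 leaves a ball of 7 radii around every point within one radius of the centre, as
    [uniform_charts] asks. *)
Lemma good_chart x : exists rC : R * R, [/\ 0 < rC.1, 1 <= rC.2 &
  forall a, `|a - chart_map (chart_at A x) x| <= 8 * rC.1 ->
    comparable_at (chart_at A x) rC.2 a].
Proof.
have Ac := chart_at_atlas A x; have dx := chart_at_dom A x.
have [C1 C11 h1] := metric_comparison g Ac dx.
have [C2 C21 h2] := metric_comparison h Ac dx.
have [r r0 hr] := nbhs_closed_ball (filterI (nbhs_chart_img dx) (filterI h1 h2)).
exists (r / 8, C1 + C2); split => /=; first by rewrite divr_gt0.
  by lra.
move=> a; rewrite mulrC divfK// => /hr[ia [h1a h2a]]; split => // v.
have [g1 g2] := h1a v; have [g3 g4] := h2a v.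
have t1 := tnorm_ge0 g (chart_inv (chart_at A x) a) (tangent_of_coord A (chart_at A x) a v).
have t2 := tnorm_ge0 h (chart_inv (chart_at A x) a) (tangent_of_coord A (chart_at A x) a v).
have nv : 0 <= `|v| by [].
have C10 : 0 <= C1 by lra.
have C20 : 0 <= C2 by lra.
by split; rewrite mulrDl; [apply: le_trans g1 _|apply: le_trans g2 _|apply: le_trans g3 _|apply: le_trans g4 _];
  rewrite ?lerDl ?lerDr mulr_ge0.
Qed.

(** A single number [d] is both the radius of validity and the inverse of the constant. The
    condition is thus monotone in [d], the form in which compactness turns a local statement into a
    uniform one. *)
Definition taylor_at (f : M -> M) (c e : chart R n M) (d : R) (x : M) : Prop :=
  let DF := 'd (local_rep c e f) (chart_map c x) in
  (forall v, `|DF v| <= d^-1 * `|v|) /\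
  forall z z' t, chart_dom c z -> chart_dom c z' ->
    `|chart_map c z - chart_map c x| <= t ->
    `|chart_map c z' - chart_map c x| <= t -> t <= d ->
    [/\ chart_dom e (f z), chart_dom e (f z') &
      `|chart_map e (f z) - chart_map e (f z') - DF (chart_map c z - chart_map c z')|
        <= d^-1 * t * `|chart_map c z - chart_map c z'|].

Lemma taylor_at_mono f c e d d' x : 0 < d' -> d' <= d ->
  taylor_at f c e d x -> taylor_at f c e d' x.
Proof.
move=> d'0 dd [h1 h2]; have d0 : 0 < d by exact: lt_le_trans dd.
have dV : d^-1 <= d'^-1 by rewrite lef_pV2.
split => [v|z z' t dz dz' hz hz' td].
  by apply: le_trans (h1 v) _; rewrite ler_wpM2r.
have [k1 k2 k3] := h2 z z' t dz dz' hz hz' (le_trans td dd).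
split => //; apply: le_trans k3 _; rewrite -!mulrA ler_wpM2r// mulr_ge0//.
exact: le_trans hz.
Qed.

Lemma taylor_near f c e x : Ck_map A 2 f -> atlas A c -> atlas A e ->
  chart_dom c x -> chart_dom e (f x) ->
  exists2 d, 0 < d & \forall x' \near (x : M), taylor_at f c e d x'.
Proof.
move=> hf Ac Ae dx dfx.
have [K [r [K0 r0 hT]]] := C2_local_taylor hf Ac Ae dx dfx.
have d0 : 0 < Num.min r K^-1 by rewrite lt_min r0 invr_gt0.
have dr : Num.min r K^-1 <= r by rewrite ge_min lexx.
have Kd : K <= (Num.min r K^-1)^-1.
  by rewrite -[X in X <= _]invrK lef_pV2 ?posrE ?invr_gt0// ge_min lexx orbT.
exists (Num.min r K^-1) => //.
set d := Num.min r K^-1 in d0 dr Kd *; clearbody d.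
have hn : nbhs x [set x' | `|chart_map c x' - chart_map c x| <= r].
  have := nbhsx_ballx (chart_map c x) r r0.
  move=> hb.
  have h2 : nbhs x (chart_map c @^-1` ball (chart_map c x) r) := chart_map_cts dx hb.
  apply: filterS h2 => x'.
  by rewrite /= -ball_normE /= distrC => /ltW.
apply: filterS hn => x' /= hx'; have [k1 k2] := hT _ hx'.
split => [v|z z' t dz dz' hz hz' td].
  by apply: le_trans (k1 v) _; rewrite ler_wpM2r.
have t0 : 0 <= t by exact: le_trans hz.
have dom_of w : chart_dom c w -> local_dom c e f (chart_map c w) -> chart_dom e (f w).
  by move=> dw [u [/= du dfu] /(chart_map_inj du dw) <-].
have [l1 T1] := k2 _ _ t hz hz' (le_trans td dr).
have [l2 _] := k2 _ _ t hz' hz (le_trans td dr).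
split; [exact: dom_of dz l1|exact: dom_of dz' l2|].
rewrite /local_rep !(chart_mapK dz) !(chart_mapK dz') in T1.
apply: le_trans T1 _; rewrite -!mulrA ler_wpM2r// mulr_ge0//.
Qed.

(** The chart [kappa x] is picked among finitely many, without continuity in [x]. Uniformity comes
    from compactness of [M], applied to all pairs of these charts simultaneously. *)
Lemma uniform_charts (f : M -> M) : compact [set: M] -> Ck_map A 2 f ->
  exists (kappa : M -> chart R n M) (C r d : R),
  [/\ [/\ 1 <= C, 0 < r & 0 < d], (forall x, atlas A (kappa x)),
      (forall x, chart_dom (kappa x) x),
      (forall x a, `|a - chart_map (kappa x) x| <= 7 * r -> comparable_at (kappa x) C a) &
      forall x, taylor_at f (kappa x) (kappa (f x)) d x].
Proof.
move=> cM hf.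
have [rC hrC] := choice good_chart.
pose c p := chart_at A p.
pose U p := [set z | chart_dom (c p) z /\
  `|chart_map (c p) z - chart_map (c p) p| < (rC p).1].
pose V p := [set z | chart_dom (c p) z /\
  `|chart_map (c p) z - chart_map (c p) p| <= (rC p).1].
have hU x : nbhs x (U x).
  have [r0 _ _] := hrC x; have dx := chart_at_dom A x.
  apply: filterI; first exact: nbhs_chart_dom.
  have hb := nbhsx_ballx (chart_map (c x) x) _ r0.
  have h2 : nbhs x (chart_map (c x) @^-1` ball (chart_map (c x) x) (rC x).1) :=
    chart_map_cts dx hb.
  apply: filterS h2 => x'.
  by rewrite /= -ball_normE /= distrC.
have cV p : closed (V p).
  apply: (chart_ball_closed A) => b hb.
  have [r0 _ hc] := hrC p.
  by have [] := hc b (le_trans hb (_ : _ <= 8 * (rC p).1)); first lra.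
have [s hs] := compact_finite_cover cM hU.
have rpos p : 0 < (rC p).1 by have [] := hrC p.
have [r r0 hr] := seq_pos_min s rpos.
have [C C1 hC] := seq_max s (fun p => (rC p).2).
have ex x : exists p, p \in s /\ U p x.
  by have [p ps hp] := hs x; exists p.
have [i hi] := choice ex.
(* The open sets [U] serve for covering and the closed sets [V] for this condition: off [V] it holds
   vacuously on a whole neighbourhood, and on [V] the points lie in the chart domains. *)
pose T p q d x := V p x -> V q (f x) -> taylor_at f (c p) (c q) d x.
have [d d0 hd] : exists2 d, 0 < d & forall x p, p \in s -> forall q, q \in s -> T p q d x.
  apply: (compact_uniform_scale cM).
    move=> x d d' d'0 dd hT p ps q qs vp vq.
    exact: taylor_at_mono d'0 dd (hT p ps q qs vp vq).
  move=> x.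
  apply: (seq_near_scale (Q := fun p d x => forall q, q \in s -> T p q d x)).
    move=> p x' d d' d'0 dd hT q qs vp vq.
    exact: taylor_at_mono d'0 dd (hT q qs vp vq).
  move=> p ps.
  apply: (seq_near_scale (Q := fun q d x => T p q d x)).
    move=> q x' d d' d'0 dd hT vp vq.
    exact: taylor_at_mono d'0 dd (hT vp vq).
  move=> q qs.
  have [vp|nvp] := pselect (V p x); last first.
    exists 1 => //.
    have nb : nbhs x (~` V p).
      by apply: open_nbhs_nbhs; split; first exact: closed_openC.
    by apply: filterS nb => x' nv vp.
  have [vq|nvq] := pselect (V q (f x)); last first.
    exists 1 => //.
    have nb : nbhs (f x) (~` V q).
      by apply: open_nbhs_nbhs; split; first exact: closed_openC.
    have h2 : nbhs x (f @^-1` (~` V q)) := hf.1 x _ nb.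
    by apply: filterS h2 => x' nv _ vq.
  have [d d0 hd] := taylor_near hf (chart_at_atlas A p) (chart_at_atlas A q) vp.1 vq.1.
  by exists d => //; apply: filterS hd => x' hx' _ _.
have UV p x : U p x -> V p x by move=> [dx /ltW].
exists (fun x => c (i x)), C, r, d; split => //.
- by move=> x; exact: chart_at_atlas.
- by move=> x; have [_ []] := hi x.
- move=> x a ha; have [ps [dx hx]] := hi x.
  have [_ _ h8] := hrC (i x).
  apply: (comparable_at_mono (hC _ ps)); apply: h8.
  rewrite -(subrK (chart_map (c (i x)) x) a) -addrA; apply: le_trans (ler_normD _ _) _.
  by have := hr _ ps; move: ha hx; rewrite -/(c (i x)); lra.
- move=> x; have [ps ux] := hi x; have [qs ufx] := hi (f x).
  by apply: (hd x _ ps _ qs); exact: UV.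
Qed.

End UniformCharts.

(** * Conformal cocycles *)

Section Cocycle.
Variables (R : realType) (M : Type) (V : lmodType R) (f : M -> M).
Variables (D : M -> {linear V -> V}) (N H : M -> V -> R) (a : M -> R).
Variables (Pu : M -> {linear V -> V}) (C sigma : R).

(** [N] is the norm in which [D] is conformal on the unstable space, with factor [a]; [H] is the
    adapted norm, in which expansion and contraction hold at every step. [Pu] is the projection on
    the unstable space along the stable one, and [C] absorbs all comparisons. *)
Record conformal_splitting : Prop := ConformalSplitting {
  cs_C : 1 <= C ;
  cs_sigma : 1 < sigma ;
  cs_N_triangle : forall x v w, N x (v + w) <= N x v + N x w ;
  cs_N_scale : forall x c v, N x (c *: v) = `|c| * N x v ;
  cs_N_eq0 : forall x v, N x v = 0 -> v = 0 ;
  cs_H_triangle : forall x v w, H x (v + w) <= H x v + H x w ;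
  cs_H_le : forall x v, H x v <= C * N x v ;
  cs_N_le : forall x v, N x v <= C * H x v ;
  cs_proj_bound : forall x v, N x (Pu x v) <= C * N x v ;
  cs_proj_idem : forall x v, Pu x (Pu x v) = Pu x v ;
  cs_proj_comm : forall x v, Pu (f x) (D x v) = D x (Pu x v) ;
  cs_factor_ge0 : forall x, 0 <= a x ;
  cs_factor_bound : exists L, forall x, a x <= L ;
  cs_conformal : forall x v, N (f x) (D x (Pu x v)) = a x * N x (Pu x v) ;
  cs_expand : forall x v, sigma * H x (Pu x v) <= H (f x) (D x (Pu x v)) ;
  cs_contract : forall x v, H (f x) (D x (v - Pu x v)) <= H x (v - Pu x v) ;
  cs_unstable : forall x, exists2 v, Pu x v = v & N x v = 1
}.

Hypothesis hC : conformal_splitting.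

Definition factor (k : nat) (x : M) : R := \prod_(i < k) a (iter i f x).

Fixpoint cocycle (k : nat) (x : M) (v : V) : V :=
  if k is j.+1 then D (iter j f x) (cocycle j x v) else v.

Lemma factorS k x : factor k.+1 x = factor k x * a (iter k f x).
Proof. by rewrite /factor big_ord_recr. Qed.

Lemma factor_add i k x : factor (i + k) x = factor k x * factor i (iter k f x).
Proof.
elim: i => [|i IH]; first by rewrite /factor big_ord0 mulr1.
by rewrite addSn !factorS IH -iterD mulrA.
Qed.

Lemma factor0 x : factor 0 x = 1.
Proof. by rewrite /factor big_ord0. Qed.

Lemma factor_ge0 k x : 0 <= factor k x.
Proof. by apply: prodr_ge0 => i _; exact: (cs_factor_ge0 hC). Qed.

Lemma cs_C0 : 0 < C. Proof. exact: lt_le_trans ltr01 (cs_C hC). Qed.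
Hint Resolve cs_C0 : core.

Lemma cs_N0 x : N x 0 = 0.
Proof. by rewrite -(scale0r (0 : V)) (cs_N_scale hC) normr0 mul0r. Qed.

Lemma cs_NN x v : N x (- v) = N x v.
Proof. by rewrite -scaleN1r (cs_N_scale hC) normrN normr1 mul1r. Qed.

Lemma cs_N_ge0 x v : 0 <= N x v.
Proof.
have := cs_N_triangle hC x v (- v).
by rewrite subrr cs_N0 cs_NN -mulr2n pmulrn_lge0.
Qed.
Hint Resolve cs_N_ge0 : core.

Lemma cs_N_sub x v w : N x (v - w) <= N x v + N x w.
Proof. by rewrite -[X in _ <= _ + X]cs_NN; exact: (cs_N_triangle hC). Qed.

Lemma cs_N_dist x v w : N x v - N x w <= N x (v - w).
Proof.
by rewrite lerBlDr; apply: le_trans (cs_N_triangle hC _ _ _); rewrite subrK.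
Qed.

Lemma cs_N_subC x v w : N x (v - w) = N x (w - v).
Proof. by rewrite -cs_NN opprB. Qed.

Lemma cocycleB k x v w :
  cocycle k x (v - w) = cocycle k x v - cocycle k x w.
Proof. by elim: k => //= k ->; rewrite linearB. Qed.

Lemma cocycleZ k x c v : cocycle k x (c *: v) = c *: cocycle k x v.
Proof. by elim: k => //= k ->; rewrite linearZ. Qed.

Lemma cocycle_unstable k x v : Pu x v = v ->
  Pu (iter k f x) (cocycle k x v) = cocycle k x v.
Proof. by move=> hv; elim: k => //= k IH; rewrite (cs_proj_comm hC) IH. Qed.

Lemma N_cocycle k x v : Pu x v = v ->
  N (iter k f x) (cocycle k x v) = factor k x * N x v.
Proof.
move=> hv; elim: k => [|k IH] /=; first by rewrite factor0 mul1r.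
rewrite -(cocycle_unstable k hv) (cs_conformal hC) (cocycle_unstable k hv) IH.
by rewrite factorS; ring.
Qed.

Lemma H_cocycle k x v : Pu x v = v ->
  sigma ^+ k * H x v <= H (iter k f x) (cocycle k x v).
Proof.
move=> hv; elim: k => [|k IH] /=; first by rewrite expr0 mul1r.
rewrite -(cocycle_unstable k hv); apply: le_trans (cs_expand hC _ _).
rewrite (cocycle_unstable k hv) exprS -mulrA ler_wpM2l //.
by apply: ltW; apply: lt_trans (cs_sigma hC).
Qed.

(** Both sides measure the growth of one unit unstable vector, in [H] by expansion and in [N] by
    conformality. The factor [C ^+ 2] pays for changing the norm at both ends. *)
Lemma factor_lb k x : sigma ^+ k <= C ^+ 2 * factor k x.
Proof.
have [v hv nv] := cs_unstable hC x.
have h1 := H_cocycle k hv; have h2 := N_cocycle k hv.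
have h3 := cs_H_le hC (iter k f x) (cocycle k x v).
have h4 := cs_N_le hC x v; rewrite nv in h4 h2.
have s0 : 0 <= sigma ^+ k.
  by apply: exprn_ge0; apply: ltW; apply: lt_trans (cs_sigma hC).
have C0 := cs_C0.
have : sigma ^+ k * 1 <= sigma ^+ k * (C * H x v) by exact: ler_wpM2l.
rewrite mulr1 => /le_trans; apply.
rewrite mulrCA expr2 -mulrA ler_pM2l //.
by apply: le_trans h1 _; apply: le_trans h3 _; rewrite h2 mulr1.
Qed.

Lemma factor_gt0 k x : 0 < factor k x.
Proof.
have s0 : 0 < sigma ^+ k by apply: exprn_gt0; apply: lt_trans (cs_sigma hC).
have := lt_le_trans s0 (factor_lb k x).
by rewrite pmulr_rgt0 // exprn_gt0.
Qed.

Lemma factor_mono i k x : (i <= k)%N ->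
  factor i x * sigma ^+ (k - i) <= C ^+ 2 * factor k x.
Proof.
move=> ik; rewrite -{2}(subnK ik) factor_add mulrCA ler_wpM2l //.
  exact: factor_ge0.
exact: factor_lb.
Qed.

Lemma factor_le i k x : (i <= k)%N -> factor i x <= C ^+ 2 * factor k x.
Proof.
move=> ik; apply: le_trans (factor_mono x ik).
rewrite ler_peMr ?factor_ge0// exprn_ege1//; exact/ltW/(cs_sigma hC).
Qed.

(** By [factor_mono] the terms decay geometrically backwards from [k]. This makes the sum of all
    errors along an orbit comparable to the last one. *)
Lemma factor_sum k x :
  \sum_(i < k) factor i x <= C ^+ 2 / (sigma - 1) * factor k x.
Proof.
have s1 := cs_sigma hC; have s0 : 0 < sigma by lra.
have hs : forall j, \sum_(i < j) (sigma ^- (j - i)) <= (sigma - 1)^-1.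
  elim=> [|j IH]; first by rewrite big_ord0 invr_ge0; lra.
  rewrite big_ord_recr /= subSnn expr1.
  have -> : \sum_(i < j) sigma ^- (j.+1 - i) = (\sum_(i < j) sigma ^- (j - i)) / sigma.
    rewrite mulr_suml; apply: eq_bigr => i _.
    by rewrite subSn; [rewrite exprSr invfM mulrC|exact/ltnW/ltn_ord].
  have -> : (sigma - 1)^-1 = (sigma - 1)^-1 / sigma + sigma^-1.
    by field; rewrite ?andbT; apply/andP; split; lra.
  by rewrite lerD2r ler_pM2r // invr_gt0.
apply: (@le_trans _ _ (\sum_(i < k) (C ^+ 2 * factor k x * sigma ^- (k - i)))).
  apply: ler_sum => i _.
  by rewrite ler_pdivlMr ?exprn_gt0//; apply/factor_mono/ltnW/ltn_ord.
rewrite -mulr_sumr [X in _ <= X]mulrAC ler_wpM2l//.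
by rewrite mulr_ge0 ?factor_ge0// exprn_ge0// ltW.
Qed.

(* Locked because [mulr_gt0] and [mulr_ge0] would otherwise unfold it. *)
Definition pert_const : R := locked (2 * (C + C ^+ 4 + C ^+ 5)).
(** Without errors, the unstable part contributes [C] and the stable part [C ^+ 4 + C ^+ 5];
    [pert_const] is twice that sum. The errors contribute [pert_const] times their sum times
    [C ^+ 3 + C ^+ 4 + C ^+ 5], and [pert_small] keeps this below the remaining half. *)
Definition pert_small : R := (2 * (C ^+ 3 + C ^+ 4 + C ^+ 5))^-1.

Lemma pert_const_gt0 : 0 < pert_const.
Proof.
have C0 := cs_C0; rewrite /pert_const -lock mulr_gt0//.
by rewrite !addr_gt0 ?exprn_gt0.
Qed.

Lemma pert_const_ge1 : 1 <= pert_const.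
Proof.
have C1 := cs_C hC; rewrite /pert_const -lock.
have h4 : 1 <= C ^+ 4 by exact: exprn_ege1.
have h5 : 1 <= C ^+ 5 by exact: exprn_ege1.
by lra.
Qed.

Lemma pert_small_gt0 : 0 < pert_small.
Proof.
have C0 := cs_C0; rewrite /pert_small invr_gt0 mulr_gt0//.
by rewrite !addr_gt0 ?exprn_gt0.
Qed.

Section Perturbation.
Variables (x : M) (e : nat -> V) (t : nat -> R) (k : nat).
Hypothesis t0 : forall j, 0 <= t j.
Hypothesis he : forall j, (j < k)%N ->
  N (iter j.+1 f x) (e j.+1 - D (iter j f x) (e j)) <=
    t j * N (iter j f x) (e j).
Hypothesis ht : \sum_(j < k) t j <= pert_small.

Local Notation B := pert_const.
Let n0 := N x (e 0).

(** The three bounds need each other, hence one induction. The unstable deviation is followed in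
    [N], where [D] multiplies it by exactly [a], the same factor as the main term. The stable part
    is followed in [H], where it does not grow; in [N] every step would cost a constant. *)
Lemma perturbation_step j : (j <= k)%N ->
  [/\ N (iter j f x) (e j) <= B * factor j x * n0,
      N (iter j f x) (Pu (iter j f x) (e j) - cocycle j x (Pu x (e 0)))
        <= C ^+ 3 * B * (\sum_(i < j) t i) * factor j x * n0 &
      H (iter j f x) (e j - Pu (iter j f x) (e j))
        <= H x (e 0 - Pu x (e 0)) +
           (C + C ^+ 2) * B * n0 * \sum_(i < j) (t i * factor i x)].
Proof.
have C1 := cs_C hC; have C0 := cs_C0.
have n00 : 0 <= n0 by exact: cs_N_ge0.
have B0 : 0 < B := pert_const_gt0.
have C0' := ltW C0; have B0' := ltW B0.
elim: j => [|j IH] jk.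
  rewrite /= !big_ord0 factor0 subrr cs_N0 !mulr1 !(mulr0, mul0r) addr0.
  by split=> //; rewrite ler_peMl// pert_const_ge1.
have [IH1 IH2 IH3] := IH (ltnW jk).
set xj := iter j f x in IH1 IH2 IH3 *.
have /= hE := he jk; rewrite -/xj in hE.
set E := e j.+1 - D xj (e j) in hE.
have eE : e j.+1 = D xj (e j) + E by rewrite /E addrC subrK.
have hE' : N (f xj) E <= t j * (B * factor j x * n0).
  by apply: le_trans hE _; rewrite ler_wpM2l.
have U : N (f xj) (Pu (f xj) (e j.+1) - cocycle j.+1 x (Pu x (e 0)))
        <= C ^+ 3 * B * (\sum_(i < j.+1) t i) * factor j.+1 x * n0.
  rewrite /= -/xj eE linearD (cs_proj_comm hC) addrAC -linearB.
  apply: le_trans (cs_N_triangle hC _ _ _) _.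
  have hu : Pu xj (Pu xj (e j) - cocycle j x (Pu x (e 0))) =
      Pu xj (e j) - cocycle j x (Pu x (e 0)).
    by rewrite linearB (cs_proj_idem hC) cocycle_unstable// (cs_proj_idem hC).
  rewrite -hu (cs_conformal hC) hu big_ord_recr /= mulrDr !mulrDl.
  apply: lerD.
    rewrite factorS -/xj.
    rewrite [X in _ <= X](_ : _ = a xj * (C ^+ 3 * B * (\sum_(i < j) t i) * factor j x * n0)); last by ring.
    by rewrite ler_wpM2l// (cs_factor_ge0 hC).
  apply: le_trans (cs_proj_bound hC _ _) _.
  apply: (@le_trans _ _ (C * (t j * (B * factor j x * n0)))).
    by rewrite ler_pM2l.
  have q0 : 0 <= C * t j * B * n0 by do 3!(apply: mulr_ge0 => //).
  have := ler_wpM2l q0 (factor_le x (leqnSn j)).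
  by move=> h; lra.
have S : H (f xj) (e j.+1 - Pu (f xj) (e j.+1))
        <= H x (e 0 - Pu x (e 0)) +
           (C + C ^+ 2) * B * n0 * \sum_(i < j.+1) (t i * factor i x).
  rewrite eE linearD (cs_proj_comm hC) opprD addrACA -linearB.
  apply: le_trans (cs_H_triangle hC _ _ _) _.
  rewrite big_ord_recr /= mulrDr addrA; apply: lerD.
    by apply: le_trans IH3; exact: (cs_contract hC).
  apply: le_trans (cs_H_le hC _ _) _.
  have : N (f xj) (E - Pu (f xj) E) <= (1 + C) * N (f xj) E.
    apply: le_trans (cs_N_sub _ _ _) _; rewrite mulrDl mul1r lerD2l.
    exact: (cs_proj_bound hC).
  move=> h; apply: (@le_trans _ _ (C * ((1 + C) * (t j * (B * factor j x * n0))))).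
    rewrite ler_pM2l//; apply: le_trans h _; rewrite ler_wpM2l//; lra.
  by rewrite le_eqVlt; apply/orP; left; apply/eqP; ring.
split => //.
set T := \sum_(i < j.+1) t i.
have T0 : 0 <= T by apply: sumr_ge0.
have hT : T <= pert_small.
  apply: le_trans ht; rewrite /T -(big_mkord xpredT t) -(big_mkord xpredT t).
  rewrite (big_cat_nat (n := j.+1) (p := k))//=.
  by rewrite lerDl sumr_ge0.
have hTA : \sum_(i < j.+1) (t i * factor i x) <= T * (C ^+ 2 * factor j.+1 x).
  rewrite /T mulr_suml; apply: ler_sum => i _.
  by rewrite ler_wpM2l// factor_le// ltnW.
set A := factor j.+1 x in U hTA *.
have A0 : 0 <= A by exact: factor_ge0.
(* This absorbs the initial stable part, which has no growing factor, into a multiple of [A]. *)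
have h1 : 1 <= C ^+ 2 * A by rewrite -(factor0 x); exact: factor_le.
have h2 : N (f xj) (e j.+1) <= N (f xj) (Pu (f xj) (e j.+1)) +
    N (f xj) (e j.+1 - Pu (f xj) (e j.+1)).
  by apply: le_trans (cs_N_triangle hC _ _ _); rewrite addrC subrK.
have h3 : N (f xj) (Pu (f xj) (e j.+1)) <= C * A * n0 + C ^+ 3 * B * T * A * n0.
  have h := cs_N_dist (f xj) (Pu (f xj) (e j.+1)) (cocycle j.+1 x (Pu x (e 0))).
  have := le_trans h U; rewrite lerBlDl => /le_trans; apply.
  have := N_cocycle j.+1 (cs_proj_idem hC x (e 0)).
  rewrite lerD2r /= -/xj -/A => ->.
  rewrite (_ : C * A * n0 = A * (C * n0)); last by ring.
  by rewrite ler_wpM2l//; exact: (cs_proj_bound hC).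
have h4 : N (f xj) (e j.+1 - Pu (f xj) (e j.+1)) <=
    C * ((C + C ^+ 2) * n0 * (C ^+ 2 * A) +
         (C + C ^+ 2) * B * n0 * (T * (C ^+ 2 * A))).
  apply: le_trans (cs_N_le hC _ _) _; rewrite ler_pM2l//.
  apply: le_trans S _; apply: lerD.
    apply: le_trans (cs_H_le hC _ _) _.
    have : N x (e 0 - Pu x (e 0)) <= (1 + C) * n0.
      apply: le_trans (cs_N_sub _ _ _) _; rewrite mulrDl mul1r lerD2l.
      exact: (cs_proj_bound hC).
    move=> h; apply: (@le_trans _ _ ((C + C ^+ 2) * n0)).
      rewrite (_ : (C + C ^+ 2) * n0 = C * ((1 + C) * n0)); last by ring.
      by rewrite ler_pM2l.
    by rewrite ler_peMr// mulr_ge0// addr_ge0 ?exprn_ge0// ltW.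
  rewrite ler_wpM2l// !mulr_ge0// ?addr_ge0 ?exprn_ge0//; exact: ltW.
apply: le_trans h2 _; apply: le_trans (lerD h3 h4) _.
set q := C ^+ 3 + C ^+ 4 + C ^+ 5.
have q0 : 0 < q by rewrite /q !addr_gt0 ?exprn_gt0.
have hTq : T * (2 * q) <= 1.
  move: hT; rewrite /pert_small -/q => hT.
  by rewrite -ler_pdivlMr ?mulr_gt0// div1r.
have -> : C * A * n0 + C ^+ 3 * B * T * A * n0 +
  C * ((C + C ^+ 2) * n0 * (C ^+ 2 * A) +
       (C + C ^+ 2) * B * n0 * (T * (C ^+ 2 * A))) =
  (B / 2 + (B / 2) * (T * (2 * q))) * A * n0 by rewrite /pert_const -lock /q; field.
rewrite ler_wpM2r// ler_wpM2r//.
have : B / 2 * (T * (2 * q)) <= B / 2 * 1.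
  by rewrite ler_pM2l// divr_gt0.
lra.
Qed.

Lemma perturbation :
  N (iter k f x) (e k) <= pert_const * factor k x * N x (e 0) /\
  N (iter k f x) (Pu (iter k f x) (e k) - cocycle k x (Pu x (e 0)))
    <= C ^+ 3 * pert_const * (\sum_(i < k) t i) * factor k x * N x (e 0).
Proof. by have [] := perturbation_step (leqnn k). Qed.

End Perturbation.

End Cocycle.

(** * Orbits of small balls *)

(** Used to meet several smallness conditions at once: each pair of the list is one upper bound on
    the scale [s]. *)
Lemma small_scale (R : realFieldType) (l : seq (R * R)) :
  all (fun b => 0 < b.2) l ->
  exists2 s, 0 < s & all (fun b => b.1 * s <= b.2) l.
Proof.
suff h : all (fun b => 0 < b.2) l -> exists2 s0, 0 < s0 &
    forall s, 0 < s -> s <= s0 -> all (fun b => b.1 * s <= b.2) l.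
  by move=> /h[s s0 hs]; exists s => //; exact: hs.
elim: l => [|[c b] l IH] /=; first by exists 1.
move=> /andP[b0 /IH[s s0 hs]].
have c0 : 0 < `|c| + 1 by rewrite ltr_wpDl.
exists (Num.min s (b / (`|c| + 1))); first by rewrite lt_min s0 divr_gt0.
move=> u u0; rewrite le_min => /andP[us ub]; rewrite hs// andbT.
move: ub; rewrite ler_pdivlMr// => ub; apply: le_trans ub.
by rewrite [X in _ <= X]mulrC ler_wpM2r ?ltW// (le_lt_trans (ler_norm c)) ?ltrDl.
Qed.

Lemma expr_unbounded (R : archiRealFieldType) (s X : R) : 1 < s ->
  exists n : nat, X < s ^+ n.
Proof.
move=> s1.
have bern n : 1 + n%:R * (s - 1) <= s ^+ n.
  elim: n => [|n IH]; first by rewrite mul0r addr0.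
  rewrite exprS -natr1.
  have : s * (1 + n%:R * (s - 1)) <= s * s ^+ n by rewrite ler_pM2l//; lra.
  apply: le_trans.
  have : 0 <= n%:R * (s - 1) ^+ 2 by rewrite mulr_ge0// sqr_ge0.
  nra.
have [m hm] : exists m : nat, X / (s - 1) < m%:R.
  exists (Num.bound `|X / (s - 1)|).
  exact: le_lt_trans (ler_norm _) (archi_boundP (normr_ge0 _)).
exists m; apply: lt_le_trans (bern m).
by move: hm; rewrite ltr_pdivrMr; lra.
Qed.

Section Nonlinear.
Variables (R : realType) (M : Type) (V : lmodType R) (f : M -> M).
Variables (D : M -> {linear V -> V}) (N H : M -> V -> R) (a : M -> R).
Variables (Pu : M -> {linear V -> V}) (C sigma : R).
Variables (d : M -> M -> \bar R) (dom : M -> M -> Prop) (Dl : M -> M -> V).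
Variables (rho K : R).

(* [Dl x z] is the displacement from x to z, read in the tangent space at x; it
   is meaningful when [dom x z]. *)
Record displacement_charts : Prop := DisplacementCharts {
  dc_rho : 0 < rho ;
  dc_K : 0 < K ;
  dc_dom_refl : forall x, dom x x ;
  dc_refl : forall x, Dl x x = 0 ;
  dc_inj : forall x p q, dom x p -> dom x q -> Dl x p = Dl x q -> p = q ;
  dc_surj : forall x v, N x v <= rho -> exists2 p, dom x p & Dl x p = v ;
  dc_near : forall x p q t, dom x p -> N x (Dl x p) <= rho -> t <= rho ->
    (d p q <= t%:E)%E -> dom x q /\ N x (Dl x q - Dl x p) <= C * t ;
  dc_dist : forall x p q, dom x p -> dom x q ->
    N x (Dl x p) <= rho -> N x (Dl x q) <= rho ->
    (d p q <= (C * N x (Dl x q - Dl x p))%:E)%E ;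
  dc_taylor : forall x p q t, dom x p -> dom x q ->
    N x (Dl x p) <= t -> N x (Dl x q) <= t -> t <= rho ->
    [/\ dom (f x) (f p), dom (f x) (f q) &
        N (f x) (Dl (f x) (f p) - Dl (f x) (f q) - D x (Dl x p - Dl x q))
          <= K * t * N x (Dl x p - Dl x q)]
}.

Hypothesis hC : conformal_splitting f D N H a Pu C sigma.
Hypothesis hD : displacement_charts.

Local Notation A := (factor f a).
Local Notation B := (pert_const C).
Local Notation c2 := (C ^+ 2 / (sigma - 1)).

(** The first entry keeps the orbit in the domain of the charts, that is [B * A i x * r <= rho] for
    all [i <= k]; the second makes the sum of the Taylor errors at most [pert_small C]. *)
Definition scale0 : R :=
  Num.min (rho / (B * C ^+ 2)) (pert_small C / (K * B * c2)).
Definition quad_const : R := locked (C ^+ 3 * B * (K * B * c2)).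

Let C0 : 0 < C := cs_C0 hC.
Let C1 : 1 <= C := cs_C hC.
Let B0 : 0 < B := pert_const_gt0 hC.
Let B1 : 1 <= B := pert_const_ge1 hC.
Let K0 : 0 < K := dc_K hD.
Let rho0 : 0 < rho := dc_rho hD.
Let c20 : 0 < c2.
Proof. by rewrite divr_gt0 ?exprn_gt0// subr_gt0 (cs_sigma hC). Qed.
Let KB0 : 0 < K * B * c2.
Proof. by rewrite mulr_gt0// mulr_gt0. Qed.
Let A0 k x : 0 < A k x := factor_gt0 hC k x.
Let N_ge0 x v : 0 <= N x v := cs_N_ge0 hC x v.

Lemma scale0_gt0 : 0 < scale0.
Proof.
rewrite lt_min !divr_gt0// ?(pert_small_gt0 hC)//.
by rewrite mulr_gt0// exprn_gt0.
Qed.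

Lemma quad_const_gt0 : 0 < quad_const.
Proof. by rewrite /quad_const -lock mulr_gt0// mulr_gt0// exprn_gt0. Qed.

Section Orbit.
Variables (x : M) (k : nat) (r : R).
Hypotheses (r0 : 0 <= r) (hr : A k x * r <= scale0).

Let hA i : (i <= k)%N -> B * A i x * r <= rho.
Proof.
move=> ik.
have h := factor_le hC x ik.
move: hr; rewrite /scale0 le_min => /andP[+ _].
rewrite ler_pdivlMr ?mulr_gt0 ?exprn_gt0// => h2; apply: le_trans h2.
rewrite (_ : A k x * r * (B * C ^+ 2) = (C ^+ 2 * A k x) * (B * r)); last by ring.
rewrite (_ : B * A i x * r = A i x * (B * r)); last by ring.
by rewrite ler_wpM2r// mulr_ge0// ltW.
Qed.

Let hsum j : (j <= k)%N ->
  \sum_(i < j) (K * (B * A i x * r)) <= (K * B * c2) * (A k x * r).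
Proof.
move=> jk.
rewrite (_ : \sum_(i < j) _ = K * B * r * \sum_(i < j) A i x); last first.
  by rewrite mulr_sumr; apply: eq_bigr => i _; ring.
rewrite (_ : K * B * c2 * (A k x * r) = K * B * r * (c2 * A k x)); last by ring.
apply: ler_wpM2l.
  by apply: mulr_ge0 => //; apply: mulr_ge0; exact: ltW.
apply: le_trans (factor_sum hC k x).
rewrite -(big_mkord xpredT (fun i => A i x)).
rewrite -(big_mkord xpredT (fun i => A i x)).
rewrite [X in _ <= X](big_cat_nat (n := j) (p := k))//=.
by rewrite lerDl sumr_ge0// => i _; exact: ltW.
Qed.

Let hsmall j : (j <= k)%N ->
  \sum_(i < j) (K * (B * A i x * r)) <= pert_small C.
Proof.
move=> jk; apply: le_trans (hsum jk) _.
move: hr; rewrite /scale0 le_min => /andP[_].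
by rewrite ler_pdivlMr// mulrC.
Qed.

Let t0 i : 0 <= K * (B * A i x * r).
Proof.
apply: mulr_ge0; first exact: ltW.
by apply: mulr_ge0 => //; apply: mulr_ge0; exact: ltW.
Qed.

(** Strong induction: the bound at earlier times is what makes the Taylor error at time [i] at most
    [K * (B * A i x * r)], and [perturbation] with these errors returns the bound at time [j] with
    the same constant [B]. *)
Lemma orbit_bound_le p j : dom x p -> N x (Dl x p) <= r -> (j <= k)%N ->
  dom (iter j f x) (iter j f p) /\
  N (iter j f x) (Dl (iter j f x) (iter j f p)) <= B * A j x * r.
Proof.
move=> dp np.
elim/ltn_ind: j => j IH jk.
have T i : (i < j)%N -> [/\ dom (iter i.+1 f x) (iter i.+1 f p),
    dom (iter i.+1 f x) (iter i.+1 f x) &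
    N (iter i.+1 f x) (Dl (iter i.+1 f x) (iter i.+1 f p) -
      D (iter i f x) (Dl (iter i f x) (iter i f p)))
     <= K * (B * A i x * r) * N (iter i f x) (Dl (iter i f x) (iter i f p))].
  move=> ij; have ik := leq_trans (ltnW ij) jk.
  have [d1 n1] := IH i ij ik.
  have := dc_taylor hD d1 (dc_dom_refl hD (iter i f x)) n1 _ (hA ik).
  rewrite !(dc_refl hD) !subr0 (cs_N0 hC); apply.
  by apply: mulr_ge0 => //; apply: mulr_ge0; exact: ltW.
split.
  by case: j {IH} jk T => // j jk T; have [] := T j (ltnSn j).
have /= [+ _] := perturbation hC (e := fun i => Dl (iter i f x) (iter i f p))
  t0 (fun i ij => let: And3 _ _ h := T i ij in h) (hsmall jk).
move=> /le_trans; apply; apply: ler_wpM2l => //.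
by apply: mulr_ge0; exact: ltW.
Qed.

Lemma orbit_bound p : dom x p -> N x (Dl x p) <= r ->
  dom (iter k f x) (iter k f p) /\
  N (iter k f x) (Dl (iter k f x) (iter k f p)) <= B * A k x * r.
Proof. by move=> dp np; exact: orbit_bound_le. Qed.

Lemma orbit_bound_rho p : dom x p -> N x (Dl x p) <= r ->
  N (iter k f x) (Dl (iter k f x) (iter k f p)) <= rho.
Proof.
move=> dp np; have [_ h] := orbit_bound dp np.
by apply: le_trans h _; exact: hA.
Qed.

(** The Taylor error for a pair of points is proportional to their difference and not only to the
    size of the ball. So the difference of two orbits is again a perturbed cocycle, and all bounds
    scale with [e0]. *)
Lemma orbit_diff p q : dom x p -> dom x q ->
  N x (Dl x p) <= r -> N x (Dl x q) <= r ->
  let e0 := Dl x p - Dl x q in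
  let e := Dl (iter k f x) (iter k f p) - Dl (iter k f x) (iter k f q) in
  N (iter k f x) e <= B * A k x * N x e0 /\
  N (iter k f x) (Pu (iter k f x) e - cocycle f D k x (Pu x e0))
    <= quad_const * (A k x * r) * (A k x * N x e0).
Proof.
move=> dp dq np nq e0 e.
have T i : (i < k)%N ->
    N (iter i.+1 f x) (Dl (iter i.+1 f x) (iter i.+1 f p) -
       Dl (iter i.+1 f x) (iter i.+1 f q) -
      D (iter i f x) (Dl (iter i f x) (iter i f p) - Dl (iter i f x) (iter i f q)))
     <= K * (B * A i x * r) *
        N (iter i f x) (Dl (iter i f x) (iter i f p) - Dl (iter i f x) (iter i f q)).
  move=> ik; have ik' := ltnW ik.
  have [d1 n1] := orbit_bound_le dp np ik'.
  have [d2 n2] := orbit_bound_le dq nq ik'.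
  by have [] := dc_taylor hD d1 d2 n1 n2 (hA ik').
have /= [h1 h2] := perturbation hC
  (e := fun i => Dl (iter i f x) (iter i f p) - Dl (iter i f x) (iter i f q))
  t0 T (hsmall (leqnn k)).
split; first exact: h1.
apply: le_trans h2 _.
rewrite -!mulrA mulrCA [X in _ <= X](_ : _ =
  C ^+ 3 * B * ((K * B * c2) * (A k x * r)) * (A k x * N x e0)); last first.
  by rewrite /quad_const -lock; ring.
rewrite [X in X <= _](_ : _ = C ^+ 3 * B *
  (\sum_(i < k) K * (B * A i x * r)) * (A k x * N x e0)); last first.
  by rewrite -/e0; under eq_bigr do rewrite -!mulrA; ring.
apply: ler_wpM2r; first by rewrite mulr_ge0// ltW.
apply: ler_wpM2l; first by rewrite mulr_ge0 ?exprn_ge0// ltW.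
exact: hsum.
Qed.

End Orbit.

Definition dist_const : R := 2 * C ^+ 5 * B.

(* Conformality makes the growth of any infinitesimal unstable displacement at q
   comparable with the diameter of the image of a ball around x. *)
Lemma distortion x q k r : 0 < r -> dom x q -> N x (Dl x q) <= r / 2 ->
  A k x * r <= scale0 -> A k q <= dist_const * A k x.
Proof.
move=> r0 dq nq hr.
have s00 := scale0_gt0; have q0 := quad_const_gt0.
(* The auxiliary scale [s] may depend on [q] and [k], because it cancels at the end. *)
have := @small_scale R [:: (1, rho); (C, rho); (C ^+ 2, r / 2);
  (A k q, scale0); (quad_const * A k q, 1 / 2);
  (C ^+ 3 * B * A k x, rho)].
case.
  by rewrite /= rho0 s00 !divr_gt0.
move=> s s0 /= /and5P[h1 h2 h3 h4 /and3P[h5 h6 _]].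
rewrite mul1r in h1.
have [v hv nv] := cs_unstable hC q.
have nsv : N q (s *: v) = s by rewrite (cs_N_scale hC) nv mulr1 gtr0_norm.
have [p dp ep] : exists2 p, dom q p & Dl q p = s *: v.
  by apply: (dc_surj hD); rewrite nsv.
have dqq := dc_dom_refl hD q; have eqq := dc_refl hD q.
have dqp : (d q p <= (C * s)%:E)%E.
  have := dc_dist hD dqq dp; rewrite eqq ep subr0 (cs_N0 hC) nsv.
  by apply => //; exact: ltW.
have nq' : N x (Dl x q) <= r by apply: le_trans nq _; lra.
have rq : N x (Dl x q) <= rho.
  apply: le_trans nq' _.
  move: hr; rewrite /scale0 le_min => /andP[+ _].
  rewrite ler_pdivlMr ?mulr_gt0 ?exprn_gt0// => h.
  have h' := factor_le hC x (leq0n k); rewrite factor0 in h'.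
  have : 1 * r <= (B * (C ^+ 2 * A k x)) * r.
    rewrite ler_pM2r//; apply: mulr_ege1 => //.
  by rewrite mul1r => /le_trans; apply; lra.
have [dxp nxp] := dc_near hD dq rq h2 dqp.
rewrite mulrA -expr2 in nxp.
have np : N x (Dl x p) <= r.
  have := cs_N_triangle hC x (Dl x p - Dl x q) (Dl x q); rewrite subrK => h.
  by apply: le_trans h _; apply: le_trans (lerD nxp nq) _; lra.
have [U _] := orbit_diff (ltW r0) hr dxp dq np nq'.
set xk := iter k f x in U; set pk := iter k f p in U; set qk := iter k f q in U.
(* Upper estimate of the image displacement, through the charts along the orbit of [x]. *)
have hd1 : (d qk pk <= (C ^+ 3 * B * A k x * s)%:E)%E.
  have [d1 n1] := orbit_bound (ltW r0) hr dq nq'.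
  have [d2 n2] := orbit_bound (ltW r0) hr dxp np.
  apply: le_trans (dc_dist hD d1 d2 _ _) _.
  - exact: (orbit_bound_rho (ltW r0) hr dq).
  - exact: (orbit_bound_rho (ltW r0) hr dxp).
  rewrite lee_fin -/xk -/pk -/qk.
  apply: (@le_trans _ _ (C * (B * A k x * (C ^+ 2 * s)))); last by lra.
  rewrite ler_pM2l//; apply: le_trans U _.
  by rewrite ler_wpM2l// mulr_ge0// ltW.
have nqk : N qk (Dl qk qk) <= rho by rewrite (dc_refl hD) (cs_N0 hC) ltW.
have [_] := dc_near hD (dc_dom_refl hD qk) nqk h6 hd1.
rewrite (dc_refl hD) subr0 => n3.
have nqp : N q (Dl q p) <= s by rewrite ep nsv.
have nqq : N q (Dl q q) <= s by rewrite eqq (cs_N0 hC) ltW.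
(* Lower estimate, through the charts along the orbit of [q]: the unstable displacement [s *: v]
   grows to [A k q * s] up to an error of at most half. In [dist_const] this accounts for the 2; the
   five factors [C] come from two passages to [d], two passages back and one unstable projection. *)
have [_] := orbit_diff (ltW s0) h4 dp dqq nqp nqq.
rewrite -/qk -/pk (dc_refl hD) eqq !subr0 ep.
rewrite linearZ hv nsv => L.
have Pv : Pu q (s *: v) = s *: v by rewrite linearZ hv.
have L2 := N_cocycle hC k Pv; rewrite nsv -/qk in L2.
have L3 := cs_N_dist hC qk (cocycle f D k q (s *: v)) (Pu qk (Dl qk pk)).
rewrite (cs_N_subC hC) L2 in L3.
have L4 := cs_proj_bound hC qk (Dl qk pk).
have As0 : 0 <= A k q * s by rewrite mulr_ge0// ltW.
have L5 : quad_const * (A k q * s) * (A k q * s) <= 1 / 2 * (A k q * s).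
  by rewrite -mulrA in h5; rewrite ler_wpM2r.
have L6 : A k q * s / 2 <= C * (C * (C ^+ 3 * B * A k x * s)).
  have : C * N qk (Dl qk pk) <= C * (C * (C ^+ 3 * B * A k x * s)).
    by rewrite ler_pM2l.
  lra.
rewrite -(ler_pM2r s0) /dist_const; lra.
Qed.
End Nonlinear.

(** * One round of the game *)

Section Avoidance.
Variables (R : realType) (M : Type) (V : lmodType R) (f : M -> M).
Variables (D : M -> {linear V -> V}) (N H : M -> V -> R) (a : M -> R).
Variables (Pu : M -> {linear V -> V}) (C sigma : R).
Variables (d : M -> M -> \bar R) (dom : M -> M -> Prop) (Dl : M -> M -> V).
Variables (rho K : R).
Hypothesis hC : conformal_splitting f D N H a Pu C sigma.
Hypothesis hD : displacement_charts f D N C d dom Dl rho K.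

Local Notation A := (factor f a).
Local Notation B := (pert_const C).
Local Notation scale0 := (scale0 C sigma rho K).
Local Notation quad_const := (quad_const C sigma K).
Let C0 : 0 < C := cs_C0 hC.
Let C1 : 1 <= C := cs_C hC.
Let B0 : 0 < B := pert_const_gt0 hC.
Let B1 : 1 <= B := pert_const_ge1 hC.
Let K0 : 0 < K := dc_K hD.
Let rho0 : 0 < rho := dc_rho hD.
Let A0 k x : 0 < A k x := factor_gt0 hC k x.
Let N_ge0 x v : 0 <= N x v := cs_N_ge0 hC x v.
Lemma dist_self x : (d x x <= 0)%E.
Proof.
have n0 : N x (Dl x x) <= rho by rewrite (dc_refl hD) (cs_N0 hC) ltW.
have := dc_dist hD (dc_dom_refl hD x) (dc_dom_refl hD x) n0 n0.
by rewrite (dc_refl hD) subrr (cs_N0 hC) mulr0.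
Qed.

(** No triangle inequality is available for [d] here, so separation is read off in the chart at
    [p]. *)
Lemma dist_separated p q : p <> q ->
  exists2 s, 0 < s & forall t, t <= s -> ~ (d p q <= t%:E)%E.
Proof.
move=> pq.
have n0 : N p (Dl p p) <= rho by rewrite (dc_refl hD) (cs_N0 hC) ltW.
have near t := dc_near hD (dc_dom_refl hD p) n0 (t := t) (q := q).
have [e0|/eqP e0] := pselect (N p (Dl p q) = 0).
  exists rho => // t /near h /h[dq _]; apply: pq.
  apply: (dc_inj hD (dc_dom_refl hD p) dq).
  by rewrite (dc_refl hD) (cs_N_eq0 hC e0).
have n1 : 0 < N p (Dl p q) by rewrite lt_neqAle eq_sym e0 N_ge0.
exists (Num.min rho (N p (Dl p q) / (2 * C))).
  by rewrite lt_min rho0 divr_gt0// mulr_gt0.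
move=> t; rewrite le_min => /andP[/near h]; rewrite ler_pdivlMr ?mulr_gt0// => h2.
by move=> /h[_]; rewrite (dc_refl hD) subr0; lra.
Qed.

Lemma orbit_separated y n : exists2 s, 0 < s &
  forall i, (i < n)%N -> iter i f y <> y ->
    forall t, t <= s -> ~ (d (iter i f y) y <= t%:E)%E.
Proof.
elim: n => [|n [s s0 IH]]; first by exists 1.
have [e|/dist_separated[s1 s10 h1]] := pselect (iter n f y = y).
  by exists s => // i; rewrite ltnS leq_eqVlt => /orP[/eqP->|/IH].
exists (Num.min s s1); first by rewrite lt_min s0.
move=> i; rewrite ltnS leq_eqVlt => /orP[/eqP-> _|/IH h hi] t;
  rewrite le_min => /andP[ts ts1]; first exact: h1.
exact: h.
Qed.

(** Chosen so that [C ^+ 2 * slack] is [(16 * C)^-1]: the points of a ball of radius [slack * r]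
    then have unstable displacements that differ by at most a quarter of the length [r / (4 * C)] of
    the move. *)
Definition slack : R := (16 * C ^+ 3)^-1.

Let slack0 : 0 < slack.
Proof. by rewrite invr_gt0 mulr_gt0// exprn_gt0. Qed.

Let slackE : slack * (16 * C ^+ 3) = 1.
Proof. by rewrite mulVf// gt_eqF// mulr_gt0// exprn_gt0. Qed.

Let C3 : 1 <= C ^+ 3. Proof. exact: exprn_ege1. Qed.

Let slack_le : slack <= 1 / 16.
Proof.
have : slack * 16 <= slack * (16 * C ^+ 3).
  by rewrite ler_pM2l// ler_peMr.
by rewrite slackE; lra.
Qed.

Let invC1 : C^-1 <= 1. Proof. by rewrite invf_le1. Qed.

Section Round.
Variables (x : M) (r delta : R) (w : V).
Hypotheses (r0 : 0 < r) (rd : r <= delta) (drho : delta <= rho).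
Hypotheses (dscale : 2 * B * delta <= scale0) (hw : Pu x w = w).
Hypothesis nw : N x w = r / (4 * C).

Let nw_le : N x w <= r / 4.
Proof. by rewrite nw invfM mulrA ler_piMr// divr_ge0// ltW. Qed.

Let slr : slack * r <= r / 16.
Proof. by rewrite mulrC ler_pM2l// -div1r. Qed.

Lemma round_near x' z : dom x x' -> Dl x x' = w ->
  (d x' z <= (slack * r)%:E)%E ->
  [/\ dom x z, N x (Dl x z - w) <= C * (slack * r) & N x (Dl x z) <= r].
Proof.
move=> dx' ex' hz.
have n1 : N x (Dl x x') <= rho.
  by rewrite ex'; move: r0 rd drho nw_le; lra.
have sr : slack * r <= rho.
  by move: r0 rd drho slr; lra.
have [dz nz] := dc_near hD dx' n1 sr hz.
rewrite ex' in nz; split=> //.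
have := cs_N_triangle hC x (Dl x z - w) w; rewrite subrK => /le_trans; apply.
have : C * (slack * r) <= r / 16.
  have : C * slack <= 1 / 16.
    have C2 : 1 <= C ^+ 2 by exact: exprn_ege1.
    have : C * slack <= C ^+ 3 * slack.
      by rewrite ler_pM2r// exprS ler_peMr// ltW.
    move: slackE; lra.
  by move=> h; rewrite mulrA mulrC ler_pM2l// -div1r.
by move: r0 nw_le; lra.
Qed.

Lemma round_legal x' z : dom x x' -> Dl x x' = w ->
  (d x' z <= (slack * r)%:E)%E -> (d x z <= r%:E)%E.
Proof.
move=> dx' ex' hz; have [dz nz _] := round_near dx' ex' hz.
have n0 : N x (Dl x x) <= rho by rewrite (dc_refl hD) (cs_N0 hC) ltW.
have nz' : N x (Dl x z) <= C * (slack * r) + r / (4 * C).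
  have := cs_N_triangle hC x (Dl x z - w) w; rewrite subrK => /le_trans; apply.
  by rewrite nw lerD2r.
have h1 : C * (C * (slack * r) + r / (4 * C)) <= r.
  have C1' : C ^+ 2 * slack <= 1 / 16.
    have : C ^+ 2 * slack <= C ^+ 3 * slack.
      by rewrite ler_pM2r// ler_weXn2l.
    move: slackE; lra.
  rewrite mulrDr (_ : C * (r / (4 * C)) = r / 4); last by field; rewrite gt_eqF.
  rewrite (_ : C * (C * (slack * r)) = C ^+ 2 * slack * r); last by ring.
  by move: r0 (ler_wpM2r (ltW r0) C1'); lra.
have [_ _ nz1] := round_near dx' ex' hz.
apply: le_trans (dc_dist hD (dc_dom_refl hD x) dz n0 _) _.
  by move: rd drho nz1; lra.
rewrite (dc_refl hD) subr0 lee_fin; apply: le_trans h1.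
by rewrite ler_pM2l.
Qed.

Let scale0_k k : A k x * r <= delta -> A k x * r <= scale0.
Proof.
move=> h; apply: le_trans h _; apply: le_trans dscale.
have d0 : 0 < delta by exact: lt_le_trans r0 rd.
by rewrite ler_peMl ?ltW//; move: B1; lra.
Qed.

(** Two errors separate the unstable displacement of [z] at time [k] from the image of [w]: the
    nonlinear one, at most [quad_const * delta], and the offset of [z] from [x'], multiplied by
    [A k x] and giving [(16 * C)^-1]. *)
Lemma round_image x' z k : dom x x' -> Dl x x' = w ->
  (d x' z <= (slack * r)%:E)%E -> A k x * r <= delta ->
  [/\ dom (iter k f x) (iter k f z),
      N (iter k f x) (Dl (iter k f x) (iter k f z)) <= B * A k x * r &
      N (iter k f x) (Pu (iter k f x) (Dl (iter k f x) (iter k f z))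
                      - cocycle f D k x w)
        <= A k x * r * (quad_const * delta + (16 * C)^-1)].
Proof.
move=> dx' ex' hz hk; have [dz nz nz1] := round_near dx' ex' hz.
have sk := scale0_k hk.
have [d1 n1] := orbit_bound hC hD (ltW r0) sk dz nz1.
split=> //.
have nx : N x (Dl x x) <= r by rewrite (dc_refl hD) (cs_N0 hC) ltW.
have [_] := orbit_diff hC hD (ltW r0) sk dz (dc_dom_refl hD x) nz1 nx.
rewrite !(dc_refl hD) !subr0 => h.
set xk := iter k f x in n1 d1 h *.
have h2 : N xk (cocycle f D k x (Pu x (Dl x z)) - cocycle f D k x w)
    <= A k x * (C * (C * (slack * r))).
  rewrite -cocycleB -{1}hw -linearB (N_cocycle hC); last exact: (cs_proj_idem hC).
  by rewrite ler_pM2l//; apply: le_trans (cs_proj_bound hC _ _) _; rewrite ler_pM2l.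
have h3 : N xk (Pu xk (Dl xk (iter k f z)) - cocycle f D k x w) <=
   quad_const * (A k x * r) * (A k x * N x (Dl x z)) + A k x * (C * (C * (slack * r))).
  have := cs_N_triangle hC xk (Pu xk (Dl xk (iter k f z)) - cocycle f D k x (Pu x (Dl x z)))
    (cocycle f D k x (Pu x (Dl x z)) - cocycle f D k x w).
  by rewrite addrA subrK => /le_trans; apply; exact: lerD.
apply: le_trans h3 _; rewrite mulrDr; apply: lerD.
  have q0 := quad_const_gt0 hC hD.
  rewrite [X in _ <= X](_ : _ = quad_const * delta * (A k x * r)); last by ring.
  apply: ler_pM.
  - by rewrite mulr_ge0 ?mulr_ge0// ltW.
  - by rewrite mulr_ge0// ltW.
  - by rewrite ler_pM2l.
  - by rewrite ler_pM2l.
rewrite -mulrA ler_pM2l// le_eqVlt; apply/orP; left; apply/eqP.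
by rewrite /slack; field; rewrite gt_eqF.
Qed.

End Round.

(** One move for a whole window. Only the first time at which [x] is dangerously close to [y]
    determines the direction; the later times are reduced to it. *)
Lemma avoiding_round y theta : 0 < theta -> theta <= 1 ->
  exists2 delta0, 0 < delta0 & forall delta, 0 < delta -> delta <= delta0 ->
  exists2 eps, 0 < eps & forall x r, 0 < r -> r <= delta ->
  exists x',
    (forall z, (d x' z <= (slack * r)%:E)%E -> (d x z <= r%:E)%E) /\
    (forall k, theta * delta < A k x * r -> A k x * r <= delta ->
     forall z, (d x' z <= (slack * r)%:E)%E -> ~ (d (iter k f z) y <= eps%:E)%E).
Proof.
move=> th0 th1.
have C0' := C0; have C1' := C1; have B0' := B0; have B1' := B1.
have s00 := scale0_gt0 hC hD; have q0 := quad_const_gt0 hC hD.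
(* Inside a window the factor can grow by at most [theta^-1], so by [factor_lb] two of its times
   differ by less than this [n]. *)
have [n hn] := expr_unbounded (C ^+ 2 / theta) (cs_sigma hC).
have [s s0 hs] := orbit_separated y n.
have := @small_scale R [:: (1, rho); (2 * B, scale0);
  (quad_const, (16 * C)^-1); (quad_const * (6 * B ^+ 2), (16 * C)^-1);
  (2 * B ^+ 2, rho); (4 * C * B ^+ 2, s)].
case.
  by rewrite /= rho0 s00 s0 !invr_gt0 !mulr_gt0.
move=> delta0 d00 /= H1; exists delta0 => // delta dl0 dle.
have : [&& delta <= rho, 2 * B * delta <= scale0,
  quad_const * delta <= (16 * C)^-1,
  quad_const * (6 * B ^+ 2) * delta <= (16 * C)^-1,
  2 * B ^+ 2 * delta <= rho & 4 * C * B ^+ 2 * delta <= s].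
  move: H1 => /and5P[g1 g2 g3 g4 /and3P[g5 g6 _]].
  have mono c b : 0 <= c -> c * delta0 <= b -> c * delta <= b.
    by move=> c0; apply: le_trans; rewrite ler_wpM2l.
  apply/and5P; split; last (apply/andP; split).
  - lra.
  - by apply: mono g2; apply: mulr_ge0 => //; exact: ltW.
  - by apply: mono g3; exact: ltW.
  - by apply: mono g4; rewrite mulr_ge0 ?mulr_ge0 ?exprn_ge0// ltW.
  - by apply: mono g5; rewrite mulr_ge0 ?exprn_ge0// ltW.
  - by apply: mono g6; rewrite mulr_ge0 ?exprn_ge0 ?mulr_ge0// ltW.
move=> /and5P[g1 g2 g3 g4 /andP[g5 g6]] {H1}.
have B2 : B <= B ^+ 2 by rewrite expr2 ler_peMl// ltW.
have g7 : 2 * B * delta <= rho.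
  by apply: le_trans g5; rewrite ler_pM2r// ler_pM2l.
exists (theta * delta / (32 * C ^+ 3)).
  by rewrite divr_gt0 ?mulr_gt0 ?exprn_gt0.
set eps := theta * delta / _.
have epsE : eps * (32 * C ^+ 3) = theta * delta.
  by rewrite /eps divfK// gt_eqF// mulr_gt0// exprn_gt0.
have eps0 : 0 < eps by rewrite divr_gt0 ?mulr_gt0 ?exprn_gt0.
have epsrho : eps <= rho.
  apply: le_trans g1; apply: (@le_trans _ _ (theta * delta)); last first.
    by rewrite ler_piMl// ltW.
  by rewrite -epsE ler_peMr ?ltW//; move: C3; lra.
have Ceps : C * eps * 32 * C <= theta * delta.
  have C23 : C ^+ 2 <= C ^+ 3 by rewrite ler_weXn2l.
  by rewrite -epsE; have := ler_wpM2l (ltW eps0) C23; lra.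
have Ceps1 : C * eps * 32 <= theta * delta.
  apply: le_trans Ceps; rewrite ler_peMr// mulr_ge0// mulr_ge0//; exact: ltW.
move=> x r r0 rd.
have [v hv nv1] := cs_unstable hC x.
pose w0 := (r / (4 * C)) *: v.
have hw0 : Pu x w0 = w0 by rewrite linearZ hv.
have nw0 : N x w0 = r / (4 * C).
  by rewrite (cs_N_scale hC) nv1 mulr1 gtr0_norm// divr_gt0// mulr_gt0.
(* If the image of a point of the ball of [x'] comes within [eps] of [y] at a time of the window,
   then that time is bad; so only bad times matter, and the notion depends on [x] alone. *)
pose bad k := `[< [/\ theta * delta < A k x * r, A k x * r <= delta,
   dom (iter k f x) y & N (iter k f x) (Dl (iter k f x) y) <= 2 * B * A k x * r] >].
have [w [hw nw hbad]] : exists w, [/\ Pu x w = w, N x w = r / (4 * C) &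
   forall k, bad k -> exists2 k0, (k0 <= k)%N & bad k0 /\
     A k0 x * (r / (4 * C)) <=
     N (iter k0 f x) (cocycle f D k0 x w - Pu (iter k0 f x) (Dl (iter k0 f x) y))].
  have [hex|nbad] := pselect (exists k, bad k); last first.
    by exists w0; split => // k bk; exfalso; apply: nbad; exists k.
  case: (ex_minnP hex) => k0 bk0 min0.
  set xk := iter k0 f x; set eta := Pu xk (Dl xk y).
  have hN := N_cocycle hC k0 hw0; rewrite nw0 -/xk in hN.
  suff [w [hw nw hk]] : exists w, [/\ Pu x w = w, N x w = r / (4 * C) &
      A k0 x * (r / (4 * C)) <= N xk (cocycle f D k0 x w - eta)].
    by exists w; split => // k /min0 k0k; exists k0.
  (* If [w0] fails then [- w0] works, because the images of [w0] and [- w0] at time [k0] are at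
     distance twice their length, and [eta] cannot be close to both. *)
  have [h|h] := lerP (A k0 x * (r / (4 * C))) (N xk (cocycle f D k0 x w0 - eta)).
    by exists w0.
  exists (- w0); split; first by rewrite linearN hw0.
    by rewrite (cs_NN hC).
  have -> : cocycle f D k0 x (- w0) = - cocycle f D k0 x w0.
    by rewrite -scaleN1r cocycleZ scaleN1r.
  rewrite -opprD (cs_NN hC).
  have := cs_N_triangle hC xk (cocycle f D k0 x w0 + eta) (cocycle f D k0 x w0 - eta).
  rewrite addrACA subrr addr0 -mulr2n -scaler_nat (cs_N_scale hC) normr_nat hN.
  by lra.
have nwrho : N x w <= rho.
  rewrite nw; apply: le_trans g1; apply: le_trans rd.
  by rewrite ler_pdivrMr ?mulr_gt0// ler_peMr ?ltW//; lra.
have [x' dx' ex'] := dc_surj hD nwrho.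
exists x'; split.
  by move=> z; exact: (round_legal r0 rd g1 nw dx' ex').
move=> k k1 k2 z hz hy.
have [dz nz _] := round_image r0 rd g1 g2 hw nw dx' ex' hz k2.
set xk := iter k f x in dz nz.
set zk := iter k f z in dz nz hy.
have nz' : N xk (Dl xk zk) <= rho.
  apply: le_trans nz _; apply: le_trans g7; rewrite -!mulrA.
  have := ler_wpM2l (ltW B0) k2; have : 0 < B * delta by rewrite mulr_gt0.
  lra.
have [dy ny] := dc_near hD dz nz' epsrho hy.
have nyk : N xk (Dl xk y) <= 2 * B * A k x * r.
  have := cs_N_triangle hC xk (Dl xk y - Dl xk zk) (Dl xk zk).
  rewrite subrK => /le_trans; apply.
  have Ar0 : 0 < A k x * r by rewrite mulr_gt0.
  have BA : A k x * r <= B * (A k x * r) by rewrite ler_peMl// ltW.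
  have Ce0 : 0 < C * eps by rewrite mulr_gt0.
  lra.
have [k0 k0k [/asboolP[b1 b2 b3 b4] hk0]] : exists2 k0, (k0 <= k)%N & bad k0 /\
     A k0 x * (r / (4 * C)) <=
     N (iter k0 f x) (cocycle f D k0 x w - Pu (iter k0 f x) (Dl (iter k0 f x) y)).
  by apply: hbad; apply/asboolP.
have [dz0 nz0 pz0] := round_image r0 rd g1 g2 hw nw dx' ex' hz b2.
set q := iter k0 f x in b3 b4 hk0 dz0 nz0 pz0.
set z0 := iter k0 f z in dz0 nz0 pz0.
pose i := (k - k0)%N.
have ki : (i + k0 = k)%N by rewrite subnK.
have Ai : A k x = A k0 x * A i q by rewrite -ki factor_add.
have xki : xk = iter i f q by rewrite /xk -ki iterD.
have zki : zk = iter i f z0 by rewrite /zk -ki iterD.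
set r' := 2 * B * A k0 x * r.
have r'0 : 0 < r' by rewrite /r' !mulr_gt0.
have hr' : A i q * r' <= scale0.
  apply: le_trans g2; rewrite (_ : A i q * r' = 2 * B * (A k x * r)).
    by rewrite ler_pM2l// mulr_gt0.
  by rewrite Ai /r'; ring.
have nz0' : N q (Dl q z0) <= r'.
  by apply: le_trans nz0 _; have : 0 < B * A k0 x * r; [rewrite !mulr_gt0|rewrite /r'; lra].
have [E1 E2] := orbit_diff hC hD (ltW r'0) hr' dz0 b3 nz0' b4.
rewrite -xki -zki in E1 E2.
set e0 := Dl q z0 - Dl q y in E1 E2.
set ei := Dl xk zk - Dl xk (iter i f y) in E1 E2.
have ne0 : N q e0 <= 3 * B * A k0 x * r.
  have := cs_N_sub hC q (Dl q z0) (Dl q y) => h.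
  by apply: le_trans h _; move: b4 nz0; lra.
(* The gap [r / (4 * C)] loses at most half to the two errors of [round_image]. *)
have Pe0 : A k0 x * r * (8 * C)^-1 <= N q (Pu q e0).
  have h1 := cs_N_triangle hC q (cocycle f D k0 x w - Pu q (Dl q z0)) (Pu q e0).
  rewrite /e0 linearB addrA subrK -linearB -/e0 in h1.
  rewrite (cs_N_subC hC) in pz0.
  have h2 : A k0 x * r * (quad_const * delta + (16 * C)^-1) <=
            A k0 x * r * (8 * C)^-1.
    rewrite ler_pM2l ?mulr_gt0//.
    have -> : (8 * C)^-1 = (16 * C)^-1 + (16 * C)^-1 by field; rewrite gt_eqF.
    by rewrite lerD2r.
  have h3 : A k0 x * (r / (4 * C)) = A k0 x * r * (8 * C)^-1 + A k0 x * r * (8 * C)^-1.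
    by field; rewrite gt_eqF.
  lra.
(* From time [k0] to [k] the cocycle multiplies the unstable gap by [A i q]; the nonlinear error
   takes at most half of it, by the choice of [delta]. *)
have nPi : A k x * r * (16 * C)^-1 <= N xk (Pu xk ei).
  have h1 := N_cocycle hC i (cs_proj_idem hC q e0); rewrite -xki in h1.
  have h2 := cs_N_dist hC xk (cocycle f D i q (Pu q e0)) (Pu xk ei).
  rewrite (cs_N_subC hC) h1 in h2.
  have h3 : quad_const * (A i q * r') * (A i q * N q e0) <=
     A k x * r * (16 * C)^-1.
    apply: (@le_trans _ _ (quad_const * (2 * B * delta) * (A i q * (3 * B * A k0 x * r)))).
      apply: ler_pM.
      - by rewrite mulr_ge0 ?mulr_ge0// ltW.
      - by rewrite mulr_ge0// ltW.
      - rewrite ler_pM2l// (_ : A i q * r' = 2 * B * (A k x * r)).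
          by rewrite ler_pM2l// mulr_gt0.
        by rewrite Ai /r'; ring.
      - by rewrite ler_pM2l.
    rewrite [X in X <= _](_ : _ = (A k x * r) * (quad_const * (6 * B ^+ 2) * delta)).
      by rewrite ler_pM2l// mulr_gt0.
    by rewrite Ai; ring.
  have h4 : A i q * (A k0 x * r * (8 * C)^-1) <= A i q * N q (Pu q e0).
    by rewrite ler_pM2l.
  have h5 : A i q * (A k0 x * r * (8 * C)^-1) =
     A k x * r * (16 * C)^-1 + A k x * r * (16 * C)^-1.
    by rewrite Ai; field; rewrite gt_eqF.
  lra.
have nei : A k x * r <= 16 * C ^+ 2 * N xk ei.
  have h := le_trans nPi (cs_proj_bound hC xk ei).
  move: h; rewrite ler_pdivrMr ?mulr_gt0// => /le_trans; apply.
  by rewrite le_eqVlt; apply/orP; left; apply/eqP; ring.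
(* When [f^i(y) = y], which includes [k = k0], the gap at time [k] separates [f^k(z)] from [y]
   itself. Otherwise both [y] and [f^i(y)] are close to [xk], hence to each other, against
   [orbit_separated]. *)
have [ey|ney] := pselect (iter i f y = y).
  rewrite /ei ey (cs_N_subC hC) in nei.
  have : 16 * C ^+ 2 * N xk (Dl xk y - Dl xk zk) <= 16 * C ^+ 2 * (C * eps).
    by rewrite ler_pM2l// mulr_gt0// exprn_gt0.
  rewrite (_ : 16 * C ^+ 2 * (C * eps) = eps * (32 * C ^+ 3) / 2); last by field.
  rewrite epsE => h; have td0 : 0 < theta * delta by rewrite mulr_gt0.
  lra.
have iN : (i < n)%N.
  rewrite ltnNge; apply/negP => ni.
  have hq := factor_lb hC i q.
  have h1 : sigma ^+ n <= sigma ^+ i.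
    by rewrite ler_eXn2l// (cs_sigma hC).
  have h2 : C ^+ 2 / theta < C ^+ 2 * A i q by lra.
  move: h2; rewrite ltr_pM2l ?exprn_gt0// => h2.
  have h3 : theta * A i q <= 1.
    have : theta * delta * A i q <= delta.
      apply: le_trans k2; rewrite Ai (_ : A k0 x * A i q * r = A k0 x * r * A i q); last by ring.
      by rewrite ler_pM2r// ltW.
    rewrite mulrAC => h; rewrite -(ler_pM2r dl0) mul1r; exact: h.
  move: h2; rewrite -div1r ltr_pdivrMr// mulrC; lra.
apply: (hs i iN ney (4 * C * B ^+ 2 * delta) g6).
have [d2 n2] := orbit_bound hC hD (ltW r'0) hr' b3 b4.
rewrite -xki in d2 n2.
have n2' : N xk (Dl xk (iter i f y)) <= 2 * B ^+ 2 * delta.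
  apply: le_trans n2 _.
  rewrite (_ : B * A i q * r' = 2 * B ^+ 2 * (A k x * r)).
    by rewrite ler_pM2l// mulr_gt0// exprn_gt0.
  by rewrite Ai /r'; ring.
have n3 : N xk (Dl xk y) <= 2 * B ^+ 2 * delta.
  apply: le_trans nyk _; rewrite -mulrA.
  by apply: ler_pM => //; [rewrite mulr_ge0// ltW|rewrite mulr_ge0// ltW|rewrite ler_pM2l].
apply: le_trans (dc_dist hD d2 dy _ _) _.
- exact: le_trans n2' g5.
- exact: le_trans n3 g5.
rewrite lee_fin (_ : 4 * C * B ^+ 2 * delta = C * (2 * B ^+ 2 * delta + 2 * B ^+ 2 * delta)); last by ring.
rewrite ler_pM2l//; apply: le_trans (cs_N_sub hC _ _ _) _; exact: lerD.
Qed.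
End Avoidance.

(** * The game *)

Section Game.
Variables (R : realType) (M : topologicalType) (V : lmodType R) (f : M -> M).
Variables (D : M -> {linear V -> V}) (N H : M -> V -> R) (a : M -> R).
Variables (Pu : M -> {linear V -> V}) (C sigma : R).
Variables (d : M -> M -> \bar R) (dom : M -> M -> Prop) (Dl : M -> M -> V).
Variables (rho K : R) (y : M).
Hypothesis hC : conformal_splitting f D N H a Pu C sigma.
Hypothesis hD : displacement_charts f D N C d dom Dl rho K.
Hypothesis hnbhs : forall x e, 0 < e ->
  nbhs x [set z | dom x z /\ N x (Dl x z) <= e].
Hypothesis cM : compact [set: M].

Local Notation A := (factor f a).
Local Notation B := (pert_const C).
Local Notation scale0 := (scale0 C sigma rho K).
Local Notation Cd := (dist_const C).
Local Notation slack := (slack C).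

(** The quotient by [2 * C ^+ 2] is the enlargement in [limit_in_ctr]: a limit of points of the ball
    of radius [alpha0 * r] is located in the ball of radius [slack * r]. *)
Definition alpha0 : R := slack / (2 * C ^+ 2).

Section Play.
Variables (beta delta eps : R) (bob : nat -> M * R) (ctr : nat -> M).
Hypothesis beta01 : 0 < beta < 1.
Local Notation alpha := alpha0.
Local Notation theta := (alpha * beta / Cd).
Local Notation x_ m := (bob m).1.
Local Notation r_ m := (bob m).2.
Hypotheses (eps0 : 0 < eps) (delta0 : 0 < delta).
Hypotheses (dC : C ^+ 2 * delta <= rho)
  (dS : 2 * C ^+ 3 / (alpha * beta) * delta <= scale0).
Hypothesis dr : delta <= r_ 0%N.
Hypothesis rS : forall m, r_ m.+1 = beta * (alpha * r_ m).
Hypothesis nest : forall m z, (d (ctr m) z <= (alpha * r_ m)%:E)%E ->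
  (d (x_ m) z <= (r_ m)%:E)%E.
Hypothesis bob_in : forall m z, (d (x_ m.+1) z <= (r_ m.+1)%:E)%E ->
  (d (ctr m) z <= (alpha * r_ m)%:E)%E.
Hypothesis legal : forall m, r_ m <= delta ->
  forall z, (d (ctr m) z <= (slack * r_ m)%:E)%E -> (d (x_ m) z <= (r_ m)%:E)%E.
Hypothesis avoid : forall m, r_ m <= delta ->
  forall k, theta * delta < A k (x_ m) * r_ m -> A k (x_ m) * r_ m <= delta ->
  forall z, (d (ctr m) z <= (slack * r_ m)%:E)%E -> ~ (d (iter k f z) y <= eps%:E)%E.

Let C0 : 0 < C := cs_C0 hC.
Let C1 : 1 <= C := cs_C hC.
Let B0 : 0 < B := pert_const_gt0 hC.
Let B1 : 1 <= B := pert_const_ge1 hC.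
Let rho0 : 0 < rho := dc_rho hD.
Let A0 k x : 0 < A k x := factor_gt0 hC k x.
Let N_ge0 x v : 0 <= N x v := cs_N_ge0 hC x v.
Let b0 : 0 < beta. Proof. by case/andP: beta01. Qed.
Let b1 : beta < 1. Proof. by case/andP: beta01. Qed.
Let C2 : 1 <= C ^+ 2. Proof. exact: exprn_ege1. Qed.
Let a0 : 0 < alpha.
Proof. by rewrite divr_gt0 ?invr_gt0 ?mulr_gt0 ?exprn_gt0. Qed.
Let slackE : slack = 2 * C ^+ 2 * alpha.
Proof. by rewrite mulrC divfK// gt_eqF// mulr_gt0// exprn_gt0. Qed.
Let a1 : 32 * alpha <= 1.
Proof.
have h : slack * (16 * C ^+ 3) = 1.
  by rewrite mulVf// gt_eqF// mulr_gt0// exprn_gt0.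
have C5 : 1 <= C ^+ 5 by exact: exprn_ege1.
have a00 := a0; rewrite slackE in h.
by have := ler_wpM2l (ltW a00) C5; lra.
Qed.
Let ab0 : 0 < alpha * beta. Proof. exact: mulr_gt0. Qed.
Let ab1 : alpha * beta < 1.
Proof. by move: a0 a1 b0 b1; nra. Qed.
Let Cd1 : C ^+ 2 <= Cd.
Proof.
have h : C ^+ 2 <= C ^+ 5 by rewrite ler_weXn2l.
have h5 : 0 < C ^+ 5 by rewrite exprn_gt0.
have := ler_wpM2l (ltW h5) B1; rewrite /dist_const; move: B1 => *; lra.
Qed.
Let Cd0 : 0 < Cd. Proof. by apply: lt_le_trans Cd1; rewrite exprn_gt0. Qed.

Lemma radiusE m : r_ m = (alpha * beta) ^+ m * r_ 0%N.
Proof. by elim: m => [|m IH]; [rewrite mul1r|rewrite rS IH exprS; ring]. Qed.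

Lemma radius_gt0 m : 0 < r_ m.
Proof. by rewrite radiusE mulr_gt0 ?exprn_gt0//; exact: lt_le_trans dr. Qed.

Lemma radius_small t : 0 < t -> exists m, r_ m <= t.
Proof.
move=> t0; have r00 : 0 < r_ 0%N by exact: lt_le_trans dr.
have [m hm] : exists m, r_ 0%N / t < (alpha * beta)^-1 ^+ m.
  by apply: expr_unbounded; rewrite invf_gt1.
exists m; rewrite radiusE; move: hm.
rewrite exprVn ltr_pdivrMr// mulrC ltr_pdivlMr ?exprn_gt0// => h.
by rewrite mulrC ltW.
Qed.

Lemma radius_anti m j : (m <= j)%N -> r_ j <= r_ m.
Proof.
move=> mj; rewrite (radiusE m) (radiusE j) ler_pM2r; last exact: lt_le_trans dr.
by apply: ler_wiXn2l => //; exact: ltW.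
Qed.

Lemma ball_anti m j : (m <= j)%N ->
  forall z, (d (x_ j) z <= (r_ j)%:E)%E -> (d (x_ m) z <= (r_ m)%:E)%E.
Proof.
move/subnK <-; elim: (j - m)%N => // i IH z; rewrite addSn => h.
exact/IH/nest/bob_in.
Qed.

Lemma center_in_ctr m j : (m < j)%N -> (d (ctr m) (x_ j) <= (alpha * r_ m)%:E)%E.
Proof.
move=> mj; apply: bob_in; apply: (ball_anti mj).
by apply: le_trans (dist_self hC hD _) _; rewrite lee_fin ltW ?radius_gt0.
Qed.

Let Cdelta : C * delta <= rho.
Proof.
by apply: le_trans dC; rewrite ler_pM2r// expr2 ler_peMl// ltW.
Qed.
Let delta_rho : delta <= rho.
Proof. by apply: le_trans Cdelta; rewrite ler_peMl// ltW. Qed.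

Let nself x : N x (Dl x x) <= rho.
Proof. by rewrite (dc_refl hD) (cs_N0 hC) ltW. Qed.

(** A later centre [x_ j] lies within [alpha * r_ m] of [ctr m] and can be taken within
    [alpha * r_ m] of [x]. The two steps are added in the chart at [ctr m], which gives
    [2 * C ^+ 2 * alpha * r_ m]. *)
Lemma limit_in_ctr x : (forall U, nbhs x U -> forall m, exists2 j, (m < j)%N & U (x_ j)) ->
  forall m, r_ m <= delta -> (d (ctr m) x <= (slack * r_ m)%:E)%E.
Proof.
move=> hx m hm.
have rm0 := radius_gt0 m.
set e := alpha * r_ m / C.
have e0 : 0 < e by rewrite divr_gt0// mulr_gt0.
have Ce : C * e = alpha * r_ m by rewrite mulrC divfK// gt_eqF.
have ard : alpha * r_ m <= delta / 32.
  have a1' := a1; have a0' := a0; have := ler_wpM2l (ltW a0') hm.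
  have := ler_wpM2r (ltW delta0) a1'; lra.
have ar0 : 0 < alpha * r_ m by rewrite mulr_gt0.
have rr := delta_rho; have d0 := delta0; have r0' := rho0.
have er : e <= rho.
  have : e <= C * e by rewrite ler_peMl// ltW.
  rewrite Ce; lra.
have [j mj [dj nj]] := hx _ (hnbhs x e0) m.
have dist1 : (d (x_ j) x <= (alpha * r_ m)%:E)%E.
  apply: le_trans (dc_dist hD dj (dc_dom_refl hD x) (le_trans nj er) (nself x)) _.
  by rewrite (dc_refl hD) sub0r (cs_NN hC) lee_fin -Ce ler_pM2l.
have ar : alpha * r_ m <= rho by lra.
have [d1 n1] := dc_near hD (dc_dom_refl hD _) (nself _) ar (center_in_ctr mj).
rewrite (dc_refl hD) subr0 in n1.
have Car : C * (alpha * r_ m) <= rho / 32.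
  have := ler_wpM2l (ltW C0) ard; have := Cdelta; lra.
have n1' : N (ctr m) (Dl (ctr m) (x_ j)) <= rho by lra.
have [d2 n2] := dc_near hD d1 n1' ar dist1.
have n3 : N (ctr m) (Dl (ctr m) x) <= 2 * (C * (alpha * r_ m)).
  have := cs_N_triangle hC (ctr m) (Dl (ctr m) x - Dl (ctr m) (x_ j)) (Dl (ctr m) (x_ j)).
  by rewrite subrK => /le_trans; apply; lra.
have n3' : N (ctr m) (Dl (ctr m) x) <= rho by lra.
apply: le_trans (dc_dist hD (dc_dom_refl hD _) d2 (nself _) n3') _.
rewrite (dc_refl hD) subr0 lee_fin slackE.
rewrite (_ : 2 * C ^+ 2 * alpha * r_ m = C * (2 * (C * (alpha * r_ m)))); last by ring.
by rewrite ler_pM2l.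
Qed.

Lemma factor_bounded k : exists2 U, 0 < U & forall x, A k x <= U.
Proof.
have [L hL] := cs_factor_bound hC.
pose L' := Num.max 1 L.
exists (L' ^+ k); first by rewrite exprn_gt0// lt_max ltr01.
move=> x; elim: k => [|k IH]; first by rewrite factor0 expr0.
rewrite factorS exprSr; apply: ler_pM => //; first exact: ltW.
  exact: (cs_factor_ge0 hC).
by rewrite le_max hL orbT.
Qed.

(** Take the least turn at which both upper bounds hold. Just before it one of them failed, and
    between consecutive turns the radius shrinks by [alpha * beta] while [distortion] limits the
    change of the factor by [Cd]; their quotient is theta. *)
Lemma window_cover k : exists m, [/\ r_ m <= delta,
  theta * delta < A k (x_ m) * r_ m & A k (x_ m) * r_ m <= delta].
Proof.
pose P m := (r_ m <= delta) && (A k (x_ m) * r_ m <= delta).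
have hex : exists m, P m.
  have [U U0 hU] := factor_bounded k.
  have tpos : 0 < Num.min delta (delta / U) by rewrite lt_min delta0 divr_gt0.
  have [m] := radius_small tpos.
  rewrite le_min => /andP[h1 h2]; exists m; rewrite /P h1/=.
  move: h2; rewrite ler_pdivlMr// mulrC; apply: le_trans.
  by rewrite ler_wpM2r// ltW// radius_gt0.
case: (ex_minnP hex) => m /andP[rm am] minm.
exists m; split => //.
have rm0 := radius_gt0 m.
(* The case in which the radius has only just dropped to [delta] or the game has only begun: the
   factor is at least [C ^- 2], and [C ^+ 2 <= Cd]. *)
have start : alpha * beta * delta < r_ m -> theta * delta < A k (x_ m) * r_ m.
  move=> h; have A1 : 1 <= C ^+ 2 * A k (x_ m).
    by rewrite -(factor0 f a (x_ m)); exact: (factor_le hC).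
  rewrite mulrAC ltr_pdivrMr//; apply: lt_le_trans h _.
  rewrite mulrAC; have := ler_wpM2r (ltW rm0) A1.
  rewrite mul1r => /le_trans; apply.
  by rewrite ler_pM2r// mulrC ler_pM2l.
case: m rm am minm rm0 start => [|m] rm am minm rm0 start.
  apply: start; apply: lt_le_trans dr.
  by rewrite gtr_pMl.
have [hm|hm] := lerP (r_ m) delta; last first.
  by apply: start; rewrite rS mulrA [beta * _]mulrC ltr_pM2l.
have [ham|ham] := lerP (A k (x_ m) * r_ m) delta.
  by have := minm m; rewrite /P hm ham => /(_ isT); rewrite ltnn.
have r0m := radius_gt0 m.
have dxx : (d (x_ m) (x_ m.+1) <= (r_ m)%:E)%E.
  apply: (ball_anti (leqnSn m)).
  by apply: le_trans (dist_self hC hD _) _; rewrite lee_fin ltW.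
have Crm : C * r_ m <= rho by apply: le_trans Cdelta; rewrite ler_pM2l.
have rmrho : r_ m <= rho by exact: le_trans hm delta_rho.
have [d1 n1] := dc_near hD (dc_dom_refl hD _) (nself _) rmrho dxx.
rewrite (dc_refl hD) subr0 in n1.
have n1' := le_trans n1 Crm.
have := dc_dist hD d1 (dc_dom_refl hD _) n1' (nself _).
rewrite (dc_refl hD) sub0r (cs_NN hC) => dx2.
(* To bound the factor at the earlier centre by the factor at the later one, [distortion] is applied
   in the chart at the later one. As [d] is not assumed symmetric here, the two points are exchanged
   through the chart at [x_ m], for [C ^+ 2]. *)
have dx3 : (d (x_ m.+1) (x_ m) <= (C ^+ 2 * r_ m)%:E)%E.
  by apply: le_trans dx2 _; rewrite lee_fin expr2 -mulrA ler_pM2l.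
have C2r : C ^+ 2 * r_ m <= rho.
  by apply: le_trans dC; rewrite ler_pM2l// exprn_gt0.
have [d2] := dc_near hD (dc_dom_refl hD _) (nself _) C2r dx3.
rewrite (dc_refl hD) subr0 => n2.
have R0 : 0 < 2 * C ^+ 3 * r_ m by rewrite !mulr_gt0// exprn_gt0.
have hn : N (x_ m.+1) (Dl (x_ m.+1) (x_ m)) <= 2 * C ^+ 3 * r_ m / 2.
  by apply: le_trans n2 _; rewrite le_eqVlt; apply/orP; left; apply/eqP; field.
have hs : A k (x_ m.+1) * (2 * C ^+ 3 * r_ m) <= scale0.
  apply: le_trans dS.
  rewrite (_ : A k (x_ m.+1) * (2 * C ^+ 3 * r_ m) =
    2 * C ^+ 3 / (alpha * beta) * (A k (x_ m.+1) * r_ m.+1)).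
    by rewrite ler_pM2l// divr_gt0// mulr_gt0// exprn_gt0.
  by rewrite rS; field; rewrite !gt_eqF.
have hdist := distortion hC hD R0 d2 hn hs.
rewrite mulrAC ltr_pdivrMr// rS.
rewrite (_ : A k (x_ m.+1) * (beta * (alpha * r_ m)) * Cd =
  alpha * beta * (Cd * A k (x_ m.+1) * r_ m)); last by ring.
rewrite ltr_pM2l//; apply: lt_le_trans ham _.
by rewrite ler_pM2r.
Qed.

(** The outcome is a cluster point of the centres of Bob, given by compactness of [M]; a visit of
    its orbit near [y] at time [k] contradicts [avoid] at the turn that [window_cover] assigns to
    [k]. *)
Lemma play_won : exists x,
  \bigcap_m game_ball d (bob m) = [set x] /\ orbit_avoiding f y x.
Proof.
have [x [_ clx]] := @cM ((fun m => x_ m) @ \oo) _ filterT.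
have hx U : nbhs x U -> forall m, exists2 j, (m < j)%N & U (x_ j).
  move=> xU m.
  have [_ [[j /= mj <-] Uj]] := clx [set x_ j | j in [set j | (m < j)%N]] U
    (ex_intro2 _ _ m.+1 I (fun j mj => ex_intro2 _ _ j mj erefl)) xU.
  by exists j.
have inctr := limit_in_ctr hx.
have inbob m : (d (x_ m) x <= (r_ m)%:E)%E.
  (* A ball of large radius is reached through a later small one inside it, where [legal] and
     [limit_in_ctr] apply. *)
  have [j hj] := radius_small delta0.
  have hj' : r_ (maxn m j) <= delta.
    by apply: le_trans hj; apply: radius_anti; exact: leq_maxr.
  by apply: (ball_anti (leq_maxl m j)); apply: legal => //; exact: inctr.
exists x; split.
  apply/seteqP; split => [z hz /=|_ -> m _ /=]; last exact: inbob.
  apply: contrapT => /(dist_separated hC hD)[s s0 hs].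
  have tpos : 0 < Num.min delta (s / (2 * C ^+ 2)).
    by rewrite lt_min delta0 divr_gt0// mulr_gt0// exprn_gt0.
  have [m] := radius_small tpos.
  rewrite le_min ler_pdivlMr ?mulr_gt0 ?exprn_gt0// => /andP[h1 h2].
  have rmrho : r_ m <= rho by exact: le_trans h1 delta_rho.
  have Crm : C * r_ m <= rho by apply: le_trans Cdelta; rewrite ler_pM2l.
  have [d1 n1] := dc_near hD (dc_dom_refl hD _) (nself _) rmrho (inbob m).
  have [d2 n2] := dc_near hD (dc_dom_refl hD _) (nself _) rmrho (hz m I).
  rewrite !(dc_refl hD) !subr0 in n1 n2.
  apply: (hs _ (lexx s)).
  apply: le_trans (dc_dist hD d2 d1 (le_trans n2 Crm) (le_trans n1 Crm)) _.
  rewrite lee_fin; apply: le_trans h2.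
  rewrite (_ : r_ m * (2 * C ^+ 2) = C * (C * r_ m + C * r_ m)); last by ring.
  by rewrite ler_pM2l//; apply: le_trans (cs_N_sub hC _ _ _) _; exact: lerD.
move=> cy.
pose e := Num.min rho (eps / C).
have e0 : 0 < e by rewrite lt_min rho0 divr_gt0.
have [_ [[k _ <-] [dk nk]]] := cy _ (hnbhs y e0).
have [m [h1 h2 h3]] := window_cover k.
apply: (avoid h1 h2 h3 (inctr m h1)).
have [er ee] : e <= rho /\ C * e <= eps.
  rewrite /e; split; first by rewrite ge_min lexx.
  by rewrite mulrC -ler_pdivlMr// ge_min lexx orbT.
apply: le_trans (dc_dist hD dk (dc_dom_refl hD y) (le_trans nk er) (nself y)) _.
rewrite (dc_refl hD) sub0r (cs_NN hC) lee_fin; apply: le_trans ee.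
by rewrite ler_pM2l.
Qed.

End Play.

Theorem orbit_avoiding_winning : winning d (orbit_avoiding f y).
Proof.
have C0 := cs_C0 hC; have C1 := cs_C hC.
have B0 := pert_const_gt0 hC; have B1 := pert_const_ge1 hC.
have s00 := scale0_gt0 hC hD; have rho0 := dc_rho hD.
have C2 : 1 <= C ^+ 2 by exact: exprn_ege1.
have a0 : 0 < alpha0 by rewrite divr_gt0 ?invr_gt0 ?mulr_gt0 ?exprn_gt0.
have slackE : slack = 2 * C ^+ 2 * alpha0.
  by rewrite mulrC divfK// gt_eqF// mulr_gt0// exprn_gt0.
have sa : alpha0 <= slack by rewrite slackE ler_peMl ?ltW//; lra.
have a1 : alpha0 < 1.
  have h : slack * (16 * C ^+ 3) = 1.
    by rewrite mulVf// gt_eqF// mulr_gt0// exprn_gt0.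
  have C3 : 1 <= C ^+ 3 by exact: exprn_ege1.
  have := ler_wpM2l (ltW (lt_le_trans a0 sa)) C3; lra.
exists alpha0; split; first by rewrite a0.
move=> beta beta01; have /andP[b0 b1] := beta01.
have ab0 : 0 < alpha0 * beta by rewrite mulr_gt0.
have ab1 : alpha0 * beta < 1 by nra.
have Cd1 : 1 <= Cd.
  have h : 1 <= C ^+ 5 by exact: exprn_ege1.
  have := ler_pM ler01 ler01 h B1; rewrite /dist_const; lra.
have th0 : 0 < alpha0 * beta / Cd by rewrite divr_gt0//; lra.
have th1 : alpha0 * beta / Cd <= 1.
  by rewrite ler_pdivrMr; lra.
have [delta0 d00 hdelta0] := avoiding_round hC hD y th0 th1.
have := @small_scale R [:: (1, delta0); (C ^+ 2, rho);
  (2 * C ^+ 3 / (alpha0 * beta), scale0)].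
case; first by rewrite /= d00 rho0 s00.
move=> delta1 d10 /= /and4P[g1 g2 g3 _].
rewrite mul1r in g1.
(* The scale [delta] will depend on the first radius of Bob, so [eps] has to be a function of it,
   with an arbitrary value outside the admissible range. *)
have [eps heps] := choice (fun delta : R =>
  match pselect (0 < delta /\ delta <= delta0) with
  | left h => let: ex_intro2 e e0 he := hdelta0 delta h.1 h.2 in
      ex_intro (fun e => 0 < delta -> delta <= delta0 -> 0 < e /\ _) e
        (fun _ _ => conj e0 he)
  | right nh => ex_intro _ (0 : R) (fun h1 h2 => False_ind _ (nh (conj h1 h2)))
  end).
have [mv hmv] : exists mv : R -> M -> R -> M, forall delta x r,
    0 < delta -> delta <= delta0 -> 0 < r -> r <= delta ->
    (forall z, (d (mv delta x r) z <= (slack * r)%:E)%E -> (d x z <= r%:E)%E) /\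
    (forall k, alpha0 * beta / Cd * delta < A k x * r -> A k x * r <= delta ->
     forall z, (d (mv delta x r) z <= (slack * r)%:E)%E ->
       ~ (d (iter k f z) y <= (eps delta)%:E)%E).
  have h (p : R * M * R) : exists x', 0 < p.1.1 -> p.1.1 <= delta0 -> 0 < p.2 ->
    p.2 <= p.1.1 ->
    (forall z, (d x' z <= (slack * p.2)%:E)%E -> (d p.1.2 z <= p.2%:E)%E) /\
    (forall k, alpha0 * beta / Cd * p.1.1 < A k p.1.2 * p.2 -> A k p.1.2 * p.2 <= p.1.1 ->
     forall z, (d x' z <= (slack * p.2)%:E)%E ->
       ~ (d (iter k f z) y <= (eps p.1.1)%:E)%E).
    case: p => -[delta x] r /=.
    have [[h1 [h2 [h3 h4]]]|nh] :=
      pselect (0 < delta /\ delta <= delta0 /\ 0 < r /\ r <= delta).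
      have [_ /(_ x r h3 h4)[x' hx']] := heps delta h1 h2.
      by exists x'.
    by exists x => h1 h2 h3 h4; exfalso; apply: nh.
  have [mv hmv] := choice h.
  by exists (fun delta x r => mv (delta, x, r)) => delta x r; exact: (hmv (delta, x, r)).
(* The scale is recomputed from the first move of Bob, so it is constant during a play, and it is at
   most the first radius, as [window_cover] requires. While the ball is larger, Alice keeps its
   centre. The default [(y, 1)] is never read, since the list of moves is not empty. *)
pose strat (s : seq (M * R)) : M :=
  let c := last (head (y, 1) s) s in
  let delta := Num.min delta1 (head (y, 1) s).2 in
  if c.2 <= delta then mv delta c.1 c.2 else c.1.
exists strat => bob.
pose delta := Num.min delta1 (bob 0%N).2.
have stratE k : strat (mkseq bob k.+1) =
    if (bob k).2 <= delta then mv delta (bob k).1 (bob k).2 else (bob k).1.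
  rewrite /strat (_ : head _ (mkseq bob k.+1) = bob 0%N)//.
  by rewrite -nth_last size_mkseq nth_mkseq.
have dd1 : delta <= delta1 by rewrite ge_min lexx.
have dd0 : delta <= delta0 by apply: le_trans g1.
have legal k : 0 < delta -> 0 < (bob k).2 -> alice_legal d alpha0 strat bob k.
  move=> dpos rk z; rewrite /game_ball /alice_move /= stratE.
  case: ifPn => [hr hz|_ hz].
    have [h _] := hmv delta (bob k).1 (bob k).2 dpos dd0 rk hr.
    apply: h; apply: le_trans hz _.
    by rewrite lee_fin ler_pM2r.
  by apply: le_trans hz _; rewrite lee_fin ger_pMl// ltW.
split.
  move=> k hk.
  have rpos j : (j <= k)%N -> 0 < (bob j).2.
    elim: j => [|j IH] jk; first exact: (hk 0%N).
    have [_ ->] := hk j.+1 jk.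
    by rewrite /alice_move /= mulr_gt0// mulr_gt0// IH// ltnW.
  apply: legal; last exact: rpos.
  by rewrite lt_min d10 rpos.
move=> hall.
have rpos j : 0 < (bob j).2.
  elim: j => [|j IH]; first exact: (hall 0%N).
  by have [_ ->] := hall j.+1; rewrite /alice_move /= mulr_gt0// mulr_gt0.
have dpos : 0 < delta by rewrite lt_min d10 rpos.
have mono c b : 0 <= c -> c * delta1 <= b -> c * delta <= b.
  by move=> c0; apply: le_trans; rewrite ler_wpM2l.
apply: (@play_won beta delta (eps delta) bob (fun k => strat (mkseq bob k.+1))) => //.
- by have [] := heps delta dpos dd0.
- by apply: mono g2; lra.
- by apply: mono g3; rewrite ltW// divr_gt0// mulr_gt0// exprn_gt0.
- by rewrite ge_min lexx orbT.
- by move=> m; have [_ ->] := hall m.+1.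
- by move=> m z; exact: legal.
- by move=> m z; have [h _] := hall m.+1; exact: h.
- move=> m hm z; rewrite stratE hm => hz.
  by have [h _] := hmv delta (bob m).1 (bob m).2 dpos dd0 (rpos m) hm; exact: h.
- move=> m hm k k1 k2 z; rewrite stratE hm => hz.
  have [_ h] := hmv delta (bob m).1 (bob m).2 dpos dd0 (rpos m) hm.
  exact: h hz.
Qed.

End Game.

(** * Anosov diffeomorphisms *)

Section Assembly.
Variables (R : realType) (n : nat) (M : topologicalType).
Variables (A : smooth_structure R n M) (g h : riemannian_metric A).
Variables (f : M -> M) (Es Eu : M -> {vspace 'rV[R]_n}) (lambda sigma : R).
Hypotheses (splitting : invariant_splitting A f Es Eu)
  (lambda1 : lambda < 1) (sigma1 : 1 < sigma).
Hypothesis contracting : forall x v, v \in Es x -> tnorm h x v = 1 ->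
  tnorm h (f x) (tangent_map A f x v) < lambda.
Hypothesis expanding : forall x v, v \in Eu x -> tnorm h x v = 1 ->
  sigma < tnorm h (f x) (tangent_map A f x v).
Hypothesis conformal : conformal_on g f Eu.

Variables (kappa : M -> chart R n M) (C0 r0 d0 : R).
Hypotheses (C01 : 1 <= C0) (r00 : 0 < r0) (d00 : 0 < d0).
Hypothesis kappa_atlas : forall x, atlas A (kappa x).
Hypothesis kappa_dom : forall x, chart_dom (kappa x) x.
Hypothesis kappa_comparable : forall x a,
  `|a - chart_map (kappa x) x| <= 7 * r0 -> comparable_at g h (kappa x) C0 a.
Hypothesis kappa_taylor : forall x, taylor_at f (kappa x) (kappa (f x)) d0 x.
Hypothesis smooth_f : Ck_map A 2 f.

(** Displacements are measured in the uniform chart [kappa x] and carried by [T] to the coordinates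
    of [chart_at], in which [tangent_map], the splitting and the metrics are expressed. *)
Let T x : {linear 'rV[R]_n -> 'rV[R]_n} := to_tangent A (kappa x) x.
Let D (x : M) : {linear 'rV[R]_n -> 'rV[R]_n} := tangent_map A f x.
Let Pu (x : M) : {linear 'rV[R]_n -> 'rV[R]_n} := daddv_pi (Eu x) (Es x).
Let Dl x z : 'rV[R]_n := T x (chart_map (kappa x) z - chart_map (kappa x) x).
Let dom x z : Prop := chart_dom (kappa x) z.

Let C0_gt0 : 0 < C0. Proof. exact: lt_le_trans C01. Qed.

Let TK x : cancel (T x) (of_tangent A (kappa x) x).
Proof. exact: to_tangentK. Qed.

Let KT x : cancel (of_tangent A (kappa x) x) (T x).
Proof. exact: of_tangentK. Qed.

Let T_comparable x v :
  [/\ `|v| <= C0 * tnorm g x (T x v), tnorm g x (T x v) <= C0 * `|v|,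
      `|v| <= C0 * tnorm h x (T x v) & tnorm h x (T x v) <= C0 * `|v|].
Proof.
have h0 : `|chart_map (kappa x) x - chart_map (kappa x) x| <= 7 * r0.
  by rewrite subrr normr0 mulr_ge0// ltW.
have [_ hv] := kappa_comparable h0.
have e1 := tangent_of_coordE A v (kappa_dom x).
have e2 := chart_mapK (kappa_dom x).
have := hv v; rewrite e1 e2.
exact: id.
Qed.

Let D_T x v : D x (T x v) =
  T (f x) ('d (local_rep (kappa x) (kappa (f x)) f) (chart_map (kappa x) x) v).
Proof.
exact: (tangent_map_to_tangent v smooth_f (kappa_atlas x) (kappa_atlas (f x))
  (kappa_dom x) (kappa_dom (f x))).
Qed.

Let Esum x : (Eu x + Es x)%VS = fullv.
Proof. by have [e _ _ _ _] := splitting x; rewrite addvC. Qed.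

Let Ecap x : (Eu x :&: Es x)%VS = 0%VS.
Proof. by have [_ e _ _ _] := splitting x; rewrite capvC. Qed.

Let Ecap' x : (Es x :&: Eu x)%VS = 0%VS.
Proof. by have [_ e _ _ _] := splitting x. Qed.

Let Pu_in x v : Pu x v \in Eu x. Proof. exact: memv_pi. Qed.

Let Pu_id x v : v \in Eu x -> Pu x v = v.
Proof. exact: daddv_pi_id. Qed.

Let Ps_in x v : v - Pu x v \in Es x.
Proof.
have hv : v \in (Eu x + Es x)%VS by rewrite Esum memvf.
have <- : daddv_pi (Es x) (Eu x) v = v - Pu x v.
  apply: (addrI (Pu x v)); rewrite addrCA subrr addr0.
  exact: daddv_pi_add (Ecap x) hv.
exact: memv_pi.
Qed.

Let Pu_stable x v : v \in Es x -> Pu x v = 0.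
Proof.
move=> vs; have hv : v \in (Eu x + Es x)%VS by rewrite Esum memvf.
have := daddv_pi_add (Ecap x) hv; rewrite (daddv_pi_id (Ecap' x) vs) => e.
by apply: (addIr v); rewrite add0r.
Qed.

Let D_Eu x v : v \in Eu x -> D x v \in Eu (f x).
Proof.
by have [_ _ _ _ e] := splitting x => hv; rewrite -e memv_img.
Qed.

Let D_Es x v : v \in Es x -> D x v \in Es (f x).
Proof.
by have [_ _ _ e _] := splitting x => hv; rewrite -e memv_img.
Qed.

Let Pu_D x v : Pu (f x) (D x v) = D x (Pu x v).
Proof.
rewrite -{1}(subrK (Pu x v) v) linearD linearD.
have e1 := Pu_stable (D_Es (Ps_in x v)).
have e2 := Pu_id (D_Eu (Pu_in x v)).
exact: etrans (congr2 +%R e1 e2) (add0r _).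
Qed.

Let D_homog (x : M) (v : 'rV[R]_n) :
  tnorm h x v != 0 -> tnorm h x ((tnorm h x v)^-1 *: v) = 1.
Proof.
by move=> v0; rewrite tnormZ normfV ger0_norm ?tnorm_ge0// mulVf.
Qed.

Let D_scale (x : M) (v : 'rV[R]_n) : tnorm h x v != 0 ->
  tnorm h (f x) (D x ((tnorm h x v)^-1 *: v)) =
  (tnorm h x v)^-1 * tnorm h (f x) (D x v).
Proof.
by move=> v0; rewrite linearZ tnormZ normfV ger0_norm ?tnorm_ge0.
Qed.

Let D_contract x v : v \in Es x -> tnorm h (f x) (D x v) <= tnorm h x v.
Proof.
move=> vs; have [v0|v0] := eqVneq (tnorm h x v) 0.
  have e : v = 0 := tnorm_eq0 v0.
  rewrite v0 e linear0; have e0 : tnorm h (f x) 0 = 0.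
    by rewrite -(scale0r 0) tnormZ normr0 mul0r.
  by rewrite e0.
have vpos : 0 < tnorm h x v by rewrite lt_neqAle eq_sym v0 tnorm_ge0.
have vs' : (tnorm h x v)^-1 *: v \in Es x by rewrite memvZ.
have := contracting vs' (D_homog v0); rewrite -/(D x _) (D_scale v0).
rewrite mulrC ltr_pdivrMr// => /ltW/le_trans; apply.
by rewrite ler_piMl ?ltW// (ltW lambda1).
Qed.

Let D_expand x v : v \in Eu x -> sigma * tnorm h x v <= tnorm h (f x) (D x v).
Proof.
move=> vs; have [v0|v0] := eqVneq (tnorm h x v) 0.
  by rewrite v0 mulr0 tnorm_ge0.
have vpos : 0 < tnorm h x v by rewrite lt_neqAle eq_sym v0 tnorm_ge0.
have vs' : (tnorm h x v)^-1 *: v \in Eu x by rewrite memvZ.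
have := expanding vs' (D_homog v0); rewrite -/(D x _) (D_scale v0).
by rewrite mulrC ltr_pdivlMr// => /ltW.
Qed.

Let h_le_g x v : tnorm h x v <= C0 ^+ 2 * tnorm g x v.
Proof.
rewrite -(KT x v); have [h1 _ _ h4] := T_comparable x (of_tangent A (kappa x) x v).
by apply: le_trans h4 _; rewrite expr2 -mulrA ler_pM2l.
Qed.

Let g_le_h x v : tnorm g x v <= C0 ^+ 2 * tnorm h x v.
Proof.
rewrite -(KT x v); have [_ h2 h3 _] := T_comparable x (of_tangent A (kappa x) x v).
by apply: le_trans h2 _; rewrite expr2 -mulrA ler_pM2l.
Qed.

Let L0 := C0 ^+ 2 / d0.

Let D_bound x v : tnorm h (f x) (D x v) <= L0 * tnorm h x v.
Proof.
have hw w : tnorm h (f x) (D x (T x w)) <= L0 * tnorm h x (T x w); last first.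
  by have := hw (of_tangent A (kappa x) x v); rewrite (KT x v).
rewrite D_T; have [_ _ _ h4] := T_comparable (f x)
  ('d (local_rep (kappa x) (kappa (f x)) f) (chart_map (kappa x) x) w).
apply: le_trans h4 _; have [hd _] := kappa_taylor x.
have [_ _ h3 _] := T_comparable x w.
apply: (@le_trans _ _ (C0 * (d0^-1 * (C0 * tnorm h x (T x w))))).
  rewrite ler_pM2l//; apply: le_trans (hd w) _.
  by rewrite ler_pM2l// invr_gt0.
by rewrite le_eqVlt; apply/orP; left; apply/eqP; rewrite /L0; ring.
Qed.

Let Q0 := (L0 + 1) / (sigma - 1).

Let L00 : 0 < L0. Proof. by rewrite divr_gt0// exprn_gt0. Qed.
Let Q00 : 0 < Q0.
Proof. by rewrite divr_gt0 ?subr_gt0// addr_gt0. Qed.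

(** With p the unstable part of v: sigma |p| <= |D p| <= |D v| + |D (v - p)| <= L0 |v| + |v| + |p|,
    which is solved for |p|. Uniform hyperbolicity thus bounds the projection directly, with no
    continuity of the splitting. *)
Let Pu_bound_h x v : tnorm h x (Pu x v) <= Q0 * tnorm h x v.
Proof.
have h1 := D_expand (Pu_in x v).
have h2 := D_contract (Ps_in x v).
have h3 := D_bound x v.
have h4 : tnorm h (f x) (D x (Pu x v)) <=
    tnorm h (f x) (D x v) + tnorm h (f x) (D x (v - Pu x v)).
  have -> : D x (Pu x v) = D x v + (-1) *: D x (v - Pu x v).
    by rewrite linearB scaleN1r opprB addrC subrK.
  apply: le_trans (tnormD _ _ _ _) _.
  by rewrite tnormZ normrN normr1 mul1r.
have h5 : tnorm h x (v - Pu x v) <= tnorm h x v + tnorm h x (Pu x v).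
  rewrite -scaleN1r; apply: le_trans (tnormD _ _ _ _) _.
  by rewrite tnormZ normrN normr1 mul1r.
rewrite /Q0 mulrAC ler_pdivlMr ?subr_gt0//.
move: h1 h2 h3 h4 h5; lra.
Qed.

(** Three requirements added up: the comparison of [g] with [h], the bound on the projection in [g],
    and the constant of [dist_le_chart]. *)
Let C1 := C0 ^+ 2 + C0 ^+ 4 * Q0 + pi / 2 * C0 ^+ 2.

Let pi0 : 0 < pi / 2 :> R. Proof. by rewrite divr_gt0// pi_gt0. Qed.
Let C02 : 1 <= C0 ^+ 2. Proof. exact: exprn_ege1. Qed.
Let C1_ge : C0 ^+ 2 <= C1.
Proof.
rewrite /C1 -addrA lerDl; apply: addr_ge0; apply: mulr_ge0; apply: ltW => //;
  by rewrite exprn_gt0.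
Qed.
Let C1_geQ : C0 ^+ 4 * Q0 <= C1.
Proof.
rewrite /C1 addrAC lerDr; apply: addr_ge0; first exact: exprn_ge0 (ltW C0_gt0).
by apply: mulr_ge0; apply: ltW => //; rewrite exprn_gt0.
Qed.
Let C1_gepi : pi / 2 * C0 ^+ 2 <= C1.
Proof.
rewrite /C1 lerDr; apply: addr_ge0; first exact: exprn_ge0 (ltW C0_gt0).
by apply: mulr_ge0; apply: ltW => //; rewrite exprn_gt0.
Qed.

Lemma anosov_conformal_splitting : exists a, conformal_splitting f D (tnorm g) (tnorm h) a Pu C1 sigma.
Proof.
have ex x : exists a, 0 <= a /\ forall v, v \in Eu x ->
    tnorm g (f x) (D x v) = a * tnorm g x v.
  have [a [L [_ hL hD]]] := conformal x.
  exists `|a|; split => // v vu.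
  apply: etrans (congr1 (tnorm g (f x)) (hD v vu)) _.
  by rewrite tnormZ (hL v vu).
have [a ha] := choice ex.
have g0 x v : 0 <= tnorm g x v by exact: tnorm_ge0.
have h0 x v : 0 <= tnorm h x v by exact: tnorm_ge0.
have unit x : exists2 v, v \in Eu x & tnorm g x v = 1.
  have [_ _ [_ hu] _ _] := splitting x.
  have v0 : vpick (Eu x) != 0 by rewrite vpick0.
  have n0 : tnorm g x (vpick (Eu x)) != 0.
    by apply: contra v0 => /eqP/tnorm_eq0/eqP.
  exists ((tnorm g x (vpick (Eu x)))^-1 *: vpick (Eu x)).
    by rewrite memvZ// memv_pick.
  by rewrite tnormZ normfV ger0_norm// mulVf.
exists a; split.
- exact: le_trans C02 C1_ge.
- exact: sigma1.
- by move=> x v w; exact: tnormD.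
- by move=> x c v; exact: tnormZ.
- by move=> x v; exact: tnorm_eq0.
- by move=> x v w; exact: tnormD.
- by move=> x v; apply: le_trans (h_le_g x v) _; rewrite ler_wpM2r.
- by move=> x v; apply: le_trans (g_le_h x v) _; rewrite ler_wpM2r.
- move=> x v; apply: (@le_trans _ _ (C0 ^+ 4 * Q0 * tnorm g x v)); last first.
    by rewrite ler_wpM2r.
  apply: le_trans (g_le_h x _) _.
  rewrite (_ : C0 ^+ 4 * Q0 * tnorm g x v = C0 ^+ 2 * (Q0 * (C0 ^+ 2 * tnorm g x v))); last by ring.
  rewrite ler_pM2l ?exprn_gt0//; apply: le_trans (Pu_bound_h x v) _.
  by rewrite ler_pM2l.
- by move=> x v; apply: Pu_id; exact: Pu_in.
- exact: Pu_D.
- by move=> x; have [] := ha x.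
- exists (C0 ^+ 2 * (L0 * C0 ^+ 2)) => x.
  have [v vu nv] := unit x; have [_ hv] := ha x.
  have := hv v vu; rewrite nv mulr1 => <-.
  apply: le_trans (g_le_h _ _) _; rewrite ler_pM2l ?exprn_gt0//.
  apply: le_trans (D_bound x v) _; rewrite ler_pM2l//.
  by have := h_le_g x v; rewrite nv mulr1.
- by move=> x v; have [_ hv] := ha x; apply: hv; exact: Pu_in.
- by move=> x v; apply: D_expand; exact: Pu_in.
- by move=> x v; apply: D_contract; exact: Ps_in.
- by move=> x; have [v vu nv] := unit x; exists v => //; exact: Pu_id.
Qed.

(** A displacement of norm at most [rho] has coordinates at most [r0 / 2], which leaves a ball of
    radius [r0] inside the region of comparability, and at most [d0], the scale of the Taylor
    estimate. *)
Let rho := Num.min (r0 / 2) d0 / C0.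
Let K := C0 ^+ 3 / d0.

Let rho0 : 0 < rho.
Proof. by rewrite divr_gt0// lt_min d00 divr_gt0. Qed.
Let Crho : C0 * rho <= r0 / 2.
Proof. by rewrite mulrC divfK ?gt_eqF// ge_min lexx. Qed.
Let Crho_d : C0 * rho <= d0.
Proof. by rewrite mulrC divfK ?gt_eqF// ge_min lexx orbT. Qed.

Let DlB x p q : Dl x q - Dl x p = T x (chart_map (kappa x) q - chart_map (kappa x) p).
Proof.
rewrite /Dl -linearB; congr (T x _).
by rewrite opprB addrA subrK.
Qed.

Let Dl_chart x p t : tnorm g x (Dl x p) <= t ->
  `|chart_map (kappa x) p - chart_map (kappa x) x| <= C0 * t.
Proof.
move=> hp; have [h1 _ _ _] := T_comparable x (chart_map (kappa x) p - chart_map (kappa x) x).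
by apply: le_trans h1 _; rewrite ler_pM2l.
Qed.

Let Dl_chart_r x p : tnorm g x (Dl x p) <= rho ->
  `|chart_map (kappa x) p - chart_map (kappa x) x| <= r0 / 2.
Proof. by move=> /Dl_chart/le_trans; apply. Qed.

Let near_point x a b : `|b - chart_map (kappa x) x| <= r0 -> `|a - b| <= 2 * r0 ->
  comparable_at g h (kappa x) C0 a.
Proof.
move=> hb hab; apply: kappa_comparable.
rewrite -(subrK b a) -addrA; apply: le_trans (ler_normD _ _) _.
by move: r00 hb hab; lra.
Qed.

Lemma riemannian_displacement_charts :
  displacement_charts f D (tnorm g) C1 (riemannian_dist g) dom Dl rho K.
Proof.
split.
- exact: rho0.
- by rewrite divr_gt0// exprn_gt0.
- by move=> x; exact: kappa_dom.
- by move=> x; rewrite /Dl subrr linear0.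
- move=> x p q dp dq e; apply: (chart_map_inj dp dq).
  have e1 := can_inj (@TK x) e.
  exact: (addIr (- chart_map (kappa x) x) e1).
- move=> x v hv.
  pose w := of_tangent A (kappa x) x v.
  have hw : `|w| <= r0.
    have [h1 _ _ _] := T_comparable x w.
    apply: le_trans h1 _; rewrite (KT x v).
    apply: (@le_trans _ _ (C0 * rho)); first by rewrite ler_pM2l.
    by move: r00 Crho; lra.
  have [ia _] : comparable_at g h (kappa x) C0 (chart_map (kappa x) x + w).
    apply: (near_point (b := chart_map (kappa x) x)).
      by rewrite subrr normr0 ltW.
    by rewrite addrC addKr; move: r00 hw; lra.
  have [dp ep] := chart_imgP ia.
  exists (chart_inv (kappa x) (chart_map (kappa x) x + w)) => //.
  by rewrite /Dl ep addrC addKr; exact: KT.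
- move=> x p q t dp np tr hd.
  have hp := Dl_chart_r np.
  have [dq nq] : chart_dom (kappa x) q /\
      `|chart_map (kappa x) q - chart_map (kappa x) p| <= C0 * t.
    apply: (chart_le_dist (kappa_atlas x) dp r00 C0_gt0 _ hd).
      move=> a ha; have [ia hv] : comparable_at g h (kappa x) C0 a.
        by apply: (near_point (b := chart_map (kappa x) p)); move: r00 hp ha; lra.
      by split => // v; have [] := hv v.
    apply: (@le_lt_trans _ _ (C0 * rho)); first by rewrite ler_pM2l.
    by move: r00 Crho; lra.
  split => //; rewrite DlB.
  have [_ h2 _ _] := T_comparable x (chart_map (kappa x) q - chart_map (kappa x) p).
  have t0 : 0 <= t.
    have := le_trans (normr_ge0 _) nq; by rewrite pmulr_rge0.
  apply: le_trans h2 _; apply: (@le_trans _ _ (C0 ^+ 2 * t)).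
    by rewrite expr2 -mulrA ler_pM2l.
  by rewrite ler_wpM2r.
- move=> x p q dp dq np nq.
  have hp := Dl_chart_r np; have hq := Dl_chart_r nq.
  set w := chart_map (kappa x) q - chart_map (kappa x) p.
  have hw : `|w| <= r0.
    have -> : w = (chart_map (kappa x) q - chart_map (kappa x) x) -
        (chart_map (kappa x) p - chart_map (kappa x) x).
      by rewrite opprB addrA subrK.
    by apply: le_trans (ler_normB _ _) _; move: hp hq; lra.
  have := @dist_le_chart R n M A g (kappa x) (chart_map (kappa x) p) w C0 (kappa_atlas x).
  rewrite (chart_mapK dp) (_ : chart_map (kappa x) p + w = chart_map (kappa x) q); last first.
    by rewrite /w addrC subrK.
  rewrite (chart_mapK dq) => hdist; apply: le_trans (hdist _) _.
    move=> s s1; have [ia hv] : comparable_at g h (kappa x) C0 (chart_map (kappa x) p + s *: w).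
      apply: (near_point (b := chart_map (kappa x) p)); first by move: r00 hp; lra.
      rewrite addrC addKr normrZ.
      have : `|s| * `|w| <= 1 * r0 by exact: ler_pM.
      by move: r00; lra.
    by split => // v; have [] := hv v.
  rewrite lee_fin DlB -/w.
  have [h1 _ _ _] := T_comparable x w.
  apply: (@le_trans _ _ (pi / 2 * C0 ^+ 2 * tnorm g x (T x w))).
    rewrite expr2 mulrA -[X in _ <= X]mulrA ler_wpM2l// mulr_ge0// ltW//.
  by rewrite ler_wpM2r ?tnorm_ge0.
- move=> x p q t dp dq np nq tr.
  have [_ hT] := kappa_taylor x.
  have hp := Dl_chart np; have hq := Dl_chart nq.
  have td : C0 * t <= d0.
    by apply: le_trans Crho_d; rewrite ler_pM2l.
  have [dfp dfq hh] := hT p q (C0 * t) dp dq hp hq td.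
  split => //.
  rewrite !DlB D_T -linearB.
  set E := chart_map (kappa (f x)) (f p) - chart_map (kappa (f x)) (f q) - _ in hh *.
  have [_ h2 _ _] := T_comparable (f x) E.
  apply: le_trans h2 _.
  have [h1 _ _ _] := T_comparable x (chart_map (kappa x) p - chart_map (kappa x) q).
  have t0 : 0 <= t by apply: le_trans np; exact: tnorm_ge0.
  apply: (@le_trans _ _ (C0 * (d0^-1 * (C0 * t) *
     (C0 * tnorm g x (T x (chart_map (kappa x) p - chart_map (kappa x) q)))))).
    rewrite ler_pM2l//; apply: le_trans hh _.
    rewrite ler_wpM2l// mulr_ge0 ?invr_ge0 ?(ltW d00)// mulr_ge0// ltW//.
  by rewrite le_eqVlt; apply/orP; left; apply/eqP; rewrite /K; ring.
Qed.

Lemma nbhs_displacement x e : 0 < e ->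
  nbhs x [set z | dom x z /\ tnorm g x (Dl x z) <= e].
Proof.
move=> e0; have r : 0 < e / C0 by rewrite divr_gt0.
have hb := nbhsx_ballx (chart_map (kappa x) x) _ r.
have h2 : nbhs x (chart_map (kappa x) @^-1` ball (chart_map (kappa x) x) (e / C0)) :=
  chart_map_cts (kappa_dom x) hb.
apply: filterS2 (nbhs_chart_dom (kappa_dom x)) h2 => z dz.
rewrite /= -ball_normE /= distrC => hz; split => //.
have [_ h3 _ _] := T_comparable x (chart_map (kappa x) z - chart_map (kappa x) x).
apply: le_trans h3 _; rewrite mulrC -ler_pdivlMr//; exact: ltW.
Qed.

Lemma orbit_avoiding_winning_charts y : compact [set: M] ->
  winning (riemannian_dist g) (orbit_avoiding f y).
Proof.
move=> cM; have [a hC] := anosov_conformal_splitting.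
apply: (orbit_avoiding_winning y hC riemannian_displacement_charts _ cM).
exact: nbhs_displacement.
Qed.

End Assembly.

Theorem theorem1p1 (R : realType) (n : nat) (M : topologicalType)
    (A : smooth_structure R n M) (g : riemannian_metric A)
    (f : M -> M) (Es Eu : M -> {vspace 'rV[R]_n}) (y : M) :
  compact [set: M] ->
  Ck_diffeomorphism A 2 f ->
  anosov_splitting A f Es Eu ->
  conformal_on g f Eu ->
  winning (riemannian_dist g) (orbit_avoiding f y).
Proof.
move=> cM [hf _] [hsplit [lambda [sigma [sigma2 [h [l1 s1 _ hs hu]]]]]] hconf.
have [kappa [C [r [d [[C1 r0 d0] kA kd kc kt]]]]] := uniform_charts g h cM hf.
apply: (orbit_avoiding_winning_charts hsplit l1 s1 hs _ hconf C1 r0 d0 kA kd kc kt hf y cM).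
by move=> x v vu nv; have /andP[] := hu x v vu nv.
Qed.
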